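(* Let $\mathfrak{m}$ be a measure on $\mathbb{R}$ satisfying $\int_{\mathbb{R}}e^{-\varepsilon x^2}\,\mathfrak{m}(dx)<\infty$ for every $\varepsilon>0$, and let $\{\xi(t), t\in\mathbb{R}^d\}$ be a Gaussian process with $\xi(0)=0$. Assume that for some $t_0$, $\xi(t_0)$ is not a.s. $0$. Then the particle system $\mathit{GS}(\mathfrak{m},\xi)$ is stationary if and only if $\mathfrak{m}=\alpha\mathfrak{e}_{\lambda}$ for some $\alpha>0$ and $\lambda\in\mathbb{R}$, and $$\{\xi(t), t\in\mathbb{R}^d\}\stackrel{d}{=}\begin{cases}\{W(t)+f(t), t\in\mathbb{R}^d\}, & \text{if }\lambda=0,\\ \{W(t)-\lambda\sigma^2(t)/2, t\in\mathbb{R}^d\}, & \text{if }\lambda\neq 0,\end{cases}$$ for some Gaussian process $\{W(t), t\in\mathbb{R}^d\}$ with stationary increments, variance $\sigma^2(t)$, $W(0)=0$ and, eventually (that is, in the case $\lambda=0$, where $f$ occurs), an additive function $f:\mathbb{R}^d\to\mathbb{R}$.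
   Context: Gaussian system: let $\mathfrak{m}$ be a measure on $\mathbb{R}$ with $\int_{\mathbb{R}}e^{-\varepsilon x^2}\,\mathfrak{m}(dx)<\infty$ for every $\varepsilon>0$, and let $\{\xi(t),t\in\mathbb{R}^d\}$ be a real-valued Gaussian process (its mean is not assumed to be zero). Let $\{U_i, i\in\mathbb{N}\}$ be a Poisson point process on $\mathbb{R}$ with intensity measure $\mathfrak{m}$ (the case of finite $\mathfrak{m}$, in which a.s. only finitely many points exist, is not excluded), and, independently, let $\xi_i$, $i\in\mathbb{N}$, be independent copies of $\xi$. Put $V_i(t)=U_i+\xi_i(t)$. The random collection of functions $\mathfrak{P}=\{V_i, i\in\mathbb{N}\}$ is called the (independent) Gaussian particle system generated by $(\mathfrak{m},\xi)$ and denoted $\mathit{GS}(\mathfrak{m},\xi)$. For $t_1,\ldots,t_n\in\mathbb{R}^d$ let $\mathfrak{P}_{t_1,\ldots,t_n}=\{(V_i(t_1),\ldots,V_i(t_n)), i\in\mathbb{N}\}$, a point process on $\mathbb{R}^n$. The system $\mathfrak{P}$ is called stationary if for all $n\in\mathbb{N}$, $t_1,\ldots,t_n\in\mathbb{R}^d$ and $h\in\mathbb{R}^d$, $\mathfrak{P}_{t_1+h,\ldots,t_n+h}\stackrel{d}{=}\mathfrak{P}_{t_1,\ldots,t_n}$ as point processes on $\mathbb{R}^n$. Notation and conventions: $\mathfrak{e}_\lambda(dx)=e^{-\lambda x}\,dx$ for $\lambda\in\mathbb{R}$ (so $\mathfrak{e}_0$ is Lebesgue measure). A function $f:\mathbb{R}^d\to\mathbb{R}$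 is additive if $f(t_1+t_2)=f(t_1)+f(t_2)$ for all $t_1,t_2\in\mathbb{R}^d$. A process $W$ has stationary increments if the law of $\{W(t+h)-W(h),t\in\mathbb{R}^d\}$ does not depend on $h\in\mathbb{R}^d$. Processes with stationary increments are always supposed to have zero mean. The variance of $W$ is $\sigma^2(t)=\operatorname{Var}W(t)$. Equality in law of processes, $\stackrel{d}{=}$, means equality of finite-dimensional distributions.
   Formalization: The measure 𝔪 is assumed to be non-zero: for 𝔪 = 0 the particle system is a.s. empty, hence stationary for every ξ, while 𝔪 = α𝔢_λ with α > 0 fails, so the claim as written is false in that case. *)

(* Defs.v *)
From mathcomp Require Import all_boot all_order all_algebra.
From mathcomp Require Import all_classical all_reals all_analysis measurable_realfun.

Set Implicit Arguments.
Unset Strict Implicit.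
Unset Printing Implicit Defensive.

Import Order.TTheory GRing.Theory Num.Theory.
Local Open Scope classical_set_scope.
Local Open Scope ring_scope.

Definition same_fdd (R : realType) (d1 d2 dS : measure_display)
    (T1 : measurableType d1) (P1 : probability T1 R)
    (T2 : measurableType d2) (P2 : probability T2 R)
    (S : measurableType dS) (I : Type) (X : I -> T1 -> S) (Y : I -> T2 -> S) :
    Prop :=
  forall (n : nat) (t : n.-tuple I) (A : set (n.-tuple S)), measurable A ->
    P1 [set w | A [tuple X (tnth t j) w | j < n]] =
    P2 [set w | A [tuple Y (tnth t j) w | j < n]].

Definition mutually_independent (R : realType) (dO : measure_display)
    (T : measurableType dO) (P : probability T R) (I : eqType)
    (F : I -> set (set T)) : Prop :=
  forall (s : seq I) (A : I -> set T), uniq s ->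
    (forall i, i \in s -> F i (A i)) ->
    P (\bigcap_(i in [set` s]) A i) = (\prod_(i <- s) P (A i))%E.

(* Normal law with mean m and standard deviation s, including the degenerate
   case: the library's normal_prob m 0 is uniform
   on [0, 1]. *)
Definition normal_law (R : realType) (m s : R) (B : set R) : \bar R :=
  if s == 0 then \d_m B else normal_prob m s B.

Definition gaussian_process (R : realType) (dO : measure_display)
    (T : measurableType dO) (P : probability T R) (I : Type)
    (X : I -> {RV P >-> R}) : Prop :=
  forall (n : nat) (t : 'I_n -> I) (a : 'I_n -> R),
    exists m s : R, forall B : set R, measurable B ->
      P [set w | B (\sum_(j < n) a j * X (t j) w)] = normal_law m s B.

(* By convention, processes with stationary increments are centered. *)
Definition stationary_increments (R : realType) (d : nat)
    (dO : measure_display) (T : measurableType dO) (P : probability T R)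
    (W : 'rV[R]_d -> {RV P >-> R}) : Prop :=
  (forall t, P.-integrable setT (EFin \o W t) /\ ('E_P[W t] = 0)%E) /\
  forall h1 h2 : 'rV[R]_d,
    same_fdd P P (fun t w => W (t + h1) w - W h1 w)
                 (fun t w => W (t + h2) w - W h2 w).

(* Point processes on E are enumerated as X : nat -> T -> option E, the value
   X i w = None meaning that there is no i-th point; points are counted with
   multiplicity. *)
Definition pp_count (R : realType) (T E : Type) (X : nat -> T -> option E)
    (B : set E) (w : T) : \bar R :=
  (\sum_(0 <= i <oo) (\1_(Some @` B) (X i w))%:E)%E.

(* Equality in law of point processes: the joint laws of the counts of finitely
   many measurable sets agree. *)
Definition same_pp (R : realType) (d1 d2 dE : measure_display)
    (T1 : measurableType d1) (P1 : probability T1 R)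
    (T2 : measurableType d2) (P2 : probability T2 R)
    (E : measurableType dE) (X : nat -> T1 -> option E)
    (Y : nat -> T2 -> option E) : Prop :=
  same_fdd (S := \bar R) P1 P2
    (fun B : {B : set E | measurable B} => pp_count R X (sval B))
    (fun B : {B : set E | measurable B} => pp_count R Y (sval B)).

(* The argument 0 of poisson_prob is a dummy one. The mass function poisson_pmf
   is avoided because at rate 0 it is constantly 1, whereas poisson_prob 0 is
   the Dirac mass at 0. *)
Record poisson_process (R : realType) (dO dE : measure_display)
    (T : measurableType dO) (P : probability T R) (E : measurableType dE)
    (m : {measure set E -> \bar R}) (X : nat -> T -> option E) : Prop := {
  poisson_measurable : forall (i : nat) (B : set E), measurable B ->
    measurable (X i @^-1` (Some @` B));
  poisson_count : forall B : set E, measurable B -> (m B < +oo)%E ->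
    forall n : nat,
      P [set w | pp_count R X B w = n%:R%:E] =
      poisson_prob (fine (m B)) 0 [set n];
  poisson_count_infty : forall B : set E, measurable B -> m B = +oo%E ->
    P [set w | pp_count R X B w = +oo%E] = 1%E;
  poisson_independent : forall (k : nat) (B : 'I_k -> set E),
    (forall j, measurable (B j)) -> trivIset setT B ->
    mutually_independent P
      (fun j => preimage_set_system setT (pp_count R X (B j)) measurable)
}.

(* A point that does not exist carries no information: the position enters
   only through the events that the i-th point exists and lies in B. *)
Definition sigma_points (T : Type) (dE : measure_display)
    (E : measurableType dE) (X : nat -> T -> option E) : set (set T) :=
  <<s [set A | exists i (B : set E),
        measurable B /\ A = X i @^-1` (Some @` B)] >>.

Definition sigma_process (T I : Type) (dS : measure_display)
    (S : measurableType dS) (X : I -> T -> S) : set (set T) :=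
  <<s [set A | exists t (B : set S), measurable B /\ A = X t @^-1` B] >>.

(* Starting points U and motions xs that generate GS(m, xi). The index None
   stands for the Poisson process, Some i for the i-th copy of xi. *)
Record gaussian_system_data (R : realType) (d : nat) (dX dO : measure_display)
    (TX : measurableType dX) (PX : probability TX R)
    (T : measurableType dO) (P : probability T R)
    (m : {measure set R -> \bar R}) (xi : 'rV[R]_d -> {RV PX >-> R})
    (U : nat -> T -> option R) (xs : nat -> 'rV[R]_d -> {RV P >-> R}) :
    Prop := {
  gs_poisson : poisson_process P m U;
  gs_copies : forall i, same_fdd P PX (fun t => xs i t : T -> R)
                                      (fun t => xi t : TX -> R);
  gs_independent : mutually_independent P (fun o : option nat =>
    if o is Some i then sigma_process (fun t => xs i t : T -> R)
    else sigma_points U)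
}.

Definition particles (R : realType) (d : nat) (T : Type)
    (U : nat -> T -> option R) (xs : nat -> 'rV[R]_d -> T -> R) :
    nat -> T -> option ('rV[R]_d -> R) :=
  fun i w => omap (fun u t => u + xs i t w) (U i w).

Definition sample_at (R : realType) (d : nat) (T : Type)
    (V : nat -> T -> option ('rV[R]_d -> R)) (n : nat)
    (t : n.-tuple 'rV[R]_d) : nat -> T -> option (n.-tuple R) :=
  fun i w => omap (fun v => [tuple v (tnth t j) | j < n]) (V i w).

Definition stationary_system (R : realType) (d : nat) (dO : measure_display)
    (T : measurableType dO) (P : probability T R)
    (V : nat -> T -> option ('rV[R]_d -> R)) : Prop :=
  forall (n : nat) (t : n.-tuple 'rV[R]_d) (h : 'rV[R]_d),
    same_pp P P (sample_at V [tuple tnth t j + h | j < n]) (sample_at V t).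

Definition exp_measure (R : realType) (lambda : R) (B : set R) : \bar R :=
  (\int[lebesgue_measure]_(x in B) (expR (- lambda * x))%:E)%E.

(* Main.v *)
(* By the form of the Laplace functional of a Poisson process, the law of the
   particles at times t_1, ..., t_n is determined by the intensity
   D |-> \int m(du) P(u + (xi(t_1), ..., xi(t_n)) \in D), so stationarity amounts
   to the invariance of these intensities under shifts of the times.

   If m(du) = alpha e^{- lambda u} du, the translation invariance of Lebesgue
   measure turns this invariance into the tilt identity
   E[e^{lambda xi(h)} G(xi(t + h) - xi(h))] = E[G(xi(t))]. For Gaussian laws it can
   be read off the moment generating functions: the increments of xi have the
   covariances of xi, and its mean has the prescribed form.

   It remains to see that m is exponential. If xi(t) has positive variance,
   comparing the times (0, t) with (- t, 0) gives
   m(du) dy = rho(u - y) m(dy) du with log rho quadratic. Using this identity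
   twice yields rho(z) rho(- z) = 1, so log rho is affine and m has an exponential
   density. If all variances vanish, xi is an additive function f, and m is
   invariant under translations by f(t_0) / k for all k >= 1. *)
From HB Require Import structures.
From mathcomp Require Import all_boot all_order all_algebra.
From mathcomp Require Import all_classical all_reals all_analysis measurable_realfun.
From mathcomp Require Import ring lra.
Require Import Defs.

Set Implicit Arguments.
Unset Strict Implicit.
Unset Printing Implicit Defensive.

Import Order.TTheory GRing.Theory Num.Theory.
Import numFieldNormedType.Exports HBNNSimple HBSimple.
Local Open Scope classical_set_scope.
Local Open Scope ring_scope.

(** * Measures and laws *)

(** Laws are identified without Fourier analysis: the functions whose integrals are fixed by an
    everywhere finite moment generating function form a class closed under dominated limits, and
    this class contains all Borel indicators. The tool serves both for Gaussian vectors and for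
    counts of points. Counts may be [+oo], so a count N enters through [expR (- N)], which lies in
    [[0, 1]] and is governed by its mixed moments; these are values of the Laplace functional.

    That functional calls for a conditional expectation given the Poisson points, whereas
    independence is available for events only. The marks of the first M particles are therefore
    replaced by their means one at a time, before M tends to infinity.

    The Gaussian integrability of [m] acts through finiteness on bounded intervals: it yields
    sigma-finiteness for Fubini's theorem and, in the reversal argument, a set of finite positive
    mass to divide by. Nothing is assumed on the dependence of [xi] on [t]; in the degenerate case
    the times [t_0 / k] provide arbitrarily small translations in place of continuity of [f]. *)

Lemma measurable_comp2 d dA dB dS (T : measurableType d) (A : measurableType dA)
    (B : measurableType dB) (S : measurableType dS) (F : A * B -> S) (X : T -> A) (Y : T -> B) :
  measurable_fun setT F -> measurable_fun setT X -> measurable_fun setT Y ->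
  measurable_fun setT (fun w => F (X w, Y w)).
Proof.
move=> mF mX mY; apply: (measurableT_comp mF (g := fun w => (X w, Y w))).
exact/measurable_fun_pairP.
Qed.

Lemma measurable_preimage d dA (T : measurableType d) (A : measurableType dA) (X : T -> A) B :
  measurable_fun setT X -> measurable B -> measurable (X @^-1` B).
Proof. by move=> mX mB; rewrite -[X in measurable X]setTI; exact: mX. Qed.

Section MeasureTools.
Local Open Scope ereal_scope.
Context {R : realType}.

(** The measure with density [Y] with respect to [mu]. Its integration formula passes from
    indicators to simple functions and then to limits by monotone convergence, so [mu] may be any
    measure. *)
Lemma exists_density_measure d (T : measurableType d)
    (mu : {measure set T -> \bar R}) (Y : T -> R) :
  measurable_fun setT Y -> (forall w, (0 <= Y w)%R) ->
  exists nu : {measure set T -> \bar R},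
    (forall A, measurable A ->
      nu A = \int[mu]_w ((Y w)%:E * (\1_A w)%:E)) /\
    forall h : T -> \bar R, measurable_fun setT h -> (forall w, 0 <= h w) ->
      \int[nu]_w h w = \int[mu]_w ((Y w)%:E * h w).
Proof.
move=> mY Y0.
have mYE : measurable_fun setT (EFin \o Y) by exact/measurable_EFinP.
have [nu nuE] : exists nu : {measure set T -> \bar R}, forall A, measurable A ->
    nu A = \int[mu]_w ((Y w)%:E * (\1_A w)%:E).
  pose n0 (A : set T) := \int[mu]_(w in A) (Y w)%:E.
  have n00 : n0 set0 = 0 by rewrite /n0 integral_set0.
  have n0_ge A : 0 <= n0 A by apply: integral_ge0 => x _; rewrite lee_fin.
  have n0_s : semi_sigma_additive n0.
    by apply: semi_sigma_additive_nng_induced => // x; rewrite lee_fin.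
  pose M := isMeasure.Build _ _ _ n0 n00 n0_ge n0_s.
  pose nu : {measure set T -> \bar R} := HB.pack n0 M.
  exists nu => A mA; rewrite [LHS]/= /n0 integral_mkcond.
  by apply: eq_integral => w _; rewrite epatch_indic.
exists nu; split => // h mh h0.
have mhT : measurable_fun setT h by [].
pose f_ := nnsfun_approx measurableT mhT.
have ndf (x : T) : nondecreasing_seq (fun n => (f_ n x)%:E).
  by move=> a b ab; rewrite lee_fin; exact/lefP/nd_nnsfun_approx.
have cf (x : T) : (f_ n x)%:E @[n --> \oo] --> h x by exact: cvg_nnsfun_approx.
transitivity (limn (fun n => \int[nu]_w (f_ n w)%:E)).
  rewrite -monotone_convergence//.
  - by apply: eq_integral => x _; apply/esym/cvg_lim.
  - by move=> n; exact/measurable_EFinP.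
  - by move=> n x _; rewrite lee_fin.
transitivity (limn (fun n => \int[mu]_w ((Y w)%:E * (f_ n w)%:E))); last first.
  rewrite -monotone_convergence//.
  - by apply: eq_integral => x _; apply/cvg_lim => //; exact: cvgeZl.
  - by move=> n; apply: emeasurable_funM => //; exact/measurable_EFinP.
  - by move=> n x _; rewrite mule_ge0// lee_fin.
  - by move=> x _ a b ab; apply: lee_wpmul2l; [rewrite lee_fin|exact: ndf].
congr (limn _); apply/funext => n.
under eq_integral do rewrite fimfunE -fsumEFin//.
rewrite ge0_integral_fsum//; last 2 first.
  - by move=> r; apply/measurable_EFinP/measurable_funM => //; exact: measurable_indic.
  - by move=> r x _; rewrite nnfun_muleindic_ge0.
transitivity (\int[mu]_w (\sum_(k \in range (f_ n))
    (k%:E * ((Y w)%:E * (\1_(f_ n @^-1` [set k]) w)%:E)))); last first.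
  apply: eq_integral => x _; rewrite fimfunE -fsumEFin//.
  rewrite ge0_mule_fsumr; last by move=> r; rewrite nnfun_muleindic_ge0.
  by apply: eq_fsbigr => r _; rewrite EFinM muleCA.
have prod_ge0 (r : R) (x : T) :
    0 <= r%:E * ((Y x)%:E * (\1_(f_ n @^-1` [set r]) x)%:E).
  have [r0|r0] := leP 0%R r; first by rewrite !mule_ge0// lee_fin.
  by rewrite preimage_nnfun0// indic0 !mule0.
rewrite ge0_integral_fsum//; last first.
  move=> r; apply: emeasurable_funM => //; apply: emeasurable_funM => //.
  exact/measurable_EFinP/measurable_indic.
apply: eq_fsbigr => r _.
have [r0|r0] := leP 0%R r; last first.
  rewrite preimage_nnfun0// indic0.
  by rewrite !integral0_eq// => x _ /=; rewrite ?mule0 ?mulr0.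
under eq_integral do rewrite EFinM.
rewrite ge0_integralZl//; last exact/measurable_EFinP/measurable_indic.
rewrite ge0_integralZl//; last 2 first.
  - by apply: emeasurable_funM => //; exact/measurable_EFinP/measurable_indic.
  - by move=> x _; rewrite mule_ge0// lee_fin.
by congr (_ * _); rewrite integral_indic// setIT nuE.
Qed.

(** Both sides are integrals of [h] against the common image measure. *)
Lemma eq_integral_comp_law d1 d2 dS (T1 : measurableType d1)
    (T2 : measurableType d2) (S : measurableType dS)
    (mu1 : {measure set T1 -> \bar R}) (mu2 : {measure set T2 -> \bar R})
    (X1 : T1 -> S) (X2 : T2 -> S) :
  measurable_fun setT X1 -> measurable_fun setT X2 ->
  (forall A, measurable A -> mu1 (X1 @^-1` A) = mu2 (X2 @^-1` A)) ->
  forall h : S -> \bar R, measurable_fun setT h -> (forall x, 0 <= h x) ->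
    \int[mu1]_w h (X1 w) = \int[mu2]_w h (X2 w).
Proof.
move=> mX1 mX2 eqX h mh h0.
have := @ge0_integral_pushforward _ _ _ _ R _ mX1 mu1 setT h measurableT mh (fun x _ => h0 x).
have := @ge0_integral_pushforward _ _ _ _ R _ mX2 mu2 setT h measurableT mh (fun x _ => h0 x).
rewrite !preimage_setT /= => <- <-.
by apply: eq_measure_integral => A mA _; exact: eqX.
Qed.

(** The weights are absorbed into densities; the hypothesis on indicators then says that [X1] and
    [X2] have the same law. *)
Lemma eq_integral_weight d1 d2 dS (T1 : measurableType d1)
    (T2 : measurableType d2) (S : measurableType dS)
    (mu1 : {measure set T1 -> \bar R}) (mu2 : {measure set T2 -> \bar R})
    (Y1 : T1 -> R) (Y2 : T2 -> R) (X1 : T1 -> S) (X2 : T2 -> S) :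
  measurable_fun setT Y1 -> (forall w, (0 <= Y1 w)%R) ->
  measurable_fun setT Y2 -> (forall w, (0 <= Y2 w)%R) ->
  measurable_fun setT X1 -> measurable_fun setT X2 ->
  (forall A, measurable A -> \int[mu1]_w ((Y1 w)%:E * (\1_A (X1 w))%:E) =
                             \int[mu2]_w ((Y2 w)%:E * (\1_A (X2 w))%:E)) ->
  forall h : S -> \bar R, measurable_fun setT h -> (forall x, 0 <= h x) ->
    \int[mu1]_w ((Y1 w)%:E * h (X1 w)) = \int[mu2]_w ((Y2 w)%:E * h (X2 w)).
Proof.
move=> mY1 Y10 mY2 Y20 mX1 mX2 eqX h mh h0.
have [nu1 [nu1A nu1E]] := exists_density_measure mu1 mY1 Y10.
have [nu2 [nu2A nu2E]] := exists_density_measure mu2 mY2 Y20.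
rewrite -(nu1E (fun w => h (X1 w)))//; last exact: (measurableT_comp mh).
rewrite -(nu2E (fun w => h (X2 w)))//; last exact: (measurableT_comp mh).
apply: (eq_integral_comp_law mX1 mX2) => // A mA.
have mA1 : measurable (X1 @^-1` A) by apply: measurable_preimage => //; exact: mX1.
have mA2 : measurable (X2 @^-1` A) by apply: measurable_preimage => //; exact: mX2.
by rewrite nu1A// nu2A//; exact: eqX.
Qed.

(** Repackages a measure with the structure that the results on product measures expect. *)
Lemma exists_finite_measure d (T : measurableType d)
    (mu : {measure set T -> \bar R}) :
  fin_num_fun mu ->
  exists K : {finite_measure set T -> \bar R}, forall A, K A = mu A.
Proof.
move=> fmu.
pose FM := @Measure_isFinite.Axioms_ d T R _ (Measure.class mu)
  (Measure.class mu) fmu.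
pose K : {finite_measure set T -> \bar R} := HB.pack (Measure.sort mu) FM.
by exists K.
Qed.

Lemma exists_sigma_finite_measure d (T : measurableType d)
    (mu : {measure set T -> \bar R}) :
  sigma_finite setT mu ->
  exists K : {sigma_finite_measure set T -> \bar R}, forall A, K A = mu A.
Proof.
move=> fmu.
pose FM := @Measure_isSigmaFinite.Axioms_ d T R _ (Measure.class mu)
  (Measure.class mu) fmu.
pose K : {sigma_finite_measure set T -> \bar R} :=
  HB.pack (Measure.sort mu) FM.
by exists K.
Qed.

(** With [Y1] and [Y2] as densities, the hypothesis says that [(X1, Z1)] gives to rectangles the
    product of the law of [X2] and [Q]. Since [Y2] has finite mass, rectangles determine the joint
    law. This stands in for a conditional expectation: [Z1] is integrated out while a weight and
    [X1] are kept. *)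
Lemma integral_weight_product d1 d2 dS dE (T1 : measurableType d1)
    (T2 : measurableType d2) (S : measurableType dS) (E : measurableType dE)
    (mu1 : {measure set T1 -> \bar R}) (mu2 : {measure set T2 -> \bar R})
    (Q : probability E R)
    (Y1 : T1 -> R) (Y2 : T2 -> R) (X1 : T1 -> S) (Z1 : T1 -> E) (X2 : T2 -> S) :
  measurable_fun setT Y1 -> (forall w, (0 <= Y1 w)%R) ->
  measurable_fun setT Y2 -> (forall w, (0 <= Y2 w)%R) ->
  measurable_fun setT X1 -> measurable_fun setT Z1 -> measurable_fun setT X2 ->
  \int[mu2]_w (Y2 w)%:E < +oo ->
  (forall A B, measurable A -> measurable B ->
     \int[mu1]_w ((Y1 w)%:E * (\1_A (X1 w) * \1_B (Z1 w))%:E) =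
     \int[mu2]_w ((Y2 w)%:E * (\1_A (X2 w))%:E) * Q B) ->
  forall h : S * E -> \bar R, measurable_fun setT h -> (forall x, 0 <= h x) ->
    \int[mu1]_w ((Y1 w)%:E * h (X1 w, Z1 w)) =
    \int[mu2]_w ((Y2 w)%:E * \int[Q]_z h (X2 w, z)).
Proof.
move=> mY1 Y10 mY2 Y20 mX1 mZ1 mX2 Y2oo eqXZ h mh h0.
have [nu1 [nu1A nu1E]] := exists_density_measure mu1 mY1 Y10.
have [nu2 [nu2A nu2E]] := exists_density_measure mu2 mY2 Y20.
have mXZ : measurable_fun setT (fun w => (X1 w, Z1 w)) by exact/measurable_fun_pairP.
have [K KE] : exists K : {finite_measure set S -> \bar R},
    forall A, K A = nu2 (X2 @^-1` A).
  pose k0 : {measure set S -> \bar R} := pushforward nu2 X2.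
  have fink : fin_num_fun (k0 mX2).
    apply: lty_fin_num_fun; change (nu2 (X2 @^-1` setT) < +oo).
    rewrite preimage_setT.
    have := nu2E (cst 1) (measurable_cst _) (fun=> lee01).
    rewrite integral_cst// mul1e => ->.
    by under eq_integral do rewrite /= mule1.
  have [K KE] := exists_finite_measure fink.
  by exists K => A; rewrite KE.
have eqA : forall A B, measurable A -> measurable B ->
    pushforward nu1 (fun w => (X1 w, Z1 w)) (A `*` B) = K A * Q B.
  move=> A B mA mB; rewrite KE /= /pushforward.
  have mA1 : measurable (X1 @^-1` A) by apply: measurable_preimage => //; exact: mX1.
  have mB1 : measurable (Z1 @^-1` B) by apply: measurable_preimage => //; exact: mZ1.
  have mA2 : measurable (X2 @^-1` A) by apply: measurable_preimage => //; exact: mX2.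
  have -> : (fun w => (X1 w, Z1 w)) @^-1` (A `*` B) = X1 @^-1` A `&` Z1 @^-1` B by [].
  have mAB := measurableI _ _ mA1 mB1.
  have := eqXZ A B mA mB.
  have i1 w : (\1_A (X1 w) * \1_B (Z1 w))%R = \1_(X1 @^-1` A `&` Z1 @^-1` B) w :> R.
    by rewrite indicI.
  by under eq_integral do rewrite i1; rewrite -nu1A// => ->; rewrite nu2A.
have uniqm := product_measure_unique eqA.
rewrite -(nu1E (fun w => h (X1 w, Z1 w)))//; last exact: (measurableT_comp mh).
rewrite -(nu2E (fun w => \int[Q]_z h (X2 w, z)))//; first last.
- by move=> w; exact: integral_ge0.
- apply: (measurableT_comp (f := fun x => \int[Q]_z h (x, z))) => //.
  exact: measurable_fun_fubini_tonelli_F.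
have := ge0_integral_pushforward mXZ nu1 measurableT mh (fun x _ => h0 x).
rewrite preimage_setT /= => <-.
have -> : \int[nu2]_w \int[Q]_z h (X2 w, z) = \int[K]_x \int[Q]_z h (x, z).
  have mF : measurable_fun setT (fun x => \int[Q]_z h (x, z)).
    exact: measurable_fun_fubini_tonelli_F.
  have F0 x : 0 <= \int[Q]_z h (x, z) by exact: integral_ge0.
  have := ge0_integral_pushforward mX2 nu2 measurableT mF (fun x _ => F0 x).
  rewrite preimage_setT /= => <-.
  by apply: eq_measure_integral => A mA _; exact/esym/KE.
rewrite -(fubini_tonelli1 h)//.
by apply: eq_measure_integral => A mA _; exact/esym/(uniqm mXZ).
Qed.

End MeasureTools.

(** * Uniqueness of moment generating functions *)

Section ExpClass.
Context {R : realType}.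
Implicit Types (f g : R -> R) (a b c x : R).

(* Functions whose integral is determined by the moment generating function. *)
Inductive exp_class : (R -> R) -> Prop :=
| exp_class_expR a : exp_class (fun x => expR (a * x))
| exp_class_lin a f g : exp_class f -> exp_class g ->
    exp_class (fun x => a * f x + g x)
| exp_class_lim (f_ : nat -> R -> R) g C c :
    (forall k, exp_class (f_ k)) -> 0 <= c ->
    (forall k x, `|f_ k x| <= C * expR (c * `|x|)) ->
    (forall x, f_ k x @[k --> \oo] --> g x) -> exp_class g.

Lemma exp_class_eq f g : f =1 g -> exp_class f -> exp_class g.
Proof. by move=> /funext ->. Qed.

(** An exponential bound for every member keeps the product of a dominated sequence with a fixed
    member dominated. *)
Lemma exp_class_bound f : exp_class f ->
  exists C c, 0 <= c /\ forall x, `|f x| <= C * expR (c * `|x|).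
Proof.
elim => {f} [a|a f g _ [C1 [c1 [c10 h1]]] _ [C2 [c2 [c20 h2]]]|f_ g C c _ _ c0 bnd fg].
- exists 1, `|a|; split => // x; rewrite mul1r ger0_norm ?expR_ge0// ler_expR.
  by rewrite -normrM ler_norm.
- have C10 : 0 <= C1.
    by have := h1 0; rewrite normr0 mulr0 expR0 mulr1; apply: le_trans.
  have C20 : 0 <= C2.
    by have := h2 0; rewrite normr0 mulr0 expR0 mulr1; apply: le_trans.
  exists (`|a| * C1 + C2), (c1 + c2); split; first exact: addr_ge0.
  move=> x; rewrite (le_trans (ler_normD _ _))// mulrDl lerD//.
    rewrite normrM -mulrA ler_wpM2l// (le_trans (h1 x))// ler_wpM2l//.
    by rewrite ler_expR ler_wpM2r// lerDl.
  by rewrite (le_trans (h2 x))// ler_wpM2l// ler_expR ler_wpM2r// lerDr.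
- exists C, c; split => // x.
  have cg : `|f_ k x| @[k --> \oo] --> `|g x| by apply: cvg_norm; exact: fg.
  move/cvg_lim : (cg) => <- //; apply: limr_le; first by apply/cvg_ex; exists `|g x|.
  by apply: nearW => k; exact: bnd.
Qed.

Lemma exp_class_cst a : exp_class (fun=> a).
Proof.
have c1 : exp_class (fun=> 1).
  by apply: exp_class_eq (exp_class_expR 0) => x; rewrite mul0r expR0.
by apply: exp_class_eq (exp_class_lin (a - 1) c1 c1) => x; rewrite mulr1 subrK.
Qed.

Lemma exp_classD f g : exp_class f -> exp_class g ->
  exp_class (fun x => f x + g x).
Proof.
by move=> cf cg; apply: exp_class_eq (exp_class_lin 1 cf cg) => x; rewrite mul1r.
Qed.

Lemma exp_classZ a f : exp_class f -> exp_class (fun x => a * f x).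
Proof.
move=> cf; apply: exp_class_eq (exp_class_lin a cf (exp_class_cst 0)) => x.
by rewrite addr0.
Qed.

(** Double induction: exponentials multiply to exponentials, linear combinations distribute, and a
    limit is multiplied by a fixed factor whose exponential bound preserves domination. *)
Lemma exp_classM f g : exp_class f -> exp_class g ->
  exp_class (fun x => f x * g x).
Proof.
move=> cf cg; elim: cf => {f} [a|a f h _ cf _ ch|f_ h C c _ cf c0 bnd fh].
- elim: cg => {g} [b|b f g _ cf _ cg|f_ h C c _ cf c0 bnd fh].
  + by apply: exp_class_eq (exp_class_expR (a + b)) => x; rewrite mulrDl expRD.
  + apply: exp_class_eq (exp_class_lin b cf cg) => x; ring.
  + apply: (@exp_class_lim (fun k x => expR (a * x) * f_ k x) _ C (`|a| + c)) => //.
    * exact: addr_ge0.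
    * move=> k x; rewrite normrM mulrDl expRD ger0_norm ?expR_ge0// mulrCA.
      by apply: ler_pM => //; rewrite ler_expR -normrM ler_norm.
    * by move=> x; apply: cvgM; [exact: cvg_cst|exact: fh].
- by apply: exp_class_eq (exp_class_lin a cf ch) => x; ring.
- have [C' [c' [c'0 bg]]] := exp_class_bound cg.
  apply: (@exp_class_lim (fun k x => f_ k x * g x) _ (C * C') (c + c')) => //.
  + exact: addr_ge0.
  + move=> k x; rewrite normrM mulrDl expRD mulrACA; exact: ler_pM.
  + by move=> x; apply: cvgM; [exact: fh|exact: cvg_cst].
Qed.

Lemma exp_class_affine b a f : exp_class f -> exp_class (fun x => f (b * x + a)).
Proof.
elim => {f} [c|c f g _ cf _ cg|f_ h C c _ cf c0 bnd fh].
- apply: exp_class_eq (exp_classZ (expR (c * a)) (exp_class_expR (c * b))) => x.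
  by rewrite -expRD; congr expR; ring.
- exact: exp_class_lin cf cg.
- have C0 : 0 <= C.
    by have := bnd 0%N 0; rewrite normr0 mulr0 expR0 mulr1; apply: le_trans.
  apply: (@exp_class_lim (fun k x => f_ k (b * x + a)) _
    (C * expR (c * `|a|)) (c * `|b|)) => //; first exact: mulr_ge0.
  move=> k x; rewrite (le_trans (bnd _ _))// -mulrA -expRD ler_wpM2l// ler_expR.
  rewrite -mulrA -mulrDr ler_wpM2l// -normrM addrC.
  exact: ler_normD.
Qed.

(** The inequality [1 + y <= expR y], at [x / k.+1%:R] and at its opposite, encloses the quotient
    between [x] and [x * expR (x / k.+1%:R)]. *)
Lemma cvg_expR_quotient x : k.+1%:R * (expR (x / k.+1%:R) - 1) @[k --> \oo] --> x.
Proof.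
have lb k : x <= k.+1%:R * (expR (x / k.+1%:R) - 1).
  rewrite -ler_pdivrMl// lerBrDl mulrC; exact: expR_ge1Dx.
have ub k : k.+1%:R * (expR (x / k.+1%:R) - 1) <= x * expR (x / k.+1%:R).
  rewrite -ler_pdivlMl// mulrCA mulrA lerBlDr -lerBlDl.
  rewrite -{1}[expR _]mul1r -mulrBl -ler_pdivlMr ?expR_gt0// mul1r -expRN.
  exact: expR_ge1Dx.
apply: (squeeze_cvgr (f := fun=> x) (h := fun k => x * expR (x / k.+1%:R))).
- by apply: nearW => k; rewrite lb ub.
- exact: cvg_cst.
- rewrite -[X in _ --> X]mulr1; apply: cvgM; first exact: cvg_cst.
  rewrite -[X in _ --> X]expR0.
  apply: continuous_cvg; first exact: continuous_expR.
  rewrite -[X in _ --> X](mulr0 x); apply: cvgM; first exact: cvg_cst.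
  exact: cvg_harmonic.
Qed.

(** A bound uniform in [k], for dominated convergence: [expR y - 1] is at most [|y| * expR |y|] in
    absolute value, and [|x| <= expR |x|]. *)
Lemma expR_quotient_bound x k :
  `|k.+1%:R * (expR (x / k.+1%:R) - 1)| <= expR (2 * `|x|).
Proof.
have k0 : 0 < k.+1%:R :> R by [].
have key (y : R) : `|expR y - 1| <= `|y| * expR `|y|.
  have h1 := expR_ge1Dx y; have h2 := expR_ge1Dx (- y).
  have [y0|y0] := leP 0 y.
    rewrite !ger0_norm//; last by lra.
    by have := expR_gt0 y; have := expRxMexpNx_1 y; nra.
  rewrite !ltr0_norm//; last by rewrite subr_lt0 expR_lt1.
  have : 1 <= expR (- y) by rewrite -expR0 ler_expR; lra.
  by nra.
rewrite normrM normr_nat (le_trans (ler_wpM2l _ (key _)))//.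
have xk : `|x / k.+1%:R| <= `|x|.
  by rewrite normrM ler_piMr// normfV normr_nat invf_le1// ler1n.
rewrite mulrA {1}normrM normfV normr_nat.
rewrite mulrCA mulfV ?gt_eqF// mulr1 mulr_natl mulr2n expRD.
apply: ler_pM => //.
  by rewrite (le_trans _ (expR_ge1Dx _))// lerDr.
by rewrite ler_expR.
Qed.

(** The identity is the derivative at [a = 0] of [expR (a * x)], a dominated limit of difference
    quotients. With products, all polynomials follow. *)
Lemma exp_class_id : exp_class id.
Proof.
apply: (@exp_class_lim (fun k x => k.+1%:R * (expR (x / k.+1%:R) - 1)) _ 1 2) => //.
- move=> k; apply: exp_classZ; apply: exp_classD; last exact: exp_class_cst.
  by apply: exp_class_eq (exp_class_expR k.+1%:R^-1) => x; rewrite mulrC.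
- by move=> k x; rewrite mul1r; exact: expR_quotient_bound.
- exact: cvg_expR_quotient.
Qed.

Lemma exp_classX f n : exp_class f -> exp_class (fun x => f x ^+ n).
Proof.
move=> cf; elim: n => [|n ih].
  by apply: exp_class_eq (exp_class_cst 1) => x; rewrite expr0.
by apply: exp_class_eq (exp_classM cf ih) => x; rewrite exprS.
Qed.

Lemma exp_class_sum n (f_ : nat -> R -> R) : (forall i, exp_class (f_ i)) ->
  exp_class (fun x => \sum_(0 <= i < n) f_ i x).
Proof.
move=> cf; elim: n => [|n ih].
  by apply: exp_class_eq (exp_class_cst 0) => x; rewrite big_geq.
by apply: exp_class_eq (exp_classD ih (cf n)) => x; rewrite big_nat_recr.
Qed.

(** The partial sums of the sine series are polynomials dominated by [expR |x|]. A bounded function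
    of this kind is the way from exponentials to indicators. *)
Lemma exp_class_sin : exp_class sin.
Proof.
apply: (@exp_class_lim (fun k x => series (sin_coeff x) k) _ 1 1) => //.
- move=> k; apply: exp_class_sum => i.
  have := exp_classZ ((odd i)%:R * (-1) ^+ i.-1./2 / i`!%:R)
    (exp_classX i exp_class_id).
  by apply: exp_class_eq => x; rewrite /sin_coeff /= mulrAC.
- move=> k x; rewrite !mul1r.
  apply: (@le_trans _ _ (series (exp_coeff `|x|) k)).
    rewrite /series /= (le_trans (ler_norm_sum _ _ _))// ler_sum// => i _.
    rewrite /sin_coeff /exp_coeff /= !normrM normrX normfV.
    rewrite [`|i`!%:R|]ger0_norm// ler_wpM2r// ?invr_ge0//.
    rewrite normrX normrN1 expr1n mulr1.
    by case: (odd i); rewrite ?normr1 ?normr0 ?mul1r ?mul0r ?exprn_ge0.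
  rewrite /expR; apply: nondecreasing_cvgn_le; last exact: is_cvg_series_exp_coeff.
  by apply: nondecreasing_series => i _ _; rewrite exp_coeff_ge0.
- by move=> x; rewrite unlock; exact: is_cvg_series_sin_coeff.
Qed.

(* The iterates of this map push (0, 1] to 1 and [-1, 0) to -1: polynomials
   in sin approximate its sign boundedly and pointwise. *)
Let step (y : R) : R := (3 * y - y ^+ 3) / 2.

Let step_bnd y : `|y| <= 1 -> `|step y| <= 1.
Proof.
rewrite !ler_norml /step => /andP[y1 y2].
have h1 : 0 <= (1 - y) ^+ 2 * (2 + y) by rewrite mulr_ge0 ?sqr_ge0//; lra.
have h2 : 0 <= (1 + y) ^+ 2 * (2 - y) by rewrite mulr_ge0 ?sqr_ge0//; lra.
by apply/andP; split; nra.
Qed.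

Let iter_bnd n y : `|y| <= 1 -> `|iter n step y| <= 1.
Proof. by move=> y1; elim: n => //= n; exact: step_bnd. Qed.

Let iter_opp n y : iter n step (- y) = - iter n step y.
Proof. by elim: n => //= n ->; rewrite /step; field. Qed.

(** In [1 - step z = (1 - z) * ((1 - z) * (2 + z) / 2)] the second factor is at most [1 - z / 2],
    hence at most [1 - y / 2] as long as [z >= y]: the distance to 1 decays geometrically. *)
Let iter_pos n y : 0 < y <= 1 ->
  [/\ y <= iter n step y, iter n step y <= 1 &
      1 - iter n step y <= (1 - y / 2) ^+ n].
Proof.
move=> /andP[y0 y1]; elim: n => [|n [h1 h2 h3]] /=.
  by split => //; rewrite expr0; lra.
set z := iter n step y in h1 h2 h3 *.
have e : 1 - step z = (1 - z) * ((1 - z) * (2 + z) / 2) by rewrite /step; field.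
split.
- by rewrite /step; nra.
- by have := step_bnd (y := z); rewrite !ler_norml => /(_ _)/andP[|//]; apply/andP; lra.
- rewrite e exprSr; apply: ler_pM => //; [lra|nra|nra].
Qed.

Let cvg_iter y : `|y| <= 1 -> iter n step y @[n --> \oo] --> Num.sg y.
Proof.
move=> yb.
have pos (z : R) : 0 < z <= 1 -> iter n step z @[n --> \oo] --> (1 : R).
  move=> /[dup] zb /andP[z0 z1].
  have hg : (1 - z / 2) ^+ n @[n --> \oo] --> (0 : R).
    by apply: cvg_expr; rewrite ger0_norm; lra.
  apply: (squeeze_cvgr (f := fun n => 1 - (1 - z / 2) ^+ n) (h := fun=> 1)).
  - apply: nearW => n; have [_ h2 h3] := iter_pos n zb.
    by apply/andP; split => //; lra.
  - rewrite -[X in _ --> X]subr0; apply: cvgB => //; exact: cvg_cst.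
  - exact: cvg_cst.
move: yb; rewrite ler_norml => /andP[y1 y2].
have [y0|y0|->] := ltgtP y 0.
- rewrite ltr0_sg// -[y]opprK.
  under eq_fun do rewrite iter_opp.
  by apply: cvgN; apply: pos; apply/andP; lra.
- by rewrite gtr0_sg//; apply: pos; rewrite y0.
- rewrite sgr0 (_ : (fun n => _) = fun=> 0); first exact: cvg_cst.
  apply/funext => n; apply/eqP; rewrite -[_ == 0](mulrn_eq0 _ 2) mulr2n.
  by rewrite -{1}oppr0 iter_opp addNr.
Qed.

(** For fixed [x] the number [x / k.+1%:R] eventually lies between [- pi] and [pi], where the sine
    has the sign of its argument. The sign of a sine is itself the limit of the iterates of
    [step]. *)
Lemma exp_class_sg : exp_class Num.sg.
Proof.
apply: (@exp_class_lim (fun k x => Num.sg (sin (x / k.+1%:R))) _ 1 0) => //.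
- move=> k; apply: (@exp_class_lim (fun n x => iter n step (sin (x / k.+1%:R))) _ 1 0) => //.
  + elim => [|n ih] /=.
      apply: exp_class_eq (exp_class_affine k.+1%:R^-1 0 exp_class_sin) => x.
      by rewrite addr0 mulrC.
    have := exp_class_lin (3 / 2) ih (exp_classZ (- 2^-1) (exp_classX 3 ih)).
    by apply: exp_class_eq => x; rewrite /step; field.
  + move=> n x; rewrite mul0r expR0 mulr1; apply: iter_bnd.
    by rewrite ler_norml sin_geN1 sin_le1.
  + by move=> x; apply: cvg_iter; rewrite ler_norml sin_geN1 sin_le1.
- by move=> k x; rewrite mul0r expR0 mulr1 normr_sg; case: eqP.
- move=> x; apply: cvg_near_cst.
  have pos (y : R) : 0 < y -> \forall k \near \oo, Num.sg (sin (y / k.+1%:R)) = 1.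
    move=> y0; near=> k; rewrite gtr0_sg// sin_gt0_pi// divr_gt0//=.
    rewrite ltr_pdivrMr// -ltr_pdivrMl ?pi_gt0//.
    rewrite (lt_le_trans (y := k%:R))// ?ler_nat//.
    by near: k; exact: nbhs_infty_gtr.
  have [x0|x0|->] := ltgtP x 0.
  + rewrite ltr0_sg//; have := pos (- x); rewrite oppr_gt0 => /(_ x0).
    apply: filterS => k; rewrite mulNr sinN sgrN => /eqP.
    by rewrite eqr_oppLR => /eqP.
  + by rewrite gtr0_sg//; exact: pos.
  + by apply: nearW => k; rewrite mul0r sin0.
Unshelve. all: end_near. Qed.

(** With [s] the sign of [x - c], the indicator is [(s ^+ 2 + s) / 2]. *)
Lemma exp_class_gt c : exp_class (fun x => (c < x)%R%:R).
Proof.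
have h := exp_class_affine 1 (- c) exp_class_sg.
apply: exp_class_eq (exp_classZ 2^-1 (exp_classD (exp_classX 2 h) h)) => x.
rewrite mul1r; have [xc|xc|->] := ltgtP c x.
- by rewrite gtr0_sg ?subr_gt0//=; field.
- by rewrite ltr0_sg ?subr_lt0//=; field.
- by rewrite subrr sgr0 /=; field.
Qed.

(** Sets with indicator in the class are stable under complements and finite intersections, and
    under countable unions by bounded limits of indicators; they form a sigma-algebra that contains
    the half-lines. *)
Lemma exp_class_indic (B : set R) : measurable B -> exp_class \1_B.
Proof.
pose G := [set B : set R | exp_class \1_B].
have GC B' : G B' -> G (~` B').
  move=> GB; apply: exp_class_eq (exp_classD (exp_class_cst 1) (exp_classZ (- 1) GB)) => x.
  by rewrite !indicE in_setC; case: (x \in B') => /=; ring.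
have GI B1 B2 : G B1 -> G B2 -> G (B1 `&` B2).
  move=> G1 G2; apply: exp_class_eq (exp_classM G1 G2) => x.
  by rewrite indicI.
have G0 : G set0 by apply: exp_class_eq (exp_class_cst 0) => x; rewrite indic0.
have GU (A : nat -> set R) : (forall i, G (A i)) -> G (\bigcup_i A i).
  move=> GA; pose A' n := \big[setU/set0]_(i < n) A i.
  have GA' n : G (A' n).
    rewrite /A'; elim: n => [|n ih]; first by rewrite big_ord0.
    rewrite big_ord_recr /= -[X in G X]setCK setCU; apply: (GC).
    by apply: (GI); exact: (GC).
  apply: (@exp_class_lim (fun n => \1_(A' n)) _ 1 0) => //.
    by move=> k x; rewrite mul0r expR0 mulr1 ger0_norm// indicE; case: (_ \in _).
  move=> x; apply: cvg_near_cst.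
  have [[i _ Aix]|nA] := pselect ((\bigcup_i A i) x).
    near=> n; rewrite !indicE !mem_set//; first by exists i.
    rewrite /A' -bigcup_mkord; exists i => //=; near: n; exact: nbhs_infty_gt.
  apply: nearW => n; rewrite !indicE !memNset// /A' -bigcup_mkord => -[i _ Ai].
  by apply: nA; exists i.
have sG : sigma_algebra setT G.
  by split => // A GA; rewrite setTD; exact: GC.
move=> mB; have /seteqP[/(_ B mB) + _] := RGenOInfty.measurableE R.
move: B mB => B _; move: B.
apply: smallest_sub => // _ [c ->].
apply: exp_class_eq (exp_class_gt c) => x.
by rewrite indicE; congr (_%:R); rewrite mem_setE in_itv/= andbT.
Unshelve. all: end_near. Qed.

End ExpClass.

Lemma dominated_cvg_EFin {R : realType} d (T : measurableType d)
    (mu : {measure set T -> \bar R}) (F : nat -> T -> R) (G H : T -> R) :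
  (forall k, measurable_fun setT (F k)) ->
  (forall w, F k w @[k --> \oo] --> G w) -> mu.-integrable setT (EFin \o H) ->
  (forall k w, `|F k w| <= H w) ->
  mu.-integrable setT (EFin \o G) /\
  (\int[mu]_w (F k w)%:E @[k --> \oo] --> \int[mu]_w (G w)%:E)%E.
Proof.
move=> mF cF iH bH.
have mG : measurable_fun setT G by apply: (measurable_fun_cvg mF) => w _; exact: cF.
have [] := @dominated_convergence _ _ _ mu setT measurableT
  (fun k => EFin \o F k) (EFin \o G) (EFin \o H).
- by move=> k; exact/measurable_EFinP.
- exact/measurable_EFinP.
- by apply/aeW => w _; apply/cvg_EFin; [exact: nearW|exact: cF].
- by [].
- by apply/aeW => w k _; rewrite lee_fin bH.
- by move=> ? _ ?; split.
Qed.

Section EqualIntegrals.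
Context {R : realType} d1 d2 (T1 : measurableType d1) (T2 : measurableType d2).
Variables (mu1 : {measure set T1 -> \bar R}) (mu2 : {measure set T2 -> \bar R}).

(** Integrability belongs to the relation, because linear combinations and dominated limits consume
    it on both sides. *)
Definition integrals_agree (F1 : T1 -> R) (F2 : T2 -> R) :=
  [/\ mu1.-integrable setT (EFin \o F1), mu2.-integrable setT (EFin \o F2) &
     (\int[mu1]_w (F1 w)%:E = \int[mu2]_w (F2 w)%:E)%E].

Lemma integrals_agree_lin a F1 F2 G1 G2 :
  integrals_agree F1 F2 -> integrals_agree G1 G2 ->
  integrals_agree (fun w => a * F1 w + G1 w) (fun w => a * F2 w + G2 w).
Proof.
move=> [iF1 iF2 eF] [iG1 iG2 eG].
have iaF1 : mu1.-integrable setT (fun w => a%:E * (F1 w)%:E)%E by exact: integrableZl.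
have iaF2 : mu2.-integrable setT (fun w => a%:E * (F2 w)%:E)%E by exact: integrableZl.
split.
- apply: (eq_integrable measurableT (fun w => a%:E * (F1 w)%:E + (G1 w)%:E)%E) => //.
  exact: integrableD.
- apply: (eq_integrable measurableT (fun w => a%:E * (F2 w)%:E + (G2 w)%:E)%E) => //.
  exact: integrableD.
- under eq_integral do rewrite EFinD EFinM.
  under [in RHS]eq_integral do rewrite EFinD EFinM.
  by rewrite !integralD// !integralZl// eF eG.
Qed.

Lemma integrals_agree_lim (F1 : nat -> T1 -> R) (F2 : nat -> T2 -> R) G1 G2
    (H1 : T1 -> R) (H2 : T2 -> R) :
  (forall k, integrals_agree (F1 k) (F2 k)) ->
  (forall w, F1 k w @[k --> \oo] --> G1 w) ->
  (forall w, F2 k w @[k --> \oo] --> G2 w) ->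
  mu1.-integrable setT (EFin \o H1) -> mu2.-integrable setT (EFin \o H2) ->
  (forall k w, `|F1 k w| <= H1 w) -> (forall k w, `|F2 k w| <= H2 w) ->
  integrals_agree G1 G2.
Proof.
move=> eF cF1 cF2 iH1 iH2 b1 b2.
have mE1 k : measurable_fun setT (F1 k).
  by have [/measurable_int/measurable_EFinP] := eF k.
have mE2 k : measurable_fun setT (F2 k).
  by have [_ /measurable_int/measurable_EFinP] := eF k.
have [iG1 c1] := dominated_cvg_EFin mE1 cF1 iH1 b1.
have [iG2 c2] := dominated_cvg_EFin mE2 cF2 iH2 b2.
split => //; apply: cvg_unique c1 _ => //.
rewrite (_ : (fun k => _) = (fun k => \int[mu2]_w (F2 k w)%:E)%E)//.
by apply/funext => k; have [] := eF k.
Qed.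

(** The factors [F1] and [F2] are carried along so that coordinates can be treated one after the
    other. At a limit, [expR (c * |x|)] is bounded by the sum of [expR (c * x)] and
    [expR (- c * x)], both integrable against the factor by the hypothesis at [c] and [- c]. *)
Lemma integrals_agree_exp_class (F1 X1 : T1 -> R) (F2 X2 : T2 -> R) (f : R -> R) :
  (forall a, integrals_agree (fun w => F1 w * expR (a * X1 w))
                           (fun w => F2 w * expR (a * X2 w))) ->
  exp_class f ->
  integrals_agree (fun w => F1 w * f (X1 w)) (fun w => F2 w * f (X2 w)).
Proof.
move=> eF; elim => {f} [a|a f g _ ef _ eg|f_ g C c _ ef c0 bnd fg].
- exact: eF.
- have := integrals_agree_lin a ef eg; congr (integrals_agree _ _);
  by apply/funext => w; ring.
- have C0 : 0 <= C.
    by have := bnd 0%N 0; rewrite normr0 mulr0 expR0 mulr1; apply: le_trans.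
  have dom d (T : measurableType d) (mu : {measure set T -> \bar R})
      (F X : T -> R) : (forall a, mu.-integrable setT
        (EFin \o (fun w => F w * expR (a * X w)))) ->
      mu.-integrable setT (EFin \o (fun w => C * (`|F w * expR (c * X w)| +
        `|F w * expR (- c * X w)|))) /\
      forall k w, `|F w * f_ k (X w)| <= C * (`|F w * expR (c * X w)| +
        `|F w * expR (- c * X w)|).
    move=> iF; split.
      apply: (eq_integrable measurableT (fun w => C%:E *
          (`|(F w * expR (c * X w))%:E| + `|(F w * expR (- c * X w))%:E|))%E) => //.
      apply: integrableZl => //; apply: integrableD => //.
        exact: (integrable_abse (iF c)).
      exact: (integrable_abse (iF (- c))).
    move=> k w; rewrite normrM !normrM -mulrDr mulrCA ler_wpM2l//.
    rewrite (le_trans (bnd _ _))// ler_wpM2l//.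
    rewrite ![`|expR _|]ger0_norm ?expR_ge0//.
    have [x0|x0] := leP 0 (X w); first by rewrite ger0_norm// lerDl expR_ge0.
    by rewrite ltr0_norm// mulrN -mulNr lerDr expR_ge0.
  have [iD1 bD1] := dom _ _ mu1 F1 X1 (fun a => let: And3 h _ _ := eF a in h).
  have [iD2 bD2] := dom _ _ mu2 F2 X2 (fun a => let: And3 _ h _ := eF a in h).
  apply: (integrals_agree_lim ef _ _ iD1 iD2 bD1 bD2).
  + by move=> w; apply: cvgM; [exact: cvg_cst|exact: fg].
  + by move=> w; apply: cvgM; [exact: cvg_cst|exact: fg].
Qed.

(** The exponential with arbitrary coefficients [a] stays in the statement: to insert [f i], the
    induction hypothesis is taken with [b] added to the i-th coefficient, which supplies the
    required family of exponentials of [X i]. *)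
Lemma integrals_agree_prod n (X1 : 'I_n -> T1 -> R) (X2 : 'I_n -> T2 -> R) :
  (forall a : 'I_n -> R,
    integrals_agree (fun w => expR (\sum_i a i * X1 i w))
                  (fun w => expR (\sum_i a i * X2 i w))) ->
  forall (f : 'I_n -> R -> R), (forall i, exp_class (f i)) ->
  forall (s : seq 'I_n) (a : 'I_n -> R),
  integrals_agree (fun w => (\prod_(i <- s) f i (X1 i w)) * expR (\sum_i a i * X1 i w))
                (fun w => (\prod_(i <- s) f i (X2 i w)) * expR (\sum_i a i * X2 i w)).
Proof.
move=> eX f ef; elim => [|i s ih] a.
  by under eq_fun do rewrite big_nil mul1r;
     under [X in integrals_agree _ X]eq_fun do rewrite big_nil mul1r.
have shift (x : 'I_n -> R) b : \sum_j (a j + b * (j == i)%:R) * x j =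
    \sum_j a j * x j + b * x i.
  under eq_bigr do rewrite mulrDl; rewrite big_split/=; congr (_ + _).
  rewrite (bigD1 i)//= eqxx mulr1 big1 ?addr0// => j /negbTE ->.
  by rewrite mulr0 mul0r.
have step : integrals_agree
    (fun w => ((\prod_(j <- s) f j (X1 j w)) * expR (\sum_j a j * X1 j w)) * f i (X1 i w))
    (fun w => ((\prod_(j <- s) f j (X2 j w)) * expR (\sum_j a j * X2 j w)) * f i (X2 i w)).
  apply: integrals_agree_exp_class => // b.
  have := ih (fun j => a j + b * (j == i)%:R); congr (integrals_agree _ _);
    by apply/funext => w; rewrite shift expRD mulrA.
move: step; congr (integrals_agree _ _); apply/funext => w;
  by rewrite big_cons mulrAC [X in X * expR _]mulrC.
Qed.

End EqualIntegrals.

(** The structure on tuples is generated by preimages under single coordinates. Boxes generate the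
    same sigma-algebra and are moreover closed under intersection, as uniqueness of measures
    requires. *)
Lemma measurable_tuple_boxes d (T : measurableType d) n :
  @measurable _ (n.-tuple T) = <<s [set A | exists B : 'I_n -> set T,
    (forall i, measurable (B i)) /\ A = [set t | forall i, B i (tnth t i)]] >>.
Proof.
apply/seteqP; split.
  apply: smallest_sub; first exact: smallest_sigma_algebra.
  move=> A; rewrite -bigcup_seq => -[i _ [B mB <-]].
  apply: sub_sigma_algebra; exists (fun j => if j == i then B else setT); split.
    by move=> j; case: ifP.
  apply/seteqP; split => [t [_ Bt] j|t /(_ i)]; rewrite /= ?eqxx//.
  by case: eqP => [->|].
apply: smallest_sub; first exact: sigma_algebra_measurable.
move=> _ [B [mB ->]].
rewrite (_ : [set t | _] = \bigcap_(i in [set: 'I_n]) ((@tnth n T)^~ i @^-1` B i)).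
  apply: fin_bigcap_measurable => // i _.
  by apply: measurable_preimage => //; exact: measurable_tnth.
by apply/seteqP; split => [t h i _|t h i]; [exact: h|exact: (h i)].
Qed.

Lemma measurable_mktuple {R : realType} d (T : measurableType d) n (X : 'I_n -> T -> R) :
  (forall i, measurable_fun setT (X i)) ->
  measurable_fun setT (fun w => [tuple X i w | i < n]).
Proof.
move=> mX; apply/measurable_fun_tnthP => i; rewrite (_ : _ \o _ = X i)//.
by apply/funext => w /=; rewrite tnth_mktuple.
Qed.

Lemma measurable_expR_comb {R : realType} d (T : measurableType d) n (a : 'I_n -> R)
    (X : 'I_n -> T -> R) : (forall j, measurable_fun setT (X j)) ->
  measurable_fun setT (fun w => expR (\sum_j a j * X j w)).
Proof.
move=> mX; apply: measurableT_comp => //.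
by apply: measurable_sum => j; exact: measurable_funM.
Qed.

Lemma integrable_expR_comb {R : realType} d (T : measurableType d)
    (mu : {measure set T -> \bar R}) n (a : 'I_n -> R) (X : 'I_n -> T -> R) :
  (forall j, measurable_fun setT (X j)) ->
  (\int[mu]_w (expR (\sum_j a j * X j w))%:E < +oo)%E ->
  mu.-integrable setT (EFin \o (fun w => expR (\sum_j a j * X j w))).
Proof.
move=> mX oo; apply/integrableP; split.
  exact/measurable_EFinP/measurable_expR_comb.
by under eq_integral do rewrite /= ger0_norm ?expR_ge0//.
Qed.

Section MGFUniqueness.
Context {R : realType} d1 d2 (T1 : measurableType d1) (T2 : measurableType d2).
Variables (mu1 : {measure set T1 -> \bar R}) (mu2 : {measure set T2 -> \bar R}).

(** The indicator of a box is a product of one-dimensional indicators, so [integrals_agree_prod] at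
    [a = 0] gives equality on boxes. The measures need not be probabilities; their masses are finite
    by the hypothesis at [a = 0]. This freedom serves for tilted measures. *)
Theorem mgf_unique n (X1 : 'I_n -> T1 -> R) (X2 : 'I_n -> T2 -> R) :
  (forall i, measurable_fun setT (X1 i)) ->
  (forall i, measurable_fun setT (X2 i)) ->
  (forall a : 'I_n -> R,
    integrals_agree mu1 mu2 (fun w => expR (\sum_i a i * X1 i w))
                  (fun w => expR (\sum_i a i * X2 i w))) ->
  forall A : set (n.-tuple R), measurable A ->
    mu1 [set w | A [tuple X1 i w | i < n]] = mu2 [set w | A [tuple X2 i w | i < n]].
Proof.
move=> mX1 mX2 eX A mA.
pose Z1 w := [tuple X1 i w | i < n]; pose Z2 w := [tuple X2 i w | i < n].
have mZ1 : measurable_fun setT Z1 by exact: measurable_mktuple.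
have mZ2 : measurable_fun setT Z2 by exact: measurable_mktuple.
pose M1 : {measure set (n.-tuple R) -> \bar R} := pushforward mu1 Z1.
pose M2 : {measure set (n.-tuple R) -> \bar R} := pushforward mu2 Z2.
have fin1 : (mu1 setT < +oo)%E.
  have [/integrableP[_ +] _ _] := eX (fun=> 0).
  under eq_integral => w _.
    rewrite /= big1; last by move=> i _; rewrite mul0r.
    rewrite expR0 normr1; over.
  by rewrite integral_cst// mul1e.
have eqbox (B : 'I_n -> set R) : (forall i, measurable (B i)) ->
    mu1 [set w | forall i, B i (X1 i w)] = mu2 [set w | forall i, B i (X2 i w)].
  move=> mB.
  have [_ _] := integrals_agree_prod eX (fun i => exp_class_indic (mB i))
    (index_enum 'I_n) (fun=> 0).
  have e d (T : measurableType d) (mu : {measure set T -> \bar R}) (X : 'I_n -> T -> R) :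
    (forall i, measurable_fun setT (X i)) ->
    (\int[mu]_w ((\prod_i \1_(B i) (X i w)) * expR (\sum_i 0 * X i w))%:E =
    mu [set w | forall i, B i (X i w)])%E.
    move=> mX.
    have mBX : measurable [set w | forall i, B i (X i w)].
      rewrite (_ : [set w | _] = \bigcap_(i in [set: 'I_n]) (X i @^-1` B i)).
        apply: fin_bigcap_measurable => // i _.
        by apply: measurable_preimage => //; exact: mX.
      by apply/seteqP; split => [t h i _|t h i]; [exact: h|exact: (h i)].
    transitivity (\int[mu]_w (\1_[set w | forall i, B i (X i w)] w)%:E)%E; last first.
      by rewrite integral_indic// setIT.
    apply: eq_integral => w _; congr (_%:E).
    rewrite [X in expR X]big1 ?expR0 ?mulr1; last by move=> i _; rewrite mul0r.
    rewrite indicE; have [h|] := boolP (w \in _).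
      rewrite big1// => i _; rewrite indicE mem_set//.
      by move: h; rewrite inE; exact.
    rewrite notin_setE => /existsNP[i nB].
    by rewrite (bigD1 i)//= indicE memNset// mul0r.
  by rewrite !e.
suff : M1 mZ1 A = M2 mZ2 A by [].
pose G := [set A | exists B : 'I_n -> set R,
  (forall i, measurable (B i)) /\ A = [set t : n.-tuple R | forall i, B i (tnth t i)]].
apply: (@measure_unique _ R (n.-tuple R) G (fun=> setT)) => //.
- exact: measurable_tuple_boxes.
- move=> _ _ [B [mB ->]] [C [mC ->]]; exists (fun i => B i `&` C i); split.
    by move=> i; exact: measurableI.
  by apply/seteqP; split => [t [h1 h2] i|t h]; [split|split => i; have [] := h i].
- by move=> _; exists (fun=> setT); split => //; apply/seteqP; split.
- by apply: bigcup_const; exists 0%N.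
- move=> _ [B [mB ->]]; rewrite /M1 /M2 /= /pushforward.
  have pre d (T : measurableType d) (X : 'I_n -> T -> R) :
    (fun w => [tuple X i w | i < n]) @^-1` [set t | forall i, B i (tnth t i)] =
    [set w | forall i, B i (X i w)].
    apply/seteqP; split => w /= h i; have := h i; by rewrite tnth_mktuple.
  by rewrite /Z1 /Z2 !pre eqbox.
Qed.

End MGFUniqueness.

(** * Moments of Gaussian variables *)

Section GaussianMoments.
Context {R : realType}.
Local Notation leb := (@lebesgue_measure R).

Lemma ge0_integral_normal_prob (m s : R) (h : R -> \bar R) :
  measurable_fun setT h -> (forall x, 0 <= h x)%E ->
  (\int[normal_prob m s]_x h x = \int[leb]_x ((normal_pdf m s x)%:E * h x))%E.
Proof.
move=> mh h0.
have [nu [nuA nuE]] := exists_density_measure leb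
  (measurable_normal_pdf m s) (normal_pdf_ge0 m s).
rewrite -nuE//; apply: eq_measure_integral => A mA _.
rewrite nuA//; transitivity (\int[leb]_(x in A) (normal_pdf m s x)%:E)%E => //.
rewrite [LHS]integral_mkcond; apply: eq_integral => x _.
by rewrite epatch_indic.
Qed.

(** Completing the square: [expR (a * x)] times the density with mean [m] is a constant times the
    density with mean [m + a * s ^+ 2]. *)
Lemma integral_expR_normal_prob (m s a : R) : s != 0 ->
  (\int[normal_prob m s]_x (expR (a * x))%:E =
   (expR (a * m + a ^+ 2 * s ^+ 2 / 2))%:E)%E.
Proof.
move=> s0; rewrite ge0_integral_normal_prob; first last.
- by move=> x; rewrite lee_fin expR_ge0.
- by apply/measurable_EFinP/measurableT_comp => //; exact: measurable_funM.
transitivity (\int[leb]_x ((expR (a * m + a ^+ 2 * s ^+ 2 / 2))%:E *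
    (normal_pdf (m + a * s ^+ 2) s x)%:E))%E.
  apply: eq_integral => x _; rewrite -!EFinM; congr (_%:E).
  rewrite !normal_pdfE// [RHS]mulrCA -[LHS]mulrA; congr (_ * _).
  by rewrite /normal_fun -!expRD; congr expR; field.
rewrite ge0_integralZl//.
- by rewrite integral_normal_pdf mule1.
- by apply/measurable_EFinP; exact: measurable_normal_pdf.
- by move=> x _; rewrite lee_fin normal_pdf_ge0.
Qed.

Context d (T : measurableType d) (P : probability T R).

Lemma integral_expR_normal_law (X : T -> R) (m s a : R) :
  measurable_fun setT X ->
  (forall B : set R, measurable B -> P [set w | B (X w)] = normal_law m s B) ->
  (\int[P]_w (expR (a * X w))%:E =
   (expR (a * m + a ^+ 2 * s ^+ 2 / 2))%:E)%E.
Proof.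
move=> mX lawX.
have mexp : measurable_fun setT (fun x : R => (expR (a * x))%:E).
  by apply/measurable_EFinP/measurableT_comp => //; exact: measurable_funM.
have exp0 x : (0 <= (expR (a * x))%:E)%E by rewrite lee_fin expR_ge0.
have [s0|s0] := eqVneq s 0.
  rewrite (eq_integral_comp_law (mu2 := \d_m) (X2 := @id R) mX _ _ mexp exp0)//.
    rewrite integral_dirac// diracT mul1e s0.
    by rewrite expr0n mulr0 mul0r addr0.
  by move=> A mA; rewrite [LHS]lawX// /normal_law s0 eqxx.
rewrite -integral_expR_normal_prob//.
rewrite (eq_integral_comp_law (mu2 := normal_prob m s) (X2 := @id R) mX _ _ mexp exp0)//.
by move=> A mA; rewrite [LHS]lawX// /normal_law (negbTE s0).
Qed.

Lemma integrable_expR_abs (X : T -> R) : measurable_fun setT X ->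
  (forall a, (\int[P]_w (expR (a * X w))%:E < +oo)%E) ->
  forall c, 0 <= c -> P.-integrable setT (EFin \o (fun w => expR (c * `|X w|))).
Proof.
move=> mX fX.
have iX a : P.-integrable setT (EFin \o (fun w => expR (a * X w))).
  apply/integrableP; split.
    by apply/measurable_EFinP/measurableT_comp => //; exact: measurable_funM.
  by under eq_integral do rewrite /= ger0_norm ?expR_ge0//; exact: fX.
move=> c c0; apply: (le_integrable measurableT _ _
  (integrableD measurableT (iX c) (iX (- c)))).
- apply/measurable_EFinP/measurableT_comp => //.
  by apply: measurable_funM => //; exact: measurableT_comp.
- move=> w _; rewrite /= lee_fin [leLHS]ger0_norm ?expR_ge0//.
  rewrite [leRHS]ger0_norm ?addr_ge0 ?expR_ge0//.
  have [x0|x0] := leP 0 (X w); first by rewrite ger0_norm// lerDl expR_ge0.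
  by rewrite ltr0_norm// mulrN -mulNr lerDr expR_ge0.
Qed.

Lemma integral_affine (F : T -> R) (a b : R) :
  P.-integrable setT (EFin \o F) ->
  (\int[P]_w (a * F w + b)%:E = a%:E * (\int[P]_w (F w)%:E) + b%:E)%E.
Proof.
move=> iF; under eq_integral do rewrite EFinD EFinM.
rewrite integralD//; first last.
- exact: finite_measure_integrable_cst.
- exact: integrableZl.
by rewrite integralZl// integral_cst//= probability_setT mule1.
Qed.

Lemma Lfun2_sqr (F : T -> R) : measurable_fun setT F ->
  P.-integrable setT (EFin \o (fun w => F w ^+ 2)) -> F \in Lfun P 2%:E.
Proof.
move=> mF iF2; apply/andP; split; rewrite inE//= /finite_norm unlock.
have /integrableP[_ fin] := iF2.
apply: poweR_lty; apply: le_lt_trans fin.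
rewrite ge0_le_integral//.
- by move=> w _; exact: poweR_ge0.
- apply/measurable_EFinP/(@measurableT_comp _ _ _ _ _ _ (fun x : R => x `^ 2)) => //.
  exact/measurableT_comp.
- by apply/measurableT_comp => //; apply/measurable_EFinP; exact: measurable_funX.
- by move=> w _ /=; rewrite lee_fin normrX powR_mulrn.
Qed.

(** The moments are limits of integrals of exponential difference quotients, whose values are read
    off the moment generating function. The parameter [s] is the variance. *)
Lemma centered_moments (Z : T -> R) (s : R) : measurable_fun setT Z ->
  (forall a, (\int[P]_w (expR (a * Z w))%:E = (expR (a ^+ 2 * s / 2))%:E)%E) ->
  [/\ P.-integrable setT (EFin \o Z),
      (\int[P]_w (Z w)%:E = 0)%E,
      P.-integrable setT (EFin \o (fun w => Z w ^+ 2)) &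
      (\int[P]_w (Z w ^+ 2)%:E = s%:E)%E].
Proof.
move=> mZ mgfZ.
have iabs c : 0 <= c -> P.-integrable setT (EFin \o (fun w => expR (c * `|Z w|))).
  by apply: integrable_expR_abs => // a; rewrite mgfZ ltry.
have iexp a : P.-integrable setT (EFin \o (fun w => expR (a * Z w))).
  apply: (le_integrable measurableT _ _ (iabs `|a| (normr_ge0 _))).
    by apply/measurable_EFinP/measurableT_comp => //; exact: measurable_funM.
  move=> w _; rewrite /= lee_fin [leLHS]ger0_norm ?expR_ge0//.
  by rewrite [leRHS]ger0_norm ?expR_ge0// ler_expR -normrM ler_norm.
have mexp a : measurable_fun setT (fun w => expR (a * Z w)).
  by apply: measurableT_comp => //; exact: measurable_funM.
have alg1 (K u : R) : K != 0 -> K^-1 ^+ 2 * u / 2 = u / 2 / K ^+ 2.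
  by move=> K0; field.
have alg2 (K e : R) : e != 0 ->
    e^-1 * (K * (e - 1)) ^+ 2 = K ^+ 2 * (e + e^-1) - 2 * K ^+ 2.
  by move=> e0; field.
pose D k w := k.+1%:R * (expR (Z w / k.+1%:R) - 1).
have mD k : measurable_fun setT (D k).
  apply: measurable_funM => //; apply: measurable_funB => //.
  by apply: measurableT_comp => //; exact: measurable_funM.
have cvgs : k.+1%:R ^+ 2 * (expR (s / 2 / k.+1%:R ^+ 2) - 1) @[k --> \oo] --> s / 2.
  (* The quotient is known to converge along [k.+1]; the square [k.+1 ^ 2] is the successor of this
     index. *)
  have : (k.+1 ^ 2).-1 @[k --> \oo] --> \oo.
    apply/cvgnyPge => N; near=> k.
    rewrite -ltnS prednK ?expn_gt0//; apply: (@leq_trans k.+1).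
      by rewrite ltnS; near: k; exact: nbhs_infty_ge.
    by rewrite expnS expn1 leq_pmulr.
  move=> h; have := cvg_comp _ _ h (@cvg_expR_quotient R (s / 2)).
  rewrite (_ : _ \o _ = (fun k =>
    k.+1%:R ^+ 2 * (expR (s / 2 / k.+1%:R ^+ 2) - 1)))//.
  by apply/funext => k; rewrite /comp prednK ?expn_gt0// natrX.
have [iZ cZ] := dominated_cvg_EFin mD (fun w => @cvg_expR_quotient R (Z w))
  (iabs 2 (ler0n _ _)) (fun k w => expR_quotient_bound (Z w) k).
have intD k : (\int[P]_w (D k w)%:E =
    (k.+1%:R * (expR (s / 2 / k.+1%:R ^+ 2) - 1))%:E)%E.
  have := integral_affine k.+1%:R (- k.+1%:R) (iexp k.+1%:R^-1).
  rewrite mgfZ -EFinM -EFinD.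
  have K0 : (k.+1%:R : R) != 0 by rewrite pnatr_eq0.
  have -> : k.+1%:R * expR (k.+1%:R^-1 ^+ 2 * s / 2) - k.+1%:R =
      k.+1%:R * (expR (s / 2 / k.+1%:R ^+ 2) - 1) :> R.
    by rewrite mulrBr mulr1; congr (_ * expR _ - _); exact: alg1.
  move=> <-; apply: eq_integral => w _; congr (_%:E).
  by rewrite /D mulrBr mulr1 [Z w / _]mulrC.
(* The extra factor tends to 1 and makes the expression symmetric: with [e] the exponential,
   [e^-1 * (K * (e - 1)) ^+ 2] equals [K ^+ 2 * (e + e^-1) - 2 * K ^+ 2], and [e] and [e^-1] have
   equal integrals. *)
pose D2 k w := expR (- Z w / k.+1%:R) * D k w ^+ 2.
have mD2 k : measurable_fun setT (D2 k).
  apply: measurable_funM; last exact: measurable_funX.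
  apply: measurableT_comp => //; apply: measurable_funM => //.
  exact: measurableT_comp.
have cD2 w : D2 k w @[k --> \oo] --> Z w ^+ 2.
  rewrite -[X in _ --> X]mul1r; apply: cvgM.
    rewrite -[X in _ --> X]expR0; apply: continuous_cvg; first exact: continuous_expR.
    rewrite -[X in _ --> X](mulr0 (- Z w)); apply: cvgM; first exact: cvg_cst.
    exact: cvg_harmonic.
  by rewrite expr2; apply: cvgM; exact: (@cvg_expR_quotient R (Z w)).
have bD2 k w : `|D2 k w| <= expR (5 * `|Z w|).
  have -> : 5 * `|Z w| = `|Z w| + (2 * `|Z w| + 2 * `|Z w|) by ring.
  rewrite normrM !expRD normrX expr2; apply: ler_pM => //.
    rewrite ger0_norm ?expR_ge0// ler_expR (le_trans (ler_norm _))//.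
    by rewrite normrM normrN ler_piMr// normfV normr_nat invf_le1// ler1n.
  by apply: ler_pM => //; exact: expR_quotient_bound.
have [iZ2 cZ2] := dominated_cvg_EFin mD2 cD2 (iabs 5 (ler0n _ _)) bD2.
have intD2 k : (\int[P]_w (D2 k w)%:E =
    (2 * (k.+1%:R ^+ 2 * (expR (s / 2 / k.+1%:R ^+ 2) - 1)))%:E)%E.
  have iee := integrableD measurableT (iexp k.+1%:R^-1) (iexp (- k.+1%:R^-1)).
  have iee' : P.-integrable setT (EFin \o
      (fun w => expR (k.+1%:R^-1 * Z w) + expR (- k.+1%:R^-1 * Z w))) by [].
  have := integral_affine (k.+1%:R ^+ 2) (- (2 * k.+1%:R ^+ 2)) iee'.
  under [in X in _ = X -> _]eq_integral do rewrite EFinD.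
  rewrite integralD//; [|exact: iexp|exact: iexp].
  rewrite !mgfZ -!EFinD.
  rewrite (_ : k.+1%:R ^+ 2 * _ + _ =
      2 * (k.+1%:R ^+ 2 * (expR (s / 2 / k.+1%:R ^+ 2) - 1))); last first.
    have e1 : k.+1%:R^-1 ^+ 2 * s / 2 = s / 2 / k.+1%:R ^+ 2.
      have K0 : (k.+1%:R : R) != 0 by rewrite pnatr_eq0.
      exact: alg1.
    by rewrite sqrrN e1; ring.
  move=> <-; apply: eq_integral => w _; congr (_%:E).
  rewrite /D2 /D ![Z w / _]mulrC mulNr [Z w / _]mulrC mulNr expRN.
  have e0 : expR (k.+1%:R^-1 * Z w) != 0 by rewrite gt_eqF ?expR_gt0.
  exact: alg2.
split => //.
- apply: cvg_unique cZ _ => //.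
  rewrite (_ : (fun k => _) = (fun k => (k.+1%:R^-1 *
    (k.+1%:R ^+ 2 * (expR (s / 2 / k.+1%:R ^+ 2) - 1)))%:E)); last first.
    apply/funext => k; rewrite intD; congr (_%:E).
    have K0 : (k.+1%:R : R) != 0 by rewrite pnatr_eq0.
    by rewrite expr2 -!mulrA mulKf.
  apply: cvg_EFin; first exact: nearW.
  rewrite -(mul0r (s / 2)); apply: cvgM => //.
  exact: cvg_harmonic.
- apply: cvg_unique cZ2 _ => //.
  rewrite (_ : (fun k => _) = (fun k => (2 * (k.+1%:R ^+ 2 *
    (expR (s / 2 / k.+1%:R ^+ 2) - 1)))%:E)); last exact/funext.
  apply: cvg_EFin; first exact: nearW.
  have e : 2 * (s / 2) = s by field.
  rewrite -[X in _ --> X]e.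
  by apply: cvgM => //; exact: cvg_cst.
Unshelve. all: end_near. Qed.

Lemma gaussian_moments (X : T -> R) (m s : R) : measurable_fun setT X ->
  (forall B : set R, measurable B -> P [set w | B (X w)] = normal_law m s B) ->
  [/\ X \in Lfun P 2%:E, ('E_P[X] = m%:E)%E & variance P X = (s ^+ 2)%:E].
Proof.
move=> mX lawX.
have mZ : measurable_fun setT (fun w => X w - m) by exact: measurable_funB.
have mgfZ a : (\int[P]_w (expR (a * (X w - m)))%:E =
    (expR (a ^+ 2 * s ^+ 2 / 2))%:E)%E.
  transitivity (\int[P]_w ((expR (- (a * m)))%:E * (expR (a * X w))%:E))%E.
    by apply: eq_integral => w _; rewrite -EFinM -expRD; congr (expR _)%:E; ring.
  rewrite ge0_integralZl ?lee_fin ?expR_ge0//; last first.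
    by apply/measurable_EFinP/measurableT_comp => //; exact: measurable_funM.
  rewrite (integral_expR_normal_law _ mX lawX) -EFinM -expRD.
  by congr (expR _)%:E; ring.
have [iZ Z0 iZ2 Z2] := centered_moments mZ mgfZ.
have EX : ('E_P[X] = m%:E)%E.
  rewrite unlock; have := integral_affine 1 m iZ.
  rewrite Z0 mule0 add0e => <-.
  by apply: eq_integral => w _; congr (_%:E); ring.
have Z2L : (fun w => X w - m) \in Lfun P 2%:E.
  exact/Lfun2_sqr.
split => //.
- rewrite (_ : X = (fun w => X w - m) \+ cst m); last first.
    by apply/funext => w /=; rewrite subrK.
  by rewrite rpredD ?lee1n// => ?; exact: Lfun_cst.
- rewrite /variance unlock EX /= unlock -Z2.
  by apply: eq_integral => w _; rewrite /= expr2.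
Qed.

End GaussianMoments.

(** * Laplace functional of a Poisson process *)

Section Laplace.
Context {R : realType}.
Implicit Types x y : \bar R.

(* [exp (- x)] with value 0 at [+oo], and junk value 0 at [-oo]. *)
Definition lap x : R := fine (expeR (- x)).

Lemma lap_fin (r : R) : lap r%:E = expR (- r). Proof. by []. Qed.

Lemma lap0 : lap 0%E = 1. Proof. by rewrite lap_fin oppr0 expR0. Qed.

Lemma lap_ge0 x : 0 <= lap x.
Proof. by rewrite /lap fine_ge0// expeR_ge0. Qed.

Lemma lap_le1 x : (0 <= x)%E -> lap x <= 1.
Proof.
case: x => [r| |]//.
by rewrite lee_fin lap_fin => r0; rewrite -expR0 ler_expR oppr_le0.
Qed.

Lemma lapD x y : (0 <= x)%E -> (0 <= y)%E -> lap (x + y)%E = lap x * lap y.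
Proof.
case: x => [r| |]//; case: y => [s| |]// _ _; rewrite /lap /= ?(mul0r, mulr0)//.
by rewrite opprD expRD.
Qed.

Lemma lap_sum (I : Type) (s : seq I) (F : I -> \bar R) :
  (forall i, 0 <= F i)%E -> lap (\sum_(i <- s) F i)%E = \prod_(i <- s) lap (F i).
Proof.
move=> F0; elim: s => [|i s ih]; first by rewrite !big_nil lap0.
by rewrite !big_cons lapD ?ih// sume_ge0.
Qed.

Lemma lap_le x y : (0 <= x)%E -> (x <= y)%E -> lap y <= lap x.
Proof.
case: x => [r| |]//; case: y => [s| |]//; rewrite ?lee_fin ?leye_eq// => r0 rs.
  by rewrite !lap_fin ler_expR lerN2.
by rewrite {1}/lap /= lap_ge0.
Qed.

Lemma lapE x : lap x = expR (- fine x) * \1_(~` [set +oo; -oo]%E) x.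
Proof.
rewrite indicE in_setC; case: x => [r| |] /=.
- by rewrite memNset ?mulr1//= => -[].
- by rewrite mem_set ?mulr0//=; left.
- by rewrite mem_set ?mulr0//=; right.
Qed.

Lemma measurable_lap : measurable_fun setT lap.
Proof.
rewrite (funext lapE); apply: measurable_funM.
  by apply: measurableT_comp => //; apply: measurableT_comp.
apply: measurable_indic; apply: measurableC.
by apply: measurableU; exact: emeasurable_set1.
Qed.

(** Continuity on [[0, +oo]]. At [+oo], the value is at most [e] once [u n] exceeds [- ln e]; the
    limit [-oo] is excluded by [0 <= u n]. *)
Lemma cvg_lap (u : nat -> \bar R) x : (forall n, 0 <= u n)%E ->
  u n @[n --> \oo] --> x -> lap (u n) @[n --> \oo] --> lap x.
Proof.
move=> u0; case: x => [r| |] ux.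
- have /fine_cvgP[ufin ur] := ux.
  rewrite lap_fin; apply: (@cvg_trans _ (expR (- fine (u n)) @[n --> \oo])).
    apply: near_eq_cvg; apply: filterS ufin => n un.
    by rewrite -[in RHS](fineK un).
  apply: continuous_cvg; first exact: continuous_expR.
  exact: cvgN.
- rewrite {2}/lap /=; apply/cvgrPdist_le => e e0.
  move/cvgeyPge : ux => /(_ (- ln e)); apply: filterS => n un.
  rewrite sub0r normrN ger0_norm ?lap_ge0//.
  have [ln0|ln0] := leP 0 (- ln e).
    by rewrite (le_trans (lap_le _ un))// lap_fin opprK lnK.
  have e1 : 1 <= e by rewrite leNgt; apply/negP => /ltW /ln_le0 h; lra.
  by rewrite (le_trans (lap_le1 (u0 n))).
- have : (0 <= limn u)%E.
    by apply: lime_ge; [apply/cvg_ex; exists (-oo)%E|exact: nearW].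
  by have /cvg_lim -> := ux.
Qed.

Lemma lap_inj x y : (0 <= x)%E -> (0 <= y)%E -> lap x = lap y -> x = y.
Proof.
case: x => [r| |]//; case: y => [s| |]// _ _; rewrite /lap /=.
- by move/expR_inj/oppr_inj => ->.
- by move/eqP; rewrite expR_eq0.
- by move/esym/eqP; rewrite expR_eq0.
Qed.

End Laplace.

Lemma indic01 (R : realType) (T : Type) (A : set T) x : 0 <= (\1_A x : R) <= 1.
Proof. by rewrite indicE; case: (x \in A); rewrite ?lexx ler01. Qed.

Lemma integral_bounded01 {R : realType} d (T : measurableType d) (P : probability T R)
    (F : T -> R) : measurable_fun setT F -> (forall w, 0 <= F w <= 1) ->
  (0 <= \int[P]_w (F w)%:E <= 1)%E.
Proof.
move=> mF F01; apply/andP; split.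
  by apply: integral_ge0 => w _; rewrite lee_fin; have /andP[] := F01 w.
rewrite -(@probability_setT _ _ _ P) -[leRHS]mul1e -integral_cst//.
apply: ge0_le_integral => //.
- by move=> w _; rewrite lee_fin; have /andP[] := F01 w.
- exact/measurable_EFinP.
- by move=> w _; rewrite lee_fin; have /andP[] := F01 w.
Qed.

Lemma prode01 (R : realType) (J : Type) (r : seq J) (F : J -> \bar R) :
  (forall j, 0 <= F j <= 1)%E -> (0 <= \prod_(j <- r) F j <= 1)%E.
Proof.
move=> F01; elim: r => [|j r ih]; first by rewrite big_nil lee01 lexx.
rewrite big_cons; have /andP[a0 a1] := F01 j; have /andP[b0 b1] := ih.
by rewrite mule_ge0//= -[leRHS]mule1 lee_pmul.
Qed.

Section IndependentProducts.
Context {R : realType} d dS (T : measurableType d) (S : measurableType dS).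
Variables (P : probability T R) (I : eqType) (N : I -> T -> S).
Hypothesis mN : forall i, measurable_fun setT (N i).
Hypothesis indN : mutually_independent P
  (fun i => preimage_set_system setT (N i) measurable).

(** Independence is given for events, that is, for products of indicators. In [gen] the indices in
    [s] already carry functions and those in [s2] still carry indicators. To move one index over,
    the remaining factors are viewed as a weight, and equality on indicators extends to functions by
    [eq_integral_weight]. *)
Lemma integral_prod_independent (h : I -> S -> R) (s : seq I) :
  (forall i, measurable_fun setT (h i)) -> (forall i x, 0 <= h i x <= 1) ->
  uniq s ->
  (\int[P]_w (\prod_(i <- s) h i (N i w))%:E =
   \prod_(i <- s) \int[P]_w (h i (N i w))%:E)%E.
Proof.
move=> mh h01.
have h0 i x : 0 <= h i x by have /andP[] := h01 i x.
have mhN i : measurable_fun setT (fun w => h i (N i w)).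
  exact: (measurableT_comp (mh i)).
have m1 (A : set S) i : measurable A -> measurable_fun setT (fun w => \1_A (N i w) : R).
  by move=> mA; apply: (measurableT_comp (measurable_indic mA)).
suff gen (s2 : seq I) (A : I -> set S) : (forall i, measurable (A i)) ->
    uniq (s ++ s2) ->
    (\int[P]_w ((\prod_(i <- s) h i (N i w)) * \prod_(i <- s2) \1_(A i) (N i w))%:E =
     (\prod_(i <- s) \int[P]_w (h i (N i w))%:E) *
     \prod_(i <- s2) \int[P]_w (\1_(A i) (N i w))%:E)%E.
  move=> us; have := gen [::] (fun=> setT) (fun=> measurableT).
  rewrite cats0 => /(_ us); rewrite big_nil mule1 => <-.
  by apply: eq_integral => w _; rewrite big_nil mulr1.
elim: s s2 A => [|i s ih] s2 A mA.
  rewrite cat0s big_nil mul1e => us2.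
  have mNA j : measurable (N j @^-1` A j).
    by apply: measurable_preimage => //; exact: mN.
  have intN j : (\int[P]_w (\1_(A j) (N j w))%:E = P (N j @^-1` A j))%E.
    transitivity (\int[P]_w (\1_(N j @^-1` A j) w)%:E)%E => //.
    by rewrite integral_indic// setIT.
  under [RHS]eq_bigr do rewrite intN.
  rewrite -(indN us2); last first.
    by move=> j _; exists (A j) => //; rewrite setTI.
  rewrite -[P _]/(P _) -[X in P X]setIT -integral_indic//; last first.
    exact: fin_bigcap_measurable.
  apply: eq_integral => w _; rewrite big_nil mul1r; congr (_%:E).
  rewrite indicE; have [wB|] := boolP (w \in _).
    rewrite big_seq big1// => j js; rewrite indicE mem_set//.
    by move: wB; rewrite inE => /(_ j); exact.
  rewrite notin_setE => /existsNP[j /not_implyP[js nB]].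
  by rewrite (big_rem j)//= indicE memNset// mul0r.
rewrite cat_cons => us.
pose Y w := (\prod_(j <- s) h j (N j w)) * \prod_(j <- s2) \1_(A j) (N j w).
pose c := (\prod_(j <- s) \int[P]_w (h j (N j w))%:E *
     \prod_(j <- s2) \int[P]_w (\1_(A j) (N j w))%:E)%E.
have c01 : (0 <= c <= 1)%E.
  have /andP[a0 a1] := @prode01 R _ s (fun j => \int[P]_w (h j (N j w))%:E)%E
    (fun j => integral_bounded01 P (mhN j) (fun w => h01 j _)).
  have /andP[b0 b1] := @prode01 R _ s2 (fun j => \int[P]_w (\1_(A j) (N j w))%:E)%E
    (fun j => integral_bounded01 P (m1 _ j (mA j)) (fun w => @indic01 _ _ _ _)).
  by rewrite /c mule_ge0//= -[leRHS]mule1 lee_pmul.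
have cfin : c \is a fin_num.
  by have /andP[c0 c1] := c01; rewrite ge0_fin_numE// (le_lt_trans c1)// ltry.
have mY : measurable_fun setT Y.
  apply: measurable_funM; first exact: measurable_prod.
  by apply: measurable_prod => j _; exact: m1.
have Y0 w : 0 <= Y w.
  by rewrite mulr_ge0// prodr_ge0.
have -> : (\int[P]_w ((\prod_(j <- i :: s) h j (N j w)) *
    \prod_(j <- s2) \1_(A j) (N j w))%:E = \int[P]_w ((Y w)%:E * (h i (N i w))%:E))%E.
  by apply: eq_integral => w _; rewrite -EFinM /Y big_cons; congr (_%:E); ring.
have fc0 (w : T) : 0 <= cst (fine c) w by rewrite fine_ge0//; case/andP: c01.
have key (D : set S) : measurable D ->
    (\int[P]_w ((Y w)%:E * (\1_D (N i w))%:E) =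
     \int[P]_w ((cst (fine c) w)%:E * (\1_D (N i w))%:E))%E.
  move=> mD /=; rewrite fineK//.
  have mA' j : measurable (if j == i then D else A j) by case: ifP.
  have us' : uniq (s ++ i :: s2).
    by rewrite (perm_uniq (permEl (perm_catCA s [:: i] s2))).
  have neq j : j \in s2 -> (j == i) = false.
    move=> js2; apply/eqP => ji; move: us; rewrite /= mem_cat -ji js2 orbT.
    by [].
  have ihD := ih (i :: s2) (fun j => if j == i then D else A j) mA' us'.
  rewrite ge0_integralZl//; first last.
  + by case/andP: c01.
  + by apply/measurable_EFinP; exact: m1.
  transitivity (\int[P]_w ((\prod_(i0 <- s) h i0 (N i0 w)) *
       \prod_(i0 <- i :: s2) \1_(if i0 == i then D else A i0) (N i0 w))%:E)%E.
    apply: eq_integral => w _; rewrite -EFinM /Y big_cons eqxx; congr (_%:E).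
    rewrite [RHS]mulrCA [LHS]mulrC; congr (_ * (_ * _)).
    by apply: eq_big_seq => j js2; rewrite neq.
  rewrite ihD big_cons eqxx [LHS]muleCA [RHS]muleC; congr (_ * (_ * _))%E.
  by apply: eq_big_seq => j js2; rewrite neq.
have mhi : measurable_fun setT (EFin \o h i) by exact/measurable_EFinP.
have hi0 x : (0 <= (EFin \o h i) x)%E by rewrite lee_fin.
rewrite (eq_integral_weight mY Y0 (measurable_cst (fine c)) fc0 (mN i) (mN i) key mhi hi0).
rewrite /= ge0_integralZl//; last 3 first.
- exact/measurable_EFinP.
- by move=> w _; rewrite lee_fin.
- by rewrite lee_fin fine_ge0//; case/andP: c01.
by rewrite fineK// big_cons /c muleC muleA.
Qed.

End IndependentProducts.

(** * Sums over the points of a point process *)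

Section PointSums.
Context {R : realType} d dE (T : measurableType d) (E : measurableType dE).
Variable X : nat -> T -> option E.

(** The integral of [f] against the random counting measure; the mean of [lap (pp_sum f)] is the
    Laplace functional at [f]. *)
Definition pp_sum (f : E -> R) (w : T) : \bar R :=
  (\sum_(0 <= i <oo) (oapp f 0 (X i w))%:E)%E.

Lemma pp_countE (B : set E) : pp_count R X B = pp_sum \1_B.
Proof.
apply/funext => w; rewrite /pp_count /pp_sum; apply: eq_eseriesr => i _.
congr (_%:E); case: (X i w) => [u|] /=; rewrite !indicE; last first.
  by rewrite memNset// => -[].
have [uB|uB] := boolP (u \in B).
  by rewrite mem_set//; exists u => //; exact: set_mem.
by rewrite memNset// => -[v Bv [vu]]; move/negP: uB; apply; rewrite -vu mem_set.
Qed.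

Lemma pp_sum_ge0 (f : E -> R) w : (forall x, 0 <= f x) -> (0 <= pp_sum f w)%E.
Proof. by move=> f0; apply: nneseries_ge0 => i _ _; rewrite lee_fin; case: (X i w). Qed.

Hypothesis mX : forall i B, measurable B -> measurable (X i @^-1` (Some @` B)).

Lemma measurable_oapp (f : E -> R) c i : measurable_fun setT f ->
  measurable_fun setT (fun w => oapp f c (X i w)).
Proof.
move=> mf _ B mB; rewrite setTI.
have mfB : measurable (f @^-1` B) by apply: measurable_preimage => //; exact: mf.
have mN : measurable (X i @^-1` [set None]).
  rewrite (_ : _ @^-1` _ = ~` (X i @^-1` (Some @` setT))).
    by apply: measurableC; exact: mX.
  apply/seteqP; split => w /=; first by move=> -> [].
  by case: (X i w) => // u; case; exists u.
have [cB|cB] := pselect (B c).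
  rewrite (_ : _ @^-1` B = X i @^-1` (Some @` (f @^-1` B)) `|` X i @^-1` [set None]).
    by apply: measurableU => //; exact: mX.
  apply/seteqP; split => w /=.
    by case: (X i w) => [u|] /= h; [left; exists u|right].
  by move=> [[u fu <-]|->].
rewrite (_ : _ @^-1` B = X i @^-1` (Some @` (f @^-1` B))); first exact: mX.
apply/seteqP; split => w /=; last by move=> [u fu <-].
by case: (X i w) => [u|] //= h; exists u.
Qed.

Lemma measurable_pp_sum (f : E -> R) : measurable_fun setT f ->
  (forall x, 0 <= f x) -> measurable_fun setT (pp_sum f).
Proof.
move=> mf f0; apply: ge0_emeasurable_sum => [i w _ _|i _].
  by rewrite lee_fin; case: (X i w) => /=.
by apply/measurable_EFinP; exact: measurable_oapp.
Qed.

Lemma pp_sum_simple k (c : 'I_k -> R) (B : 'I_k -> set E) w :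
  (forall j, 0 <= c j) ->
  pp_sum (fun x => \sum_j c j * \1_(B j) x) w =
  (\sum_j (c j)%:E * pp_count R X (B j) w)%E.
Proof.
move=> c0; rewrite /pp_sum.
under eq_eseriesr => i _.
  rewrite (_ : (_)%:E = \sum_j ((c j)%:E * (oapp \1_(B j) 0 (X i w))%:E))%E.
    over.
  case: (X i w) => [u|] /=; last by rewrite big1// => j _; rewrite mule0.
  by rewrite -sumEFin.
rewrite nneseries_sum; last first.
  move=> j i _; rewrite mule_ge0// ?lee_fin//.
  by case: (X i w) => //= u; rewrite indicE.
apply: eq_bigr => j _; rewrite pp_countE /pp_sum nneseriesZl// => i _.
by rewrite lee_fin; case: (X i w) => //= u; rewrite indicE.
Qed.

(** Monotone convergence for the counting measure on the indices. *)
Lemma pp_sum_monotone (f : E -> R) (f_ : nat -> E -> R) w :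
  (forall n x, 0 <= f_ n x) -> (forall x, nondecreasing_seq (f_^~ x)) ->
  (forall x, f_ n x @[n --> \oo] --> f x) ->
  pp_sum (f_ n) w @[n --> \oo] --> pp_sum f w.
Proof.
move=> f0 ndf cf.
have fge0 x : 0 <= f x.
  have /cvg_lim <- // := cf x; apply: limr_ge; first by apply/cvg_ex; exists (f x).
  exact: nearW.
rewrite /pp_sum -ge0_integral_count; last by move=> i; rewrite lee_fin; case: (X i w).
rewrite (_ : (fun n => _) = (fun n => \int[counting]_i (oapp (f_ n) 0 (X i w))%:E)%E);
  last first.
  apply/funext => n; rewrite ge0_integral_count// => i.
  by rewrite lee_fin; case: (X i w) => /=.
have cl i : (oapp (f_ n) 0 (X i w))%:E @[n --> \oo] --> (oapp f 0 (X i w))%:E.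
  apply: cvg_EFin; first exact: nearW.
  case: (X i w) => [u|] /=; last exact: cvg_cst.
  exact: cf.
have -> : (\int[counting]_i (oapp f 0 (X i w))%:E =
    \int[counting]_i limn (fun n => (oapp (f_ n) 0 (X i w))%:E))%E.
  by apply: eq_integral => i _; apply/esym/cvg_lim => //; exact: cl.
apply: cvg_monotone_convergence => //.
- by move=> n i _; rewrite lee_fin; case: (X i w) => /=.
- by move=> i _ a b ab; rewrite lee_fin; case: (X i w) => //= u; exact: ndf.
Qed.

End PointSums.

Section PoissonLaplace.
Context {R : realType} d dE (T : measurableType d) (E : measurableType dE).
Variables (P : probability T R) (m : {measure set E -> \bar R}).
Variable X : nat -> T -> option E.
Hypothesis PX : poisson_process P m X.
Let mX := poisson_measurable PX.
Let N (B : set E) := pp_count R X B.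

Let mN B : measurable B -> measurable_fun setT (N B).
Proof.
move=> mB; rewrite /N pp_countE; apply: measurable_pp_sum => //.
Qed.

Let N0 B w : (0 <= N B w)%E.
Proof. by rewrite /N pp_countE; exact: pp_sum_ge0. Qed.

Let mlapN B c : measurable B -> measurable_fun setT (fun w => lap (c%:E * N B w)%E).
Proof.
by move=> mB; apply: (measurableT_comp measurable_lap); apply: measurable_funeM; exact: mN.
Qed.

Lemma sum_poisson_prob (l : R) :
  (\sum_(0 <= n <oo) poisson_prob l 0 [set n] = 1)%E.
Proof.
rewrite -(@probability_setT _ _ _ (poisson_prob l 0)).
rewrite (_ : [set: nat] = \bigcup_n [set n]); last first.
  by apply/seteqP; split => // n _; exists n.
rewrite measure_semi_bigcup//.
by move=> i j _ _ [k [/= -> ->]].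
Qed.

(** The factor [expR (- (c * n%:R))] turns the Poisson weights of rate [l] into a constant times
    those of rate [l * expR (- c)], whose sum is 1. *)
Lemma sum_exp_poisson_prob (l c : R) : 0 <= l ->
  (\sum_(0 <= n <oo) ((expR (- (c * n%:R)))%:E * poisson_prob l 0 [set n]) =
   (expR (- ((1 - expR (- c)) * l)))%:E)%E.
Proof.
move=> l0; transitivity (\sum_(0 <= n <oo) ((expR (- ((1 - expR (- c)) * l)))%:E *
    poisson_prob (l * expR (- c)) 0%N [set n]))%E; last first.
  rewrite nneseriesZl; last by [].
  by rewrite [X in (_ * X)%E](sum_poisson_prob _) mule1.
apply: eq_eseriesr => n _.
(* Rate 0 is apart: there [poisson_prob] is the Dirac mass at 0 and is not given by the mass
   function. *)
move: l0; rewrite le_eqVlt => /predU1P[<-|l0].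
  rewrite mul0r mulr0 oppr0 expR0 mul1e /poisson_prob ltxx diracE.
  by case: n => [|n]; rewrite ?mulr0 ?oppr0 ?expR0 ?mul1e// memNset ?mule0.
rewrite /poisson_prob mulr_gt0 ?expR_gt0// l0.
rewrite !esum_set1 ?lee_fin ?poisson_pmf_ge0//.
rewrite -!EFinM; congr (_%:E); rewrite /poisson_pmf mulr_gt0 ?expR_gt0// l0.
rewrite exprMn -expRM_natr.
have -> : expR (- l) = expR (- ((1 - expR (- c)) * l)) * expR (- (l * expR (- c))).
  by rewrite -expRD; congr expR; ring.
by rewrite mulNr; ring.
Qed.

Lemma poisson_count_laplace (B : set E) (c : R) : measurable B -> 0 <= c ->
  (\int[P]_w (lap (c%:E * N B w)%E)%:E =
   (lap ((1 - expR (- c))%:E * m B)%E)%:E)%E.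
Proof.
move=> mB c0.
have [mBoo|] := eqVneq (m B) +oo%E.
  (* For [c = 0] both sides are 1 by the convention that 0 times [+oo] is 0; for [c > 0] the count
     is almost surely [+oo] and both sides vanish. *)
  have [->|cn0] := eqVneq c 0.
    rewrite oppr0 expR0 subrr mul0e lap0.
    under eq_integral do rewrite mul0e lap0.
    by rewrite integral_cst//= probability_setT mule1.
  have cp : 0 < c by rewrite lt_def cn0.
  have ecp : 0 < 1 - expR (- c) by rewrite subr_gt0 expR_lt1 oppr_lt0.
  rewrite mBoo gt0_muley ?lte_fin// {2}/lap /=.
  have Noo := poisson_count_infty PX mB mBoo.
  transitivity (\int[P]_w (cst 0 w))%E; last by rewrite integral0.
  have mNoo : measurable [set w | N B w = +oo%E].
    rewrite (_ : [set w | _] = setT `&` N B @^-1` [set +oo%E]); last by rewrite setTI.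
    by apply: mN => //; exact: emeasurable_set1.
  apply: ge0_ae_eq_integral => //.
  - by apply/measurable_EFinP; exact: mlapN.
  - by move=> w _; rewrite lee_fin lap_ge0.
  - exists (~` [set w | N B w = +oo%E]); split.
    + exact: measurableC.
    + by rewrite [LHS]probability_setC// [X in (_ - X)%E]Noo subee.
    + move=> w /=; apply: contra_not => -> _.
      by rewrite gt0_muley ?lte_fin.
rewrite -ltey => mBfin.
set l := fine (m B).
have l0 : 0 <= l by rewrite fine_ge0.
have -> : m B = l%:E by rewrite fineK// ge0_fin_numE.
rewrite -EFinM lap_fin -sum_exp_poisson_prob//.
pose D n := [set w | N B w = n%:R%:E].
have mD n : measurable (D n).
  rewrite (_ : D n = setT `&` N B @^-1` [set n%:R%:E]); last by rewrite setTI.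
  by apply: mN => //; exact: emeasurable_set1.
have mUD : measurable (\bigcup_n D n) by exact: bigcupT_measurable.
have PD n : P (D n) = poisson_prob l 0 [set n] by exact: poisson_count.
have tD : trivIset setT D.
  move=> i j _ _ [w []]; rewrite /D /= => -> [/eqP]; by rewrite eqr_nat => /eqP.
(* The Poisson masses sum to 1, so the count is almost surely a natural number and the integral
   splits over the events [D n]. *)
have PUD : P (\bigcup_n D n) = 1%E.
  rewrite measure_semi_bigcup//.
  rewrite -(sum_poisson_prob l).
  by apply: eq_eseriesr => n _; exact: PD.
transitivity (\int[P]_(w in \bigcup_n D n) (lap (c%:E * N B w)%E)%:E)%E.
  rewrite (ge0_negligible_integral (N := ~` \bigcup_n D n))//.
  - by rewrite setDE setCK setTI.
  - exact: measurableC.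
  - by apply/measurable_EFinP; exact: mlapN.
  - by move=> w _; rewrite lee_fin lap_ge0.
  - by rewrite [LHS]probability_setC// PUD subee.
rewrite ge0_integral_bigcup//; last 2 first.
- by apply: measurable_funTS; apply/measurable_EFinP; exact: mlapN.
- by move=> w _; rewrite lee_fin lap_ge0.
apply: eq_eseriesr => n _.
transitivity (\int[P]_(w in D n) (expR (- (c * n%:R)))%:E)%E.
  by apply: eq_integral => w /set_mem /= ->; rewrite -EFinM lap_fin.
by rewrite integral_cst//; congr (_ * _)%E; exact: PD.
Qed.

(** Disjoint sets have independent counts, so the integral factorizes. On the other side, at most
    one indicator is nonzero at each point, which makes [1 - expR (- f)] a sum over the sets. *)
Lemma poisson_laplace_simple k (c : 'I_k -> R) (B : 'I_k -> set E) :
  (forall j, 0 <= c j) -> (forall j, measurable (B j)) -> trivIset setT B ->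
  (\int[P]_w (lap (pp_sum X (fun x => \sum_j c j * \1_(B j) x) w))%:E =
   (lap (\int[m]_x (1 - expR (- \sum_j c j * \1_(B j) x))%:E)%E)%:E)%E.
Proof.
move=> c0 mB tB.
(* The absolute value keeps [h j] between 0 and 1 on the whole of [\bar R]; counts are nonnegative,
   so it changes nothing on them. *)
pose h j (x : \bar R) := lap ((c j)%:E * `|x|)%E.
have mh j : measurable_fun setT (h j).
  apply: (measurableT_comp measurable_lap); apply: measurable_funeM.
  exact: abse_measurable.
have h01 j x : 0 <= h j x <= 1.
  by rewrite lap_ge0 lap_le1// mule_ge0// lee_fin.
have ind : mutually_independent P
   (fun j => preimage_set_system setT (N (B j)) measurable).
  exact: (poisson_independent PX).
have := integral_prod_independent (fun j => mN (mB j)) ind mh h01 (index_enum_uniq _).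
transitivity (\int[P]_w (\prod_j h j (N (B j) w))%:E)%E.
  apply: eq_integral => w _; congr (_%:E); rewrite pp_sum_simple// lap_sum.
    by apply: eq_bigr => j _; rewrite /h gee0_abs// N0.
  by move=> j; rewrite mule_ge0// ?lee_fin// N0.
rewrite H.
transitivity (\prod_j (lap ((1 - expR (- c j))%:E * m (B j))%E)%:E)%E.
  apply: eq_bigr => j _; rewrite -poisson_count_laplace//.
  by apply: eq_integral => w _; rewrite /h gee0_abs// N0.
have e0 j : 0 <= 1 - expR (- c j) by rewrite subr_ge0 -expR0 ler_expR oppr_le0.
rewrite -[LHS](big_morph EFin EFinM erefl) -lap_sum; last first.
  by move=> j; rewrite mule_ge0// lee_fin.
congr (lap _)%:E.
transitivity (\int[m]_x (\sum_j (1 - expR (- c j))%:E * (\1_(B j) x)%:E))%E.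
  rewrite ge0_integral_sum//; last 2 first.
  - by move=> j; apply: measurable_funeM; exact/measurable_EFinP/measurable_indic.
  - by move=> j x _; rewrite mule_ge0// lee_fin// indicE.
  apply: eq_bigr => j _; rewrite ge0_integralZl//; last 2 first.
  - exact/measurable_EFinP/measurable_indic.
  - by rewrite lee_fin.
  by rewrite integral_indic// setIT.
apply: eq_integral => x _.
under eq_bigr do rewrite -EFinM.
rewrite sumEFin; congr (_%:E).
have [[j Bjx]|nB] := pselect (exists j, B j x).
  have neq i : i != j -> \1_(B i) x = 0 :> R.
    move=> ij; rewrite indicE memNset// => Bix; move/eqP: ij; apply.
    by apply: tB => //; exists x.
  rewrite (bigD1 j)//= [in RHS](bigD1 j)//= !indicE !mem_set// !mulr1.
  rewrite !big1 ?addr0// => i ij; by rewrite neq// mulr0.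
have zero i : \1_(B i) x = 0 :> R.
  by rewrite indicE memNset// => Bix; apply: nB; exists i.
by rewrite !big1 ?oppr0 ?expR0 ?subrr// => i _; rewrite zero mulr0.
Qed.

Lemma nnsfun_sum_indic (g : {nnsfun E >-> R}) :
  exists (k : nat) (c : 'I_k -> R) (B : 'I_k -> set E),
    [/\ forall j, 0 <= c j, forall j, measurable (B j), trivIset setT B &
       forall x, g x = \sum_j c j * \1_(B j) x].
Proof.
pose s : seq R := finmap.enum_fset (fset_set (range g)).
have us : uniq s by exact: finmap.fset_uniq.
exists (size s), (fun j => nth 0 s j), (fun j => g @^-1` [set nth 0 s j]); split.
- move=> j; have : nth 0 s j \in s by exact: mem_nth.
  by rewrite in_fset_set// inE => -[x _ <-].
- by move=> j; exact: measurable_sfunP.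
- move=> i j _ _ [x [/= gi gj]]; apply/val_inj/eqP => /=.
  by rewrite -(nth_uniq 0 _ _ us)// -gi -gj.
- move=> x; rewrite fimfunE fsbig_finite//= -/s (big_nth 0) big_mkord.
  exact: eq_bigr.
Qed.

(** Increasing simple functions: dominated convergence on the left, with bound 1; on the right
    monotone convergence and the continuity of [lap], also where the integral is infinite. *)
Lemma poisson_laplace (f : E -> R) : measurable_fun setT f -> (forall x, 0 <= f x) ->
  (\int[P]_w (lap (pp_sum X f w))%:E =
   (lap (\int[m]_x (1 - expR (- f x))%:E)%E)%:E)%E.
Proof.
move=> mf f0.
have mfT : measurable_fun setT (EFin \o f) by exact/measurable_EFinP.
pose f_ := nnsfun_approx measurableT mfT.
have f_0 n x : 0 <= f_ n x by [].
have ndf x : nondecreasing_seq (fun n => f_ n x).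
  by move=> a b ab; exact/lefP/nd_nnsfun_approx.
have cf x : f_ n x @[n --> \oo] --> f x.
  have f0E y : setT y -> (0 <= (EFin \o f) y)%E by rewrite lee_fin.
  by have /fine_cvgP[_] := cvg_nnsfun_approx measurableT mfT f0E (I : setT x).
have eqn n : (\int[P]_w (lap (pp_sum X (f_ n) w))%:E =
   (lap (\int[m]_x (1 - expR (- f_ n x))%:E)%E)%:E)%E.
  have [k [c [B [c0 mB tB fE]]]] := nnsfun_sum_indic (f_ n).
  by rewrite (funext fE); exact: poisson_laplace_simple.
have e0 (r : R) : 0 <= r -> 0 <= 1 - expR (- r).
  by move=> r0; rewrite subr_ge0 -expR0 ler_expR oppr_le0.
have me (h : E -> R) : measurable_fun setT h ->
    measurable_fun setT (fun x => (1 - expR (- h x))%:E).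
  move=> mh; apply/measurable_EFinP/measurable_funB => //.
  by apply: measurableT_comp => //; exact: measurableT_comp.
have ml (h : E -> R) : measurable_fun setT h -> (forall x, 0 <= h x) ->
    measurable_fun setT (fun w => lap (pp_sum X h w)).
  by move=> mh h0; apply: (measurableT_comp measurable_lap); exact: measurable_pp_sum.
have bl n w : `|lap (pp_sum X (f_ n) w)| <= cst 1 w.
  by rewrite ger0_norm ?lap_ge0// lap_le1// pp_sum_ge0.
have one_int : P.-integrable setT (EFin \o cst (1 : R)).
  exact: finite_measure_integrable_cst.
have [_ cL] := dominated_cvg_EFin (fun n => ml _ (measurable_funPT (f_ n)) (f_0 n))
  (fun w => cvg_lap (fun n => pp_sum_ge0 X w (f_0 n)) (pp_sum_monotone (w := w) f_0 ndf cf))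
  one_int bl.
apply: cvg_unique cL _ => //.
rewrite (_ : (fun n => _) = (fun n =>
  (lap (\int[m]_x (1 - expR (- f_ n x))%:E)%E)%:E)); last exact/funext.
apply: cvg_EFin; first exact: nearW.
apply: cvg_lap; first by move=> n; apply: integral_ge0 => x _; rewrite lee_fin e0.
have -> : (\int[m]_x (1 - expR (- f x))%:E =
    \int[m]_x limn (fun n => (1 - expR (- f_ n x))%:E))%E.
  apply: eq_integral => x _; apply/esym/cvg_lim => //.
  apply: cvg_EFin; first exact: nearW.
  apply: cvgB; first exact: cvg_cst.
  by apply: continuous_cvg; [exact: continuous_expR|exact: cvgN].
apply: cvg_monotone_convergence => //.
- by move=> n; exact: me.
- by move=> n x _; rewrite lee_fin e0.
- by move=> x _ a b ab; rewrite lee_fin lerB// ler_expR lerN2 ndf.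
Qed.

End PoissonLaplace.

(** * Laplace functional of a particle system *)

Definition shift_tuple {R : realType} n (u : R) (x : n.-tuple R) : n.-tuple R :=
  [tuple u + tnth x j | j < n].

Definition tuple_of_process {R : realType} (I T : Type) n (X : I -> T -> R)
  (t : n.-tuple I) (w : T) : n.-tuple R := [tuple X (tnth t j) w | j < n].

Lemma measurable_shift_tuple {R : realType} n :
  measurable_fun setT (fun p : R * n.-tuple R => shift_tuple p.1 p.2).
Proof.
apply: measurable_mktuple => i; apply: measurable_funD => //.
exact: (measurableT_comp (measurable_tnth i)).
Qed.

Lemma measurable_shift_comp {R : realType} d (T : measurableType d) n (X : T -> R)
    (Y : T -> n.-tuple R) : measurable_fun setT X -> measurable_fun setT Y ->
  measurable_fun setT (fun w => shift_tuple (X w) (Y w)).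
Proof. by move=> mX mY; exact: (measurable_comp2 (@measurable_shift_tuple R n) mX mY). Qed.

Lemma measurable_tuple_of_process {R : realType} d (T : measurableType d) (I : Type) n
    (X : I -> T -> R) (t : n.-tuple I) :
  (forall i, measurable_fun setT (X i)) -> measurable_fun setT (tuple_of_process X t).
Proof. by move=> mX; exact: measurable_mktuple. Qed.

Section GaussianSystem.
Context {R : realType} (d : nat) dX dO (TX : measurableType dX) (PX : probability TX R)
  (T : measurableType dO) (P : probability T R).
Variables (m : {measure set R -> \bar R}) (xi : 'rV[R]_d -> {RV PX >-> R})
  (U : nat -> T -> option R) (xs : nat -> 'rV[R]_d -> {RV P >-> R}).
Hypothesis GS : gaussian_system_data m xi U xs.
Variables (n : nat) (t : n.-tuple 'rV[R]_d).

Let mU := poisson_measurable (gs_poisson GS).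
Let Xi i := tuple_of_process (fun s => xs i s : T -> R) t.
Let Z := tuple_of_process (fun s => xi s : TX -> R) t.

Let mXi i : measurable_fun setT (Xi i).
Proof. by apply: measurable_tuple_of_process => s; exact: measurable_funPT. Qed.

Let mZ : measurable_fun setT Z.
Proof. by apply: measurable_tuple_of_process => s; exact: measurable_funPT. Qed.

Let lawXi i (B : set (n.-tuple R)) : measurable B -> P (Xi i @^-1` B) = PX (Z @^-1` B).
Proof. by move=> mB; exact: (gs_copies GS i t mB). Qed.

(* Missing points are sent to [+oo]. *)
Let uE i w : \bar R := oapp EFin +oo%E (U i w).

Let uE_preimage i (A : set \bar R) : measurable A -> sigma_points U (uE i @^-1` A).
Proof.
move=> mA; have mA' : measurable (EFin @^-1` A : set R).
  have mE : measurable_fun [set: R] (EFin \o @id R) by exact/measurable_EFinP.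
  by apply: measurable_preimage => //; exact: mE.
have sU B : measurable B -> sigma_points U (U i @^-1` (Some @` B)).
  by move=> mB; apply: sub_sigma_algebra; exists i, B.
have [Aoo|Aoo] := pselect (A +oo%E); last first.
  rewrite (_ : _ @^-1` A = U i @^-1` (Some @` (EFin @^-1` A))); first exact: sU.
  apply/seteqP; split => w; rewrite /uE /=; last by move=> [u uA <-].
  by case: (U i w) => //= u uA; exists u.
(* Absence of a point is not a generating event; the preimage is written as the complement of the
   event that the point exists and lies outside [A]. *)
rewrite (_ : _ @^-1` A = ~` (U i @^-1` (Some @` ~` (EFin @^-1` A)))).
  rewrite -setTD; apply: sigma_algebraCD; apply: sU; exact: measurableC.
apply/seteqP; split => w; rewrite /uE /=.
  by move=> Aw [u uA uw]; apply: uA; rewrite -uw in Aw.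
by case: (U i w) => //= u nA; apply: contrapT => uA; apply: nA; exists u.
Qed.

Let sigmaI C D : sigma_points U C -> sigma_points U D -> sigma_points U (C `&` D).
Proof. exact: (@measurableI _ (g_sigma_algebraType _)). Qed.

Let sigma_meas C : sigma_points U C -> measurable C.
Proof.
apply: smallest_sub; first exact: sigma_algebra_measurable.
by move=> _ [i [B [mB ->]]]; exact: mU.
Qed.

Let muE i : measurable_fun setT (uE i).
Proof. by move=> _ A mA; rewrite setTI; apply: sigma_meas; exact: uE_preimage. Qed.

(** The case without replaced marks: independence over the index [None] and the indices [Some j]
    with [j < M], the j-th event being measurable for the j-th copy of [xi]. *)
Let indep_base M (C : set T) (A : nat -> set (n.-tuple R)) :
  sigma_points U C -> (forall j, measurable (A j)) ->
  (\int[P]_w (\1_C w * \prod_(0 <= j < M) \1_(A j) (Xi j w))%:E =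
   P C * \prod_(0 <= j < M) PX (Z @^-1` A j))%E.
Proof.
move=> sC mA.
have mXA j : measurable (Xi j @^-1` A j) by apply: measurable_preimage => //; exact: mXi.
pose S : seq (option nat) := None :: map Some (index_iota 0 M).
pose ev (o : option nat) : set T := if o is Some j then Xi j @^-1` A j else C.
have uS : uniq S.
  rewrite /= map_inj_uniq ?iota_uniq ?andbT; last by move=> i j [].
  by apply/mapP => -[].
have evS o : o \in S -> (if o is Some i then sigma_process (fun s => xs i s : T -> R)
    else sigma_points U) (ev o).
  case: o => [j|]//= _.
  pose GP := [set B | exists s (D : set R), measurable D /\ B = xs j s @^-1` D].
  have mXj : measurable_fun setT (Xi j : g_sigma_algebraType GP -> n.-tuple R).
    apply/measurable_fun_tnthP => k _ D mD; rewrite setTI.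
    apply: sub_sigma_algebra; exists (tnth t k), D; split => //.
    by apply/seteqP; split => w /=; rewrite tnth_mktuple.
  by have := mXj measurableT _ (mA j); rewrite setTI.
have := gs_independent GS uS evS.
rewrite big_cons big_map /=.
move=> PE.
have -> : (\prod_(0 <= j < M) PX (Z @^-1` A j) = \prod_(0 <= j < M) P (Xi j @^-1` A j))%E.
  by apply: eq_big_nat => j _; rewrite lawXi.
rewrite -[RHS]PE -[X in P X]setIT -integral_indic//; last first.
  by apply: fin_bigcap_measurable => //; case => [j|]//= _; exact: sigma_meas.
apply: eq_integral => w _; congr (_%:E).
rewrite [RHS]indicE; have [wB|] := boolP (w \in _).
  have wS o : o \in S -> ev o w by move=> oS; have := set_mem wB; apply.
  rewrite indicE mem_set ?mul1r; last exact: (wS None).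
  rewrite big_seq big1// => j js; rewrite indicE mem_set//.
  by apply: (wS (Some j)); rewrite inE/= map_f.
rewrite notin_setE => /existsNP[[j|] /not_implyP[/= oS nB]].
  rewrite [X in _ * X](big_rem j)/=; last first.
    by move: oS; rewrite inE /= => /mapP[k kM [->]].
  by rewrite [X in _ * (X * _)]indicE memNset// mul0r mulr0.
by rewrite indicE memNset// mul0r.
Qed.

Variable phi : n.-tuple R -> R.
Hypothesis mphi : measurable_fun setT phi.
Hypothesis phi01 : forall x, 0 <= phi x <= 1.

(** [F i] is the factor of the i-th particle and [G i] its conditional expectation given the points.
    A missing particle gets the neutral factor 1. *)
Let F i w : R := oapp (fun u => phi (shift_tuple u (Xi i w))) 1 (U i w).
Let g u : R := fine (\int[PX]_w (phi (shift_tuple u (Z w)))%:E)%E.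
Let G i w : R := oapp g 1 (U i w).

Let mphi_shift u : measurable_fun setT (fun w => phi (shift_tuple u (Z w))).
Proof.
apply: (measurableT_comp mphi).
exact: measurable_shift_comp (measurable_cst u) mZ.
Qed.

Let gE u : (g u)%:E = (\int[PX]_w (phi (shift_tuple u (Z w)))%:E)%E.
Proof.
have /andP[a b] := integral_bounded01 PX (mphi_shift u) (fun w => phi01 _).
by rewrite /g fineK// ge0_fin_numE// (le_lt_trans b)// ltry.
Qed.

Let g01 u : 0 <= g u <= 1.
Proof.
by have := integral_bounded01 PX (mphi_shift u) (fun w => phi01 _); rewrite -gE !lee_fin.
Qed.

Let fin_set : set \bar R := ~` [set +oo; -oo]%E.

Let mfin_set : measurable fin_set.
Proof. by apply: measurableC; apply: measurableU; exact: emeasurable_set1. Qed.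

(** Extends the factor to positions in [\bar R] by the value 1 at infinity, so that [F i] becomes a
    function of the pair [(uE i, Xi i)], to which the product formula applies. *)
Let hR (p : \bar R * n.-tuple R) : R :=
  \1_fin_set p.1 * phi (shift_tuple (fine p.1) p.2) + \1_(~` fin_set) p.1.

Let mhR : measurable_fun setT hR.
Proof.
apply: measurable_funD.
  apply: measurable_funM.
    exact: (measurableT_comp (measurable_indic mfin_set)).
  apply: (measurableT_comp mphi).
  apply: (measurable_shift_comp _ measurable_snd).
  exact: (measurableT_comp (@fine_measurable R setT measurableT) measurable_fst).
apply: (measurableT_comp (measurable_indic _)) => //.
exact: measurableC.
Qed.

Let hR_fin r x : hR (r%:E, x) = phi (shift_tuple r x).
Proof.
rewrite /hR /= indicC /= indicE mem_set ?mul1r ?subrr ?addr0//.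
by move=> [].
Qed.

Let hR_oo x : hR (+oo%E, x) = 1.
Proof.
rewrite /hR /= indicC /= indicE memNset ?mul0r ?subr0 ?add0r//.
by move=> h; apply: h; left.
Qed.

Let hR0 p : 0 <= hR p.
Proof.
by rewrite addr_ge0 ?mulr_ge0 ?indicE//; have /andP[] := phi01 (shift_tuple (fine p.1) p.2).
Qed.

Let hR_F i w : hR (uE i w, Xi i w) = F i w.
Proof. by rewrite /uE /F; case: (U i w) => [u|] /=; rewrite ?hR_fin ?hR_oo. Qed.

Let Q : probability (n.-tuple R) R := distribution PX
  (HB.pack Z (isMeasurableFun.Build _ _ _ _ Z mZ) : {RV PX >-> n.-tuple R}).

Let hR_G i w : (\int[Q]_x (hR (uE i w, x))%:E)%E = (G i w)%:E.
Proof.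
have mh : measurable_fun setT (fun x => (hR (uE i w, x))%:E).
  apply/measurable_EFinP.
  exact: (measurable_comp2 mhR (measurable_cst (uE i w)) (@measurable_id _ _ setT)).
rewrite ge0_integral_distribution//; last by move=> x; rewrite lee_fin.
rewrite /uE /G /=; case: (U i w) => [u|] /=.
  by rewrite gE; apply: eq_integral => z _; rewrite hR_fin.
under eq_integral do rewrite hR_oo.
by rewrite integral_cst//= probability_setT mule1.
Qed.

Lemma measurable_marks i : measurable_fun setT (F i).
Proof.
rewrite -(funext (hR_F i)).
exact: (measurable_comp2 mhR (muE i) (@mXi i)).
Qed.

Let F0 i w : 0 <= F i w.
Proof. by rewrite -hR_F. Qed.

Let G01 i w : 0 <= G i w <= 1.
Proof. by rewrite /G; case: (U i w) => [u|] //=; rewrite ler01 lexx. Qed.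

Lemma measurable_mean_mark : measurable_fun setT g.
Proof.
have mgE : measurable_fun setT (fun u => \int[PX]_w (phi (shift_tuple u (Z w)))%:E)%E.
  apply: (measurable_fun_fubini_tonelli_F
    (fun p : R * TX => (phi (shift_tuple p.1 (Z p.2)))%:E)).
    apply/measurable_EFinP; apply: (measurableT_comp mphi).
    exact: measurable_shift_comp measurable_fst (measurableT_comp mZ measurable_snd).
  by move=> p; rewrite lee_fin; have /andP[] := phi01 (shift_tuple p.1 (Z p.2)).
exact: measurableT_comp.
Qed.

Lemma measurable_mean_marks i : measurable_fun setT (G i).
Proof.
by apply: measurable_oapp => //; exact: measurable_mean_mark.
Qed.

(* Replaces the marks by their means one after the other: [C] and the [A j] are
   a generator of the information carried by the points and the later marks. *)
Let replace_gen M (C : set T) (A : nat -> set (n.-tuple R)) i : (i <= M)%N ->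
  sigma_points U C -> (forall j, measurable (A j)) ->
  (\int[P]_w ((\prod_(0 <= j < i) F j w) * \1_C w *
     \prod_(i <= j < M) \1_(A j) (Xi j w))%:E =
   (\int[P]_w ((\prod_(0 <= j < i) G j w) * \1_C w)%:E) *
     \prod_(i <= j < M) PX (Z @^-1` A j))%E.
Proof.
elim: i C A => [|i ih] C A iM sC mA.
  under eq_integral do rewrite big_geq// mul1r.
  rewrite indep_base//; congr (_ * _)%E.
  under eq_integral do rewrite big_geq// mul1r.
  by rewrite integral_indic ?setIT//; exact: sigma_meas.
pose c := (\prod_(i.+1 <= j < M) PX (Z @^-1` A j))%E.
have c01 : (0 <= c <= 1)%E.
  apply: prode01 => j; rewrite measure_ge0 probability_le1//.
  by apply: measurable_preimage => //; exact: mZ.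
have cfin : c \is a fin_num.
  by have /andP[c0 c1] := c01; rewrite ge0_fin_numE// (le_lt_trans c1)// ltry.
pose Y1 w := (\prod_(0 <= j < i) F j w) * \1_C w *
  \prod_(i.+1 <= j < M) \1_(A j) (Xi j w).
pose Y2 w := fine c * ((\prod_(0 <= j < i) G j w) * \1_C w).
have mC := sigma_meas sC.
have m1 (j : nat) (B : set (n.-tuple R)) : measurable B ->
    measurable_fun setT (fun w => \1_B (Xi j w) : R).
  by move=> mB; apply: (measurableT_comp (measurable_indic mB)); exact: mXi.
have mY1 : measurable_fun setT Y1.
  apply: measurable_funM; last by apply: measurable_prod => j _; exact: m1.
  by apply: measurable_funM;
    [apply: measurable_prod => j _; exact: measurable_marks|exact: measurable_indic].
have mGC : measurable_fun setT (fun w => (\prod_(0 <= j < i) G j w) * \1_C w).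
  apply: measurable_funM; last exact: measurable_indic.
  by apply: measurable_prod => j _; exact: measurable_mean_marks.
have mY2 : measurable_fun setT Y2 by exact: measurable_funM.
have Y10 w : 0 <= Y1 w.
  by rewrite /Y1 !mulr_ge0 ?prodr_ge0.
have GC01 w : 0 <= (\prod_(0 <= j < i) G j w) * \1_C w <= 1.
  apply/andP; split.
    by rewrite mulr_ge0// prodr_ge0// => j _; have /andP[] := G01 j w.
  have /andP[a1 b1] := indic01 R C w.
  rewrite mulr_ile1//; last by apply: prodr_ile1 => j _; exact: G01.
  by rewrite prodr_ge0// => j _; have /andP[] := G01 j w.
have fc0 : 0 <= fine c by rewrite fine_ge0//; case/andP: c01.
have Y20 w : 0 <= Y2 w.
  by rewrite mulr_ge0//; have /andP[] := GC01 w.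
have Y2E (D : T -> R) : measurable_fun setT D -> (forall w, 0 <= D w) ->
    (\int[P]_w ((Y2 w)%:E * (D w)%:E) =
     c * \int[P]_w ((\prod_(0 <= j < i) G j w) * \1_C w * D w)%:E)%E.
  move=> mD D0; rewrite -[in RHS](fineK cfin) -ge0_integralZl//.
  - by apply: eq_integral => w _; rewrite -!EFinM; congr (_%:E); rewrite /Y2 !mulrA.
  - by apply/measurable_EFinP; exact: measurable_funM.
  - by move=> w _; rewrite lee_fin mulr_ge0//; have /andP[] := GC01 w.
have Y2oo : (\int[P]_w (Y2 w)%:E < +oo)%E.
  have := Y2E (cst 1) (measurable_cst _) (fun=> ler01).
  under eq_integral do rewrite mule1.
  move=> ->; under eq_integral do rewrite mulr1.
  have /andP[h1 h2] := integral_bounded01 P mGC GC01.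
  by rewrite lte_mul_pinfty//; [case/andP: c01|exact: (le_lt_trans h2 (ltry _))].
(* The product formula asks for rectangles only. They come from the induction hypothesis with [C]
   cut by the event that [uE i] lies in [D], and with [B] as the i-th set. *)
have rect (D : set \bar R) (B : set (n.-tuple R)) : measurable D -> measurable B ->
    (\int[P]_w ((Y1 w)%:E * (\1_D (uE i w) * \1_B (Xi i w))%:E) =
     (\int[P]_w ((Y2 w)%:E * (\1_D (uE i w))%:E)) * Q B)%E.
  move=> mD mB.
  have sCD := sigmaI sC (uE_preimage i mD).
  have mA' j : measurable (if j == i then B else A j) by case: ifP.
  have := ih (C `&` uE i @^-1` D) (fun j => if j == i then B else A j) (ltnW iM) sCD mA'.
  have congA (S : Type) (idx : S) (op : S -> S -> S) (H : nat -> set (n.-tuple R) -> S) :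
      \big[op/idx]_(i.+1 <= j < M) H j (if j == i then B else A j) =
      \big[op/idx]_(i.+1 <= j < M) H j (A j).
    by apply: eq_big_nat => j /andP[ij _]; rewrite gtn_eqF.
  rewrite [X in _ = (_ * X)%E -> _]big_ltn// eqxx
    (congA _ _ _ (fun _ B' => PX (Z @^-1` B'))) -/c => ihD.
  rewrite Y2E//; last first.
    by apply: (measurableT_comp (measurable_indic mD)); exact: muE.
  have QB : Q B = PX (Z @^-1` B) by [].
  transitivity ((\int[P]_w ((\prod_(0 <= j < i) G j w) *
    \1_(C `&` uE i @^-1` D) w)%:E * (PX (Z @^-1` B) * c))%E).
    rewrite -ihD; apply: eq_integral => w _; rewrite -EFinM; congr (_%:E).
    rewrite [X in _ = _ * X]big_ltn// eqxx.
    rewrite (congA _ _ _ (fun j B' => \1_B' (Xi j w))) /Y1.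
    have -> : \1_(C `&` uE i @^-1` D) w = \1_C w * \1_D (uE i w) :> R.
      by rewrite indicI.
    by ring.
  rewrite muleA muleAC [X in (X * _)%E]muleC QB; congr (_ * _ * _)%E.
  by apply: eq_integral => w _; rewrite indicI -mulrA.
have mhRE : measurable_fun setT (fun p => (hR p)%:E) by exact/measurable_EFinP.
have hRE0 p : (0 <= (hR p)%:E)%E by rewrite lee_fin.
have := integral_weight_product mY1 Y10 mY2 Y20 (muE i) (@mXi i) (muE i) Y2oo rect mhRE hRE0.
move=> key.
transitivity (\int[P]_w ((Y1 w)%:E * (hR (uE i w, Xi i w))%:E))%E.
  apply: eq_integral => w _; rewrite -EFinM hR_F /Y1 big_nat_recr//=; congr (_%:E).
  by ring.
rewrite key muleC -/c.
under eq_integral do rewrite hR_G.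
rewrite Y2E//; last 2 first.
- exact: measurable_mean_marks.
- by move=> w; have /andP[] := G01 i w.
congr (_ * _)%E; apply: eq_integral => w _; congr (_%:E).
by rewrite big_nat_recr//=; ring.
Qed.

Lemma mean_marks01 u : 0 <= g u <= 1. Proof. exact: g01. Qed.

Lemma mean_marksE u : (g u)%:E = (\int[PX]_w (phi (shift_tuple u (Z w)))%:E)%E.
Proof. exact: gE. Qed.

Lemma integral_prod_marks M :
  (\int[P]_w (\prod_(0 <= j < M) F j w)%:E =
   \int[P]_w (\prod_(0 <= j < M) G j w)%:E)%E.
Proof.
have sT : sigma_points U setT by exact: (@measurableT _ (g_sigma_algebraType _)).
have := replace_gen (leqnn M) sT (fun=> measurableT).
rewrite big_geq// mule1 => e.
transitivity (\int[P]_w ((\prod_(0 <= j < M) G j w) * \1_setT w)%:E)%E.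
  rewrite -e; apply: eq_integral => w _; congr (_%:E).
  by rewrite [X in _ * X]big_geq// indicT !mulr1.
by apply: eq_integral => w _; rewrite indicT mulr1.
Qed.

End GaussianSystem.

(** * Stationarity as shift invariance of the intensities *)

Section MomentsDetermine.
Context {R : realType} d1 d2 (T1 : measurableType d1) (T2 : measurableType d2).
Variables (P1 : probability T1 R) (P2 : probability T2 R).

Lemma integrable_bounded d (T : measurableType d) (P : probability T R) (F : T -> R) C :
  measurable_fun setT F -> (forall w, `|F w| <= C) -> P.-integrable setT (EFin \o F).
Proof.
move=> mF bF; apply: (le_integrable measurableT _ _
  (finite_measure_integrable_cst P C measurableT)).
  exact/measurable_EFinP.
by move=> w _; rewrite /= lee_fin (le_trans (bF w))// ler_norm.
Qed.

(** Mixed form of the claim: in [Y s p] the coordinates in [s] already carry exponentials and all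
    coordinates carry powers. Adding [i] to [s] expands one exponential in its series, whose terms
    only raise the i-th power; the partial sums are bounded because the variables lie in
    [[0, 1]]. *)
Lemma mgf_of_moments k (X1 : 'I_k -> T1 -> R) (X2 : 'I_k -> T2 -> R) :
  (forall i, measurable_fun setT (X1 i)) -> (forall i, measurable_fun setT (X2 i)) ->
  (forall i w, 0 <= X1 i w <= 1) -> (forall i w, 0 <= X2 i w <= 1) ->
  (forall p : 'I_k -> nat, (\int[P1]_w (\prod_i X1 i w ^+ p i)%:E =
                            \int[P2]_w (\prod_i X2 i w ^+ p i)%:E)%E) ->
  forall a : 'I_k -> R,
    integrals_agree P1 P2 (fun w => expR (\sum_i a i * X1 i w))
                          (fun w => expR (\sum_i a i * X2 i w)).
Proof.
move=> mX1 mX2 b1 b2 eqm a.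
pose Y (I : Type) (X : 'I_k -> I -> R) (s : seq 'I_k) (p : 'I_k -> nat) w :=
  (\prod_(i <- s) expR (a i * X i w)) * \prod_i X i w ^+ p i.
have mY d (T : measurableType d) (X : 'I_k -> T -> R) s p :
    (forall i, measurable_fun setT (X i)) -> measurable_fun setT (Y _ X s p).
  move=> mX; apply: measurable_funM.
    apply: measurable_prod => i _; apply: measurableT_comp => //.
    exact: measurable_funM.
  by apply: measurable_prod => i _; exact: measurable_funX.
pose C s := \prod_(i <- s) expR `|a i|.
have Y0 (I : Type) (X : 'I_k -> I -> R) s p w :
    (forall i w, 0 <= X i w <= 1) -> 0 <= Y _ X s p w <= C s.
  move=> bX; apply/andP; split.
    rewrite mulr_ge0 ?prodr_ge0// => i _.
    by rewrite exprn_ge0//; have /andP[] := bX i w.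
  rewrite -[leRHS]mulr1; apply: ler_pM.
  - by apply: prodr_ge0 => i _; exact: expR_ge0.
  - by apply: prodr_ge0 => i _; rewrite exprn_ge0//; have /andP[] := bX i w.
  - apply: ler_prod => i _; rewrite expR_ge0/= ler_expR (le_trans (ler_norm _))//.
    have /andP[x0 x1] := bX i w.
    by rewrite normrM ler_piMr// ger0_norm.
  - apply: prodr_ile1 => i _; have /andP[x0 x1] := bX i w.
    by rewrite exprn_ge0// exprn_ile1.
have step s p : integrals_agree P1 P2 (Y _ X1 s p) (Y _ X2 s p).
  elim: s p => [|i s ih] p.
    split.
    - apply: (@integrable_bounded _ _ _ _ (C [::])); first exact: mY.
      by move=> w; have /andP[h0 h1] := Y0 _ X1 [::] p w b1; rewrite ger0_norm.
    - apply: (@integrable_bounded _ _ _ _ (C [::])); first exact: mY.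
      by move=> w; have /andP[h0 h1] := Y0 _ X2 [::] p w b2; rewrite ger0_norm.
    - under eq_integral do rewrite /Y big_nil mul1r.
      under [in RHS]eq_integral do rewrite /Y big_nil mul1r.
      exact: eqm.
  have shift (I : Type) (X : 'I_k -> I -> R) w l :
      Y _ X s (fun j => p j + l * (j == i))%N w = X i w ^+ l * Y _ X s p w.
    rewrite /Y mulrCA; congr (_ * _).
    under eq_bigr do rewrite exprD.
    rewrite big_split /= mulrC; congr (_ * _).
    rewrite (bigD1 i)//= eqxx muln1 big1 ?mulr1// => j /negbTE ->.
    by rewrite muln0 expr0.
  pose S (I : Type) (X : 'I_k -> I -> R) L w :=
    series (exp_coeff (a i * X i w)) L * Y _ X s p w.
  have agreeS L : integrals_agree P1 P2 (S _ X1 L) (S _ X2 L).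
    elim: L => [|L ihL].
      have z := integrals_agree_lin (- 1) (ih p) (ih p).
      move: z; congr (integrals_agree _ _ _ _); apply/funext => w;
      by rewrite /S /series /= big_geq// mul0r mulN1r addNr.
    have := integrals_agree_lin (a i ^+ L / L`!%:R) (ih (fun j => p j + L * (j == i))%N) ihL.
    congr (integrals_agree _ _ _ _); apply/funext => w;
    by rewrite shift /S /series /= big_nat_recr//= /exp_coeff /= exprMn; ring.
  have bS (I : Type) (X : 'I_k -> I -> R) L w : (forall i w, 0 <= X i w <= 1) ->
      `|S _ X L w| <= C (i :: s).
    move=> bX; rewrite /S normrM /C big_cons; have /andP[h0 h1] := Y0 _ X s p w bX.
    apply: ler_pM => //; last by rewrite ger0_norm.
    have /andP[x0 x1] := bX i w.
    apply: (@le_trans _ _ (series (exp_coeff `|a i|) L)).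
      rewrite /series /= (le_trans (ler_norm_sum _ _ _))// ler_sum// => j _.
      rewrite /exp_coeff /= normrM normfV [`|j`!%:R|]ger0_norm// ler_wpM2r// ?invr_ge0//.
      by rewrite normrX lerXn2r ?nnegrE// normrM ler_piMr// ger0_norm.
    rewrite /expR; apply: nondecreasing_cvgn_le; last exact: is_cvg_series_exp_coeff.
    by apply: nondecreasing_series => j _ _; rewrite exp_coeff_ge0.
  have cS (I : Type) (X : 'I_k -> I -> R) w : S _ X L w @[L --> \oo] --> Y _ X (i :: s) p w.
    rewrite /S {2}/Y big_cons -mulrA; apply: cvgM; last exact: cvg_cst.
    exact: is_cvg_series_exp_coeff.
  apply: (integrals_agree_lim agreeS (cS _ X1) (cS _ X2)
    (finite_measure_integrable_cst P1 (C (i :: s)) measurableT)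
    (finite_measure_integrable_cst P2 (C (i :: s)) measurableT)).
  - by move=> L w; exact: bS.
  - by move=> L w; exact: bS.
have := step (index_enum 'I_k) (fun=> 0%N).
congr (integrals_agree _ _ _ _); apply/funext => w; rewrite /Y expR_sum.
  by rewrite [X in _ * X]big1 ?mulr1// => i _; rewrite expr0.
by rewrite [X in _ * X]big1 ?mulr1// => i _; rewrite expr0.
Qed.

End MomentsDetermine.

Lemma cvg_prod_lap {R : realType} (a : nat -> R) : (forall i, 0 <= a i) ->
  \prod_(0 <= i < M) expR (- a i) @[M --> \oo] --> lap (\sum_(0 <= i <oo) (a i)%:E)%E.
Proof.
move=> a0; rewrite (_ : (fun M => _) = (fun M => lap (\sum_(0 <= i < M) (a i)%:E)%E)).
  apply: cvg_lap; first by move=> M; apply: sume_ge0 => i _; rewrite lee_fin.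
  by apply: is_cvg_nneseries => i _ _; rewrite lee_fin.
by apply/funext => M; rewrite lap_sum.
Qed.

Section GaussianSystemLaplace.
Context {R : realType} (d : nat) dX dO (TX : measurableType dX) (PX : probability TX R)
  (T : measurableType dO) (P : probability T R).
Variables (m : {measure set R -> \bar R}) (xi : 'rV[R]_d -> {RV PX >-> R})
  (U : nat -> T -> option R) (xs : nat -> 'rV[R]_d -> {RV P >-> R}).
Hypothesis GS : gaussian_system_data m xi U xs.
Variables (n : nat) (t : n.-tuple 'rV[R]_d).

Let Z := tuple_of_process (fun s => xi s : TX -> R) t.
Let V := sample_at (particles U (fun i s => xs i s : T -> R)) t.

Lemma sample_particlesE (f : n.-tuple R -> R) c i w : oapp f c (V i w) =
  oapp (fun u => f (shift_tuple u (tuple_of_process (fun s => xs i s : T -> R) t w))) c (U i w).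
Proof.
rewrite /V /sample_at /particles; case: (U i w) => [u|]//=.
by congr f; apply/eq_from_tnth => j; rewrite !tnth_mktuple.
Qed.

(** After the marks are replaced by their means [g], the functional is that of the Poisson process
    of starting points at [- ln g], and [1 - g] is the inner integral of [1 - expR (- f)]. *)
Lemma gs_laplace (f : n.-tuple R -> R) (K : R) : measurable_fun setT f ->
  (forall x, 0 <= f x <= K) ->
  measurable_fun setT (fun w => lap (pp_sum V f w)) /\
  (\int[P]_w (lap (pp_sum V f w))%:E =
   (lap (\int[m]_u \int[PX]_w (1 - expR (- f (shift_tuple u (Z w))))%:E)%E)%:E)%E.
Proof.
move=> mf f0K.
have f0 x : 0 <= f x by have /andP[] := f0K x.
pose phi x := expR (- f x).
have mphi : measurable_fun setT phi by apply: measurableT_comp => //; exact: measurableT_comp.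
have phi01 x : 0 <= phi x <= 1 by rewrite /phi expR_ge0 -expR0 ler_expR oppr_le0 f0.
pose F i w : R := oapp (fun u => phi (shift_tuple u
  (tuple_of_process (fun s => xs i s : T -> R) t w))) 1 (U i w).
pose g u : R := fine (\int[PX]_w (phi (shift_tuple u (Z w)))%:E)%E.
pose G i w : R := oapp g 1 (U i w).
have gE u : (g u)%:E = (\int[PX]_w (phi (shift_tuple u (Z w)))%:E)%E.
  exact: mean_marksE.
have g01 u : 0 <= g u <= 1 by exact: mean_marks01.
have mshift u : measurable_fun setT (fun w => shift_tuple u (Z w)).
  apply: (measurable_shift_comp (measurable_cst u)).
  by apply: measurable_tuple_of_process => s; exact: measurable_funPT.
have gK u : expR (- K) <= g u.
  rewrite -lee_fin gE -[leLHS]mule1 -(@probability_setT _ _ _ PX) -integral_cst//.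
  apply: ge0_le_integral => //.
  - by move=> w _; rewrite lee_fin expR_ge0.
  - by apply/measurable_EFinP; apply: measurableT_comp.
  - by move=> w _; rewrite lee_fin ler_expR lerN2; have /andP[] := f0K (shift_tuple u (Z w)).
have gp u : 0 < g u by exact: (lt_le_trans (expR_gt0 _) (gK u)).
(* Finite because [g] is at least [expR (- K)]: the upper bound on [f] keeps [g] away from 0. *)
pose f' u := - ln (g u).
have mg : measurable_fun setT g by exact: (measurable_mean_mark xi t mphi phi01).
have mf' : measurable_fun setT f'.
  by apply: measurableT_comp => //; apply: measurableT_comp => //; exact: measurable_ln.
have f'0 u : 0 <= f' u by rewrite oppr_ge0 ln_le0//; have /andP[] := g01 u.
have FE j w : F j w = expR (- oapp f 0 (V j w)).
  rewrite sample_particlesE /F; case: (U j w) => //=.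
  by rewrite oppr0 expR0.
have GE j w : G j w = expR (- oapp f' 0 (U j w)).
  by rewrite /G; case: (U j w) => [u|] /=; rewrite ?oppr0 ?expR0// opprK lnK ?posrE.
have one_int : P.-integrable setT (EFin \o cst (1 : R)).
  exact: finite_measure_integrable_cst.
have cF w : \prod_(0 <= j < M) F j w @[M --> \oo] --> lap (pp_sum V f w).
  under eq_fun do under eq_bigr do rewrite FE.
  by apply: cvg_prod_lap => i; case: (V i w).
have cG w : \prod_(0 <= j < M) G j w @[M --> \oo] --> lap (pp_sum U f' w).
  under eq_fun do under eq_bigr do rewrite GE.
  by apply: cvg_prod_lap => i; case: (U i w).
have mF M : measurable_fun setT (fun w => \prod_(0 <= j < M) F j w).
  by apply: measurable_prod => j _; exact: (measurable_marks GS).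
have mG M : measurable_fun setT (fun w => \prod_(0 <= j < M) G j w).
  by apply: measurable_prod => j _; exact: (measurable_mean_marks GS).
have bF M w : `|\prod_(0 <= j < M) F j w| <= cst 1 w.
  rewrite ger0_norm; last by apply: prodr_ge0 => j _; rewrite FE expR_ge0.
  by apply: prodr_ile1 => j _; rewrite FE expR_ge0 -expR0 ler_expR oppr_le0 /=; case: (V j w).
have bG M w : `|\prod_(0 <= j < M) G j w| <= cst 1 w.
  rewrite ger0_norm; last by apply: prodr_ge0 => j _; rewrite GE expR_ge0.
  by apply: prodr_ile1 => j _; rewrite GE expR_ge0 -expR0 ler_expR oppr_le0 /=; case: (U j w).
have [_ IF] := dominated_cvg_EFin mF cF one_int bF.
have [_ IG] := dominated_cvg_EFin mG cG one_int bG.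
split.
  exact: (measurable_fun_cvg mF (fun w _ => cF w)).
have eqFG : (fun M => \int[P]_w (\prod_(0 <= j < M) F j w)%:E)%E =
            (fun M => \int[P]_w (\prod_(0 <= j < M) G j w)%:E)%E.
  by apply/funext => M; exact: (integral_prod_marks GS).
rewrite eqFG in IF.
rewrite (cvg_unique _ IF IG)//.
rewrite (poisson_laplace (gs_poisson GS))//.
congr (lap _)%:E; apply: eq_integral => u _.
rewrite /f' opprK lnK ?posrE//.
rewrite EFinB gE.
under [RHS]eq_integral do rewrite EFinB.
rewrite integralB//.
- by rewrite integral_cst//= probability_setT mule1.
- exact: finite_measure_integrable_cst.
- apply: (@integrable_bounded _ _ _ _ _ 1); first exact: (measurableT_comp mphi).
  by move=> w; have /andP[a b] := phi01 (shift_tuple u (Z w)); rewrite ger0_norm.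
Qed.

End GaussianSystemLaplace.

Lemma mulIe {R : realType} (a : R) (x y : \bar R) : a != 0 ->
  (a%:E * x = a%:E * y)%E -> x = y.
Proof.
move=> a0 /(congr1 (fun z => ((a^-1)%:E * z)%E)).
by rewrite !muleA -EFinM mulVf// !mul1e.
Qed.

(** * Intensity measures of the sampled particles *)

Section Intensity.
Context {R : realType}.

Lemma bigcup_centered_itv : \bigcup_(n : nat) `[(- n%:R : R), n%:R]%classic = setT.
Proof.
apply/seteqP; split => // x _.
exists (Num.trunc `|x|).+1 => //=; rewrite in_itv/= -ler_norml.
by rewrite ltW// truncnS_gt.
Qed.

Definition gauss_integrable (m : {measure set R -> \bar R}) :=
  forall eps : R, 0 < eps -> (\int[m]_x (expR (- eps * x ^+ 2))%:E < +oo)%E.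

(** On the interval, [expR (- x ^+ 2)] is bounded below by [expR (- a ^+ 2)]; the hypothesis is
    taken at exponent 1. *)
Lemma gauss_integrable_itv (m : {measure set R -> \bar R}) (a : R) :
  gauss_integrable m -> (m `[(- a)%R, a]%classic < +oo)%E.
Proof.
move=> /(_ 1 ltr01) moo.
have mI : measurable `[(- a)%R, a]%classic by exact: measurable_itv.
have me : measurable_fun setT (fun x : R => (expR (- 1 * x ^+ 2))%:E).
  apply/measurable_EFinP/measurableT_comp => //; apply: measurable_funM => //.
have h : ((expR (- a ^+ 2))%:E * m `[(- a)%R, a]%classic <=
    \int[m]_x (expR (- 1 * x ^+ 2))%:E)%E.
  rewrite -integral_cst//.
  apply: (@le_trans _ _ (\int[m]_(x in `[(- a)%R, a]%classic) (expR (- 1 * x ^+ 2))%:E)%E).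
    apply: ge0_le_integral => //.
    - by move=> x _; rewrite lee_fin expR_ge0.
    - by apply: measurable_funTS.
    - move=> x; rewrite /= in_itv/= => /andP[ax xa]; rewrite lee_fin ler_expR mulN1r lerN2.
      by nra.
  by apply: ge0_subset_integral.
have := le_lt_trans h moo.
case: (m _) (measure_ge0 m `[(- a)%R, a]%classic) => [r _ _|_|]//; first exact: ltry.
by rewrite gt0_muley ?lte_fin ?expR_gt0.
Qed.

Lemma gauss_integrable_sigma_finite (m : {measure set R -> \bar R}) :
  gauss_integrable m -> sigma_finite setT m.
Proof.
move=> mg; exists (fun n : nat => `[- n%:R, n%:R]%classic).
  exact/esym/bigcup_centered_itv.
by move=> n; split; [exact: measurable_itv|exact: gauss_integrable_itv].
Qed.

Definition intensity (m : {measure set R -> \bar R}) dX (TX : measurableType dX)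
    (PX : probability TX R) n (Z : TX -> n.-tuple R) (D : set (n.-tuple R)) : \bar R :=
  (\int[m]_u \int[PX]_w (\1_D (shift_tuple u (Z w)))%:E)%E.

Section Fubini.
Context dX (TX : measurableType dX) (PX : probability TX R).
Variable m : {measure set R -> \bar R}.
Hypothesis m_sigma : sigma_finite setT m.

(** The intensity is the image of the product of [m] and [PX] under the shift, so equality on sets
    extends to nonnegative functions. The copy [K] of [m] carries the sigma-finite structure for
    Fubini's theorem. *)
Lemma eq_intensity_integral n (Z1 Z2 : TX -> n.-tuple R) :
  measurable_fun setT Z1 -> measurable_fun setT Z2 ->
  (forall D, measurable D -> intensity m PX Z1 D = intensity m PX Z2 D) ->
  forall h : n.-tuple R -> \bar R, measurable_fun setT h -> (forall x, 0 <= h x)%E ->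
  (\int[m]_u \int[PX]_w h (shift_tuple u (Z1 w)) =
   \int[m]_u \int[PX]_w h (shift_tuple u (Z2 w)))%E.
Proof.
move=> mZ1 mZ2 eqI.
have [K KE] := exists_sigma_finite_measure m_sigma.
have mS (Z : TX -> n.-tuple R) : measurable_fun setT Z ->
    measurable_fun setT (fun p : R * TX => shift_tuple p.1 (Z p.2)).
  move=> mZ.
  exact: measurable_shift_comp measurable_fst (measurableT_comp mZ measurable_snd).
have IE (Z : TX -> n.-tuple R) : measurable_fun setT Z ->
    forall h : n.-tuple R -> \bar R, measurable_fun setT h -> (forall x, 0 <= h x)%E ->
  (\int[m]_u \int[PX]_w h (shift_tuple u (Z w)) =
   \int[K \x PX]_p h (shift_tuple p.1 (Z p.2)))%E.
  move=> mZ h mh h0.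
  rewrite (fubini_tonelli1 (fun p : R * TX => h (shift_tuple p.1 (Z p.2))))//.
    by apply: eq_measure_integral => A _ _; exact/esym/KE.
  exact: (measurableT_comp mh (mS _ mZ)).
move=> h mh h0; rewrite !IE//.
apply: (eq_integral_comp_law (mS _ mZ1) (mS _ mZ2)) => // A mA.
have m1E : measurable_fun setT (EFin \o (\1_A : n.-tuple R -> R)).
  by apply/measurable_EFinP; exact: measurable_indic.
have i0 (x : n.-tuple R) : (0 <= (EFin \o (\1_A : n.-tuple R -> R)) x)%E by rewrite lee_fin.
have mu (Z : TX -> n.-tuple R) : measurable_fun setT Z ->
   (K \x PX)%E ((fun p : R * TX => shift_tuple p.1 (Z p.2)) @^-1` A) = intensity m PX Z A.
  move=> mZ; rewrite /intensity (IE Z mZ _ m1E i0).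
  transitivity (\int[K \x PX]_p
      (\1_((fun p : R * TX => shift_tuple p.1 (Z p.2)) @^-1` A) p)%:E)%E => //.
  rewrite integral_indic ?setIT//.
  by apply: measurable_preimage => //; exact: mS.
exact: etrans (mu _ mZ1) (etrans (eqI A mA) (esym (mu _ mZ2))).
Qed.

End Fubini.
End Intensity.

Definition shift_invariant {R : realType} (d : nat) dX (TX : measurableType dX)
    (PX : probability TX R) (m : {measure set R -> \bar R}) (xi : 'rV[R]_d -> {RV PX >-> R}) :=
  forall n (t : n.-tuple 'rV[R]_d) h (A : set (n.-tuple R)), measurable A ->
  intensity m PX (tuple_of_process (fun s => xi s : TX -> R) [tuple tnth t j + h | j < n]) A =
  intensity m PX (tuple_of_process (fun s => xi s : TX -> R) t) A.

Section StationarySystem.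
Context {R : realType} (d : nat) dX dO (TX : measurableType dX) (PX : probability TX R)
  (T : measurableType dO) (P : probability T R).
Variables (m : {measure set R -> \bar R}) (xi : 'rV[R]_d -> {RV PX >-> R})
  (U : nat -> T -> option R) (xs : nat -> 'rV[R]_d -> {RV P >-> R}).
Hypothesis GS : gaussian_system_data m xi U xs.
Hypothesis m_sigma : sigma_finite setT m.

Let Z n (t : n.-tuple 'rV[R]_d) := tuple_of_process (fun s => xi s : TX -> R) t.
Let V n (t : n.-tuple 'rV[R]_d) :=
  sample_at (particles U (fun i s => xs i s : T -> R)) t.

Let mZ n (t : n.-tuple 'rV[R]_d) : measurable_fun setT (Z t).
Proof. by apply: measurable_tuple_of_process => s; exact: measurable_funPT. Qed.

Let lapN n (t : n.-tuple 'rV[R]_d) D w := lap (pp_count R (V t) D w).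

Let mlapN n (t : n.-tuple 'rV[R]_d) D : measurable D -> measurable_fun setT (lapN t D).
Proof.
move=> mD; rewrite /lapN pp_countE.
exact: (gs_laplace GS t (measurable_indic mD) (indic01 R D)).1.
Qed.

Let lapN01 n (t : n.-tuple 'rV[R]_d) D w : 0 <= lapN t D w <= 1.
Proof. by rewrite lap_ge0 lap_le1// pp_countE pp_sum_ge0. Qed.

Let integral_lapN n (t : n.-tuple 'rV[R]_d) D : measurable D ->
  (\int[P]_w (lapN t D w)%:E = (lap ((1 - expR (- 1))%:E * intensity m PX (Z t) D)%E)%:E)%E.
Proof.
move=> mD; rewrite /lapN pp_countE (gs_laplace GS t (measurable_indic mD) (indic01 R D)).2.
congr (lap _)%:E.
have m1 u : measurable_fun setT (fun w => (\1_D (shift_tuple u (Z t w)) : R)%:E).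
  apply/measurable_EFinP; apply: (measurableT_comp (measurable_indic mD)).
  exact: measurable_shift_comp (measurable_cst u) (mZ t).
have mp : measurable_fun setT (fun p : R * TX => (\1_D (shift_tuple p.1 (Z t p.2)) : R)%:E).
  apply/measurable_EFinP; apply: (measurableT_comp (measurable_indic mD)).
  exact: measurable_shift_comp measurable_fst (measurableT_comp (mZ t) measurable_snd).
have e0 : 0 <= 1 - expR (- 1) :> R by rewrite subr_ge0 -expR0 ler_expR oppr_le0.
rewrite /intensity -ge0_integralZl//.
- apply: eq_integral => u _; rewrite -ge0_integralZl//.
  apply: eq_integral => w _; rewrite -EFinM indicE; congr (_%:E).
  by case: (_ \in _); rewrite ?mulr1// mulr0 oppr0 expR0 subrr.
- apply: (measurable_fun_fubini_tonelli_F
    (fun p : R * TX => (\1_D (shift_tuple p.1 (Z t p.2)))%:E)) => //.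
- by move=> u _; apply: integral_ge0.
Qed.

(** A single count suffices: its Laplace transform at 1 is [lap] of [1 - expR (- 1)] times the
    intensity, and [lap] is injective on [[0, +oo]], so infinite intensities are covered. *)
Lemma same_pp_intensity n (t1 t2 : n.-tuple 'rV[R]_d) D : measurable D ->
  same_pp P P (V t1) (V t2) -> intensity m PX (Z t1) D = intensity m PX (Z t2) D.
Proof.
move=> mD st.
(* The absolute value makes the test function nonnegative on all of [R]; on the values of [lapN] it
   is the identity. *)
have eqL : (\int[P]_w `|lapN t1 D w|%:E =
            \int[P]_w `|lapN t2 D w|%:E)%E.
  apply: (eq_integral_comp_law (mlapN _ mD) (mlapN _ mD)
    _ (h := fun x : R => `|x|%:E)) => //; last first.
    by apply/measurable_EFinP; exact: normr_measurable.
  move=> A mA.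
  have mL : measurable [set x : 1.-tuple \bar R | A (lap (tnth x ord0))].
    rewrite -[X in measurable X]setTI.
    exact: (measurableT_comp measurable_lap (measurable_tnth ord0)).
  have := st 1%N [tuple exist _ D mD] _ mL.
  congr (P _ = P _); apply/seteqP; split => w /=;
  by rewrite !tnth_mktuple.
have lap0' r : (\int[P]_w `|lapN r D w|%:E = \int[P]_w (lapN r D w)%:E)%E.
  by apply: eq_integral => w _; rewrite ger0_norm//; have /andP[] := lapN01 r D w.
have e0 : 0 < 1 - expR (- 1) :> R by rewrite subr_gt0 expR_lt1 oppr_lt0.
have I0 r : (0 <= intensity m PX (Z r) D)%E.
  by apply: integral_ge0 => u _; apply: integral_ge0.
have /lap_inj H := EFin_inj (etrans (esym (integral_lapN _ mD)) (etrans (esym (lap0' _))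
  (etrans eqL (etrans (lap0' _) (integral_lapN t2 mD))))).
have c0 r : (0 <= (1 - expR (- 1))%:E * intensity m PX (Z r) D)%E.
  by rewrite mule_ge0// lee_fin ltW.
exact: mulIe (lt0r_neq0 e0) (H (c0 _) (c0 _)).
Qed.

(** The variables [lapN] lie in [[0, 1]], and their mixed moment with exponents [p] is the Laplace
    functional at the combination of the indicators of the [B' j] with coefficients [p j], which the
    intensity determines. The sets may overlap. *)
Lemma intensity_same_pp n (t1 t2 : n.-tuple 'rV[R]_d) :
  (forall D, measurable D -> intensity m PX (Z t1) D = intensity m PX (Z t2) D) ->
  same_pp P P (V t1) (V t2).
Proof.
move=> inv k B A mA.
pose B' j := sval (tnth B j).
have mB j : measurable (B' j) by exact: (svalP (tnth B j)).
pose X (r : n.-tuple 'rV[R]_d) j w := lapN r (B' j) w.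
(* The inverse of [lap] on [[0, +oo]], with value [+oo] at 0: events on the counts become events on
   the variables [X]. *)
pose psi (y : R) : \bar R := if y == 0 then +oo%E else (- ln y)%:E.
have mpsi : measurable_fun setT psi.
  apply: measurable_fun_ifT => //.
    exact: measurable_fun_eqr.
  by apply/measurable_EFinP; apply: measurableT_comp.
have lapK x : (0 <= x)%E -> psi (lap x) = x.
  case: x => [r| |]// _; last by rewrite /psi /lap /= eqxx.
  by rewrite /psi lap_fin gt_eqF ?expR_gt0// expRK opprK.
have NX r j w : pp_count R (V r) (B' j) w = psi (X r j w).
  by rewrite /X /lapN lapK// pp_countE pp_sum_ge0.
pose A' := [set y : k.-tuple R | A [tuple psi (tnth y j) | j < k]].
have mA' : measurable A'.
  have mf : measurable_fun setT (fun y : k.-tuple R => [tuple psi (tnth y j) | j < k]).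
    apply/measurable_fun_tnthP => i.
    rewrite (_ : _ \o _ = psi \o (@tnth k R)^~ i).
      exact: (measurableT_comp mpsi (measurable_tnth i)).
    by apply/funext => y /=; rewrite tnth_mktuple.
  by apply: measurable_preimage => //; exact: mf.
have PE r : [set w | A [tuple pp_count R (V r) (sval (tnth B j)) w | j < k]] =
    [set w | A' [tuple X r j w | j < k]].
  apply/seteqP; split => w; rewrite /A' /=;
  congr A; apply/eq_from_tnth => j; rewrite !tnth_mktuple; first exact: NX.
  exact/esym/NX.
transitivity (P [set w | A' [tuple X t1 j w | j < k]]).
  by congr (P _); exact: PE.
transitivity (P [set w | A' [tuple X t2 j w | j < k]]); last by congr (P _); exact/esym/PE.
apply: (mgf_unique (X1 := X _) (X2 := X _) _ _ _ mA');
  [by move=> j; exact: mlapN|by move=> j; exact: mlapN|].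
apply: mgf_of_moments; [by move=> j; exact: mlapN|by move=> j; exact: mlapN|
  by move=> j w; exact: lapN01|by move=> j w; exact: lapN01|].
move=> p.
pose f (x : n.-tuple R) := \sum_j (p j)%:R * \1_(B' j) x : R.
have mf : measurable_fun setT f.
  apply: measurable_sum => j; apply: measurable_funM => //; exact: measurable_indic.
have fK x : 0 <= f x <= \sum_j (p j)%:R.
  apply/andP; split; first by apply: sumr_ge0 => j _; rewrite mulr_ge0 ?indicE.
  apply: ler_sum => j _; rewrite ler_piMr//.
have momE r : (\int[P]_w (\prod_i X r i w ^+ p i)%:E =
    (lap (\int[m]_u \int[PX]_w (1 - expR (- f (shift_tuple u (Z r w))))%:E)%E)%:E)%E.
  rewrite -(gs_laplace GS r mf fK).2; apply: eq_integral => w _; congr (_%:E).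
  rewrite pp_sum_simple// lap_sum; last first.
    by move=> j; rewrite mule_ge0// ?lee_fin// pp_countE pp_sum_ge0.
  apply: eq_bigr => j _; rewrite /X /lapN.
  have : (0 <= pp_count R (V r) (B' j) w)%E by rewrite pp_countE pp_sum_ge0.
  move: (pp_count _ _ _ _) => x x0.
  elim: (p j) => [|q ih]; first by rewrite expr0 mul0e lap0.
  by rewrite -addn1 natrD exprD expr1 ih EFinD ge0_muleDl ?lee_fin//
    mul1e lapD// mule_ge0// lee_fin.
have mh : measurable_fun setT (fun x => (1 - expR (- f x))%:E).
  apply/measurable_EFinP; apply: measurable_funB => //.
  by apply: measurableT_comp => //; exact: measurableT_comp.
have h0 x : (0 <= (1 - expR (- f x))%:E)%E.
  by rewrite lee_fin subr_ge0 -expR0 ler_expR oppr_le0; have /andP[] := fK x.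
have E := eq_intensity_integral m_sigma (mZ t1) (mZ t2) inv mh h0.
exact: etrans (momE t1) (etrans (congr1 (fun x => (lap x)%:E) E) (esym (momE t2))).
Qed.

Lemma stationary_shift_invariantE :
  stationary_system P (particles U (fun i t => xs i t : T -> R)) <-> shift_invariant m xi.
Proof.
split=> [st n t h D mD|inv n t h]; first exact: (same_pp_intensity mD (st n t h)).
by apply: intensity_same_pp => D mD; exact: inv.
Qed.

End StationarySystem.

(** * Gaussian processes and exponential tilting *)

Section SecondMoments.
Context {R : realType} d (T : measurableType d) (P : probability T R).
Local Notation L2 := (Lfun P 2%:E).

Definition mean (F : T -> R) : R := fine 'E_P[F].
Definition cov (F G : T -> R) : R := fine (covariance P F G).

Let le12 : (1 <= 2%:E :> \bar R)%E. Proof. by rewrite lee_fin ler1n. Qed.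

Lemma L2_L1 F : F \in L2 -> F \in Lfun P 1.
Proof. by move=> F2; rewrite Lfun_subset12// fin_num_measure. Qed.

Lemma L2_scale a F : F \in L2 -> (fun w => a * F w) \in L2.
Proof. by move=> F2; rewrite (_ : (fun w => _) = a *: F)// rpredZ//. Qed.

Lemma L2_add F G : F \in L2 -> G \in L2 -> (fun w => F w + G w) \in L2.
Proof. by move=> F2 G2; rewrite (_ : (fun w => _) = F + G)// rpredD//. Qed.

Lemma L2_sum (I : Type) (s : seq I) (a : I -> R) (X : I -> T -> R) :
  (forall i, X i \in L2) -> (fun w => \sum_(i <- s) a i * X i w) \in L2.
Proof.
move=> X2; elim: s => [|i s ih].
  rewrite (_ : (fun w => _) = 0) ?rpred0//.
  by apply/funext => w; rewrite big_nil.
rewrite (_ : (fun w => _) = (fun w => a i * X i w + \sum_(j <- s) a j * X j w)).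
  by apply: L2_add => //; exact: L2_scale.
by apply/funext => w; rewrite big_cons.
Qed.

Lemma meanE F : F \in L2 -> ('E_P[F] = (mean F)%:E)%E.
Proof. by move=> /L2_L1 F1; rewrite /mean fineK// expectation_fin_num. Qed.

Lemma covE F G : F \in L2 -> G \in L2 -> covariance P F G = (cov F G)%:E.
Proof.
move=> F2 G2; rewrite /cov fineK//.
apply: covariance_fin_num; [exact: L2_L1|exact: L2_L1|exact: Lfun2_mul_Lfun1].
Qed.

Lemma mean_sum (I : Type) (s : seq I) (a : I -> R) (X : I -> T -> R) :
  (forall i, X i \in L2) ->
  mean (fun w => \sum_(i <- s) a i * X i w) = \sum_(i <- s) a i * mean (X i).
Proof.
move=> X2; elim: s => [|i s ih].
  rewrite big_nil (_ : (fun w => _) = cst 0) /mean ?expectation_cst//.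
  by apply/funext => w; rewrite big_nil.
rewrite big_cons -ih; apply: EFin_inj.
rewrite -meanE ?EFinD ?EFinM -?meanE//; [|exact: L2_sum..].
rewrite -expectationZl ?L2_L1//.
rewrite -expectationD ?L2_L1//; last exact: L2_sum.
  by congr expectation; apply/funext => w; rewrite big_cons /= [X i w * _]mulrC.
by rewrite (_ : _ \o* _ = fun w => a i * X i w) ?L2_scale//; apply/funext => w /=; rewrite mulrC.
Qed.

Lemma covC F G : cov F G = cov G F. Proof. by rewrite /cov covarianceC. Qed.

Lemma cov_suml (I : Type) (s : seq I) (a : I -> R) (X : I -> T -> R) G :
  (forall i, X i \in L2) -> G \in L2 ->
  cov (fun w => \sum_(i <- s) a i * X i w) G = \sum_(i <- s) a i * cov (X i) G.
Proof.
move=> X2 G2; elim: s => [|i s ih].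
  rewrite big_nil (_ : (fun w => _) = cst 0) /cov ?covariance_cst_l//.
  by apply/funext => w; rewrite big_nil.
have aX2 : a i \o* X i \in L2.
  by rewrite (_ : _ \o* _ = fun w => a i * X i w) ?L2_scale//; apply/funext => w /=; rewrite mulrC.
rewrite big_cons -ih; apply: EFin_inj.
rewrite -covE ?EFinD ?EFinM -?covE//; [|exact: L2_sum..].
rewrite -covarianceZl; [|exact: L2_L1|exact: L2_L1|exact: Lfun2_mul_Lfun1].
rewrite -covarianceDl//; last exact: L2_sum.
by congr covariance; apply/funext => w; rewrite big_cons /= [X i w * _]mulrC.
Qed.

Lemma cov_sum (I : Type) (s : seq I) (a : I -> R) (X : I -> T -> R) :
  (forall i, X i \in L2) ->
  cov (fun w => \sum_(i <- s) a i * X i w) (fun w => \sum_(i <- s) a i * X i w) =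
  \sum_(i <- s) \sum_(j <- s) a i * a j * cov (X i) (X j).
Proof.
move=> X2; rewrite cov_suml//; last exact: L2_sum.
apply: eq_bigr => i _; rewrite covC cov_suml// mulr_sumr.
by apply: eq_bigr => j _; rewrite mulrA covC.
Qed.

(** Written with [mean] and [cov], the exponent of a linear combination is a quadratic polynomial in
    its coefficients; Dirac laws are included. *)
Lemma gaussian_variable_mgf (L : T -> R) : measurable_fun setT L ->
  (exists m s : R, forall B : set R, measurable B -> P [set w | B (L w)] = normal_law m s B) ->
  (\int[P]_w (expR (L w))%:E = (expR (mean L + cov L L / 2))%:E)%E.
Proof.
move=> mL [m [s lawX]].
have [L2 EL VL] := gaussian_moments mL lawX.
have := integral_expR_normal_law 1 mL lawX.
under eq_integral do rewrite mul1r.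
rewrite mul1r expr1n mul1r => ->.
by move: EL VL; rewrite (meanE L2) => -[<-]; rewrite /variance (covE L2 L2) => -[<-].
Qed.

End SecondMoments.

Section GaussianProcess.
Context {R : realType} d (T : measurableType d) (P : probability T R) (I : Type).
Variable X : I -> {RV P >-> R}.
Hypothesis GX : gaussian_process X.
Let mX t : measurable_fun setT (X t : T -> R). Proof. exact: measurable_funPT. Qed.

Lemma gaussian_process_law t : exists m s : R, forall B : set R, measurable B ->
  P [set w | B (X t w)] = normal_law m s B.
Proof.
have [m [s lawX]] := GX (fun=> t) (fun _ : 'I_1 => 1).
exists m, s => B mB; rewrite -lawX//; congr (P _).
by apply/funext => w /=; rewrite big_ord1 mul1r.
Qed.

Lemma gaussian_process_L2 t : (X t : T -> R) \in Lfun P 2%:E.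
Proof.
have [m [s lawX]] := gaussian_process_law t.
by have [] := gaussian_moments (mX t) lawX.
Qed.

Lemma gaussian_mgf n (t : 'I_n -> I) (a : 'I_n -> R) :
  (\int[P]_w (expR (\sum_j a j * X (t j) w))%:E =
   (expR (\sum_j a j * mean P (X (t j)) +
     (\sum_i \sum_j a i * a j * cov P (X (t i)) (X (t j))) / 2))%:E)%E.
Proof.
have X2 j : (X (t j) : T -> R) \in Lfun P 2%:E by exact: gaussian_process_L2.
rewrite -(mean_sum _ a X2) -(cov_sum _ a X2).
apply: gaussian_variable_mgf (GX t a).
by apply: measurable_sum => j; exact: measurable_funM.
Qed.

Lemma gaussian_mgf_integrable n (t : 'I_n -> I) (a : 'I_n -> R) :
  P.-integrable setT (EFin \o (fun w => expR (\sum_j a j * X (t j) w))).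
Proof.
by apply: integrable_expR_comb => //; rewrite gaussian_mgf ltry.
Qed.

End GaussianProcess.

(* [lebesgue_measure] lives on [measurableTypeR R], whose display differs from
   the one of the canonical measurable structure of [R]. *)
Definition leb {R : realType} (A : set R) : \bar R := lebesgue_measure A.

Section Leb.
Context {R : realType}.

Let leb0 : leb (set0 : set R) = 0%E. Proof. exact: measure0. Qed.

Let leb_ge0 (A : set R) : (0 <= leb A)%E. Proof. exact: measure_ge0. Qed.

Let leb_semi_sigma_additive : semi_sigma_additive (leb : set R -> \bar R).
Proof.
move=> F mF tF mUF; exact: (@measure_semi_sigma_additive _ _ _ (@lebesgue_measure R) F).
Qed.

HB.instance Definition _ := isMeasure.Build _ _ _ (leb : set R -> \bar R)
  leb0 leb_ge0 leb_semi_sigma_additive.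

Let leb_sigma_finite : sigma_finite setT (leb : set R -> \bar R).
Proof.
have [F FT mF] := @sigma_finiteT _ _ _ (@lebesgue_measure R).
by exists F.
Qed.

HB.instance Definition _ := @Measure_isSigmaFinite.Build _ _ _
  (leb : set R -> \bar R) leb_sigma_finite.

Lemma integral_leb (f : R -> \bar R) : measurable_fun setT f -> (forall x, 0 <= f x)%E ->
  (\int[lebesgue_measure]_x f x = \int[leb]_x f x)%E.
Proof.
move=> mf f0.
apply: (eq_integral_comp_law (X1 := fun x : measurableTypeR R => x : R)
  (X2 := @id R)) => //.
Qed.

End Leb.

(** * Translations of Lebesgue measure and exponential intensities *)

Section Translation.
Context {R : realType}.

Let mshift (c : R) : measurable_fun setT (fun x : R => x + c).
Proof. exact: measurable_funD. Qed.

Lemma lebesgue_preimage_shift (c : R) (A : set R) : measurable A ->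
  leb ((fun x => x + c) @^-1` A) = leb A.
Proof.
move=> mA; apply/esym.
have mshift' : measurable_fun setT (fun x : measurableTypeR R => (x : R) + c : measurableTypeR R).
  exact: (mshift c).
pose nu : {measure set (measurableTypeR R) -> \bar R} := pushforward (@lebesgue_measure R)
  (fun x : measurableTypeR R => (x : R) + c : measurableTypeR R).
apply: (lebesgue_measure_unique (mu := nu mshift')) => // X [[a b] _ <-].
rewrite /nu /= /pushforward.
rewrite (_ : _ @^-1` _ = `]a - c, b - c]%classic).
  by rewrite !lebesgue_measure_itv/= !lte_fin ltrBlDr subrK; case: ifP => // _;
    rewrite -!EFinB; congr _%:E; ring.
by apply/seteqP; split => x /=; rewrite !in_itv/= ltrBlDr lerBrDr.
Qed.

Lemma integral_lebesgue_shift (c : R) (f : R -> \bar R) :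
  measurable_fun setT f -> (forall x, 0 <= f x)%E ->
  (\int[leb]_x f (x + c)%R = \int[leb]_x f x)%E.
Proof.
move=> mf f0.
by apply: (eq_integral_comp_law (mshift c) (@measurable_id _ _ setT)) => // A mA;
  exact: lebesgue_preimage_shift.
Qed.

End Translation.

Lemma exp_measureE {R : realType} (lambda : R) (A : set R) : measurable A ->
  exp_measure lambda A = (\int[leb]_x ((expR (- lambda * x))%:E * (\1_A x)%:E))%E.
Proof.
move=> mA.
have mexp : measurable_fun setT (fun x : R => expR (- lambda * x)).
  by apply: measurableT_comp => //; exact: measurable_funM.
transitivity (\int[lebesgue_measure]_x ((fun x => (expR (- lambda * x))%:E) \_ A) x)%E.
  exact: integral_mkcond.
transitivity (\int[leb]_x ((fun x => (expR (- lambda * x))%:E) \_ A) x)%E.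
  apply: integral_leb.
    apply/(measurable_restrictT _ mA); apply: measurable_funTS; exact/measurable_EFinP.
  by move=> x; rewrite erestrict_ge0// => y _; rewrite lee_fin expR_ge0.
by apply: eq_integral => x _; rewrite epatch_indic.
Qed.

Lemma exp_measure0 {R : realType} (A : set R) : measurable A -> exp_measure 0 A = leb A.
Proof.
move=> mA; rewrite exp_measureE//; transitivity (\int[leb]_x (\1_A x : R)%:E)%E.
  by apply: eq_integral => x _; rewrite oppr0 mul0r expR0 mul1e.
by rewrite integral_indic// setIT.
Qed.

Section ExponentialIntensity.
Context {R : realType}.
Variables (m : {measure set R -> \bar R}) (alpha lambda : R).
Hypothesis alpha0 : 0 <= alpha.
Hypothesis mE : forall B : set R, measurable B ->
  m B = (alpha%:E * exp_measure lambda B)%E.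

Let mexp : measurable_fun setT (fun x : R => expR (- lambda * x)).
Proof. by apply: measurableT_comp => //; exact: measurable_funM. Qed.

Lemma integral_exp_intensity (h : R -> \bar R) :
  measurable_fun setT h -> (forall x, 0 <= h x)%E ->
  (\int[m]_x h x = alpha%:E * \int[leb]_x ((expR (- lambda * x))%:E * h x))%E.
Proof.
move=> mh h0.
have mD : measurable_fun setT (fun x => alpha * expR (- lambda * x)).
  exact: measurable_funM.
have D0 x : 0 <= alpha * expR (- lambda * x) by rewrite mulr_ge0 ?expR_ge0.
have [nu [nuA nuE]] := exists_density_measure leb mD D0.
transitivity (\int[nu]_x h x)%E.
  apply: eq_measure_integral => A mA _; rewrite nuA//.
  under eq_integral do rewrite EFinM -muleA.
  rewrite ge0_integralZl//; first last.
    apply: emeasurable_funM; first exact/measurable_EFinP.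
    exact/measurable_EFinP/measurable_indic.
  rewrite [LHS](mE mA); congr (_ * _)%E.
  exact: exp_measureE.
rewrite nuE//.
under eq_integral do rewrite EFinM -muleA.
rewrite ge0_integralZl//.
- by apply: emeasurable_funM => //; exact/measurable_EFinP.
- by move=> x _; rewrite mule_ge0// lee_fin expR_ge0.
Qed.

(** The substitution [v = u + Y w] turns [expR (- lambda * u)] into [expR (- lambda * v) * expR
    (lambda * Y w)]; it is made inside Fubini's theorem, for fixed [w]. *)
Lemma exp_intensity_tilt dX dS (TX : measurableType dX) (S : measurableType dS)
    (PX : probability TX R) (Y : TX -> R) (D : TX -> S) (H : R * S -> \bar R) :
  measurable_fun setT Y -> measurable_fun setT D ->
  measurable_fun setT H -> (forall x, 0 <= H x)%E ->
  (\int[m]_u \int[PX]_w H (u + Y w, D w)%R =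
   alpha%:E * \int[leb]_v ((expR (- lambda * v))%:E *
     \int[PX]_w ((expR (lambda * Y w))%:E * H (v, D w))))%E.
Proof.
move=> mY mD mH H0.
have mH1 : measurable_fun setT (fun p : R * TX => H (p.1 + Y p.2, D p.2)).
  apply: (measurable_comp2 mH); last exact: (measurableT_comp mD measurable_snd).
  apply: measurable_funD => //; exact: (measurableT_comp mY measurable_snd).
have meY : measurable_fun setT (fun w => expR (lambda * Y w)).
  by apply: measurableT_comp => //; exact: measurable_funM.
have mH2 : measurable_fun setT (fun p : R * TX => (expR (lambda * Y p.2))%:E * H (p.1, D p.2))%E.
  apply: emeasurable_funM.
    apply/measurable_EFinP; exact: (measurableT_comp meY measurable_snd).
  exact: measurable_comp2 mH measurable_fst (measurableT_comp mD measurable_snd).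
have H20 p : (0 <= (expR (lambda * Y p.2))%:E * H (p.1, D p.2))%E.
  by rewrite mule_ge0// lee_fin expR_ge0.
rewrite integral_exp_intensity//; first last.
- by move=> u; exact: integral_ge0.
- exact: (measurable_fun_fubini_tonelli_F
    (fun p : R * TX => H (p.1 + Y p.2, D p.2))).
congr (_ * _)%E.
have mexp1 : measurable_fun setT (fun p : R * TX => (expR (- lambda * p.1))%:E).
  by apply/measurable_EFinP; exact: (measurableT_comp mexp measurable_fst).
have e0 (r : R) : (0 <= (expR r)%:E)%E by rewrite lee_fin expR_ge0.
transitivity (\int[leb]_u \int[PX]_w
    ((expR (- lambda * u))%:E * H (u + Y w, D w)%R))%E.
  apply: eq_integral => u _; rewrite ge0_integralZl//.
  by apply: (measurableT_comp mH1 (g := fun w => (u, w))); exact: measurable_pair1.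
rewrite (fubini_tonelli (m1 := leb) (m2 := PX)
  (fun p : R * TX => (expR (- lambda * p.1))%:E * H (p.1 + Y p.2, D p.2)%R)%E)//=; first last.
- by move=> p; rewrite mule_ge0.
- exact: emeasurable_funM.
transitivity (\int[PX]_w \int[leb]_v
    ((expR (- lambda * v))%:E * ((expR (lambda * Y w))%:E * H (v, D w))))%E.
  apply: eq_integral => w _.
  rewrite -(integral_lebesgue_shift (Y w) (f := fun v => (expR (- lambda * v))%:E *
    ((expR (lambda * Y w))%:E * H (v, D w)))%E).
  - apply: eq_integral => u _; rewrite muleA -EFinM -expRD; congr ((expR _)%:E * _)%E.
    by ring.
  - apply: emeasurable_funM; first exact/measurable_EFinP.
    by apply: (measurableT_comp mH2 (g := fun v => (v, w))); exact: measurable_pair2.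
  - by move=> v; rewrite !mule_ge0.
rewrite -(fubini_tonelli (m1 := leb) (m2 := PX)
  (fun p : R * TX => (expR (- lambda * p.1))%:E *
    ((expR (lambda * Y p.2))%:E * H (p.1, D p.2)))%E)//=; first last.
- by move=> p; rewrite mule_ge0.
- exact: emeasurable_funM.
apply: eq_integral => v _; rewrite ge0_integralZl//.
- by apply: (measurableT_comp mH2 (g := fun w => (v, w))); exact: measurable_pair1.
- by move=> w _; exact: (H20 (v, w)).
Qed.

End ExponentialIntensity.

Section GaussianIncrements.
Context {R : realType} dX (TX : measurableType dX) (PX : probability TX R) (d : nat).
Variable xi : 'rV[R]_d -> {RV PX >-> R}.
Hypothesis Gxi : gaussian_process xi.
Local Notation mu t := (mean PX (xi t)).
Local Notation c s t := (cov PX (xi s) (xi t)).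

Let mxi t : measurable_fun setT (xi t : TX -> R). Proof. exact: measurable_funPT. Qed.
Let xi2 t : (xi t : TX -> R) \in Lfun PX 2%:E. Proof. exact: gaussian_process_L2. Qed.

Definition increment h t w := xi (t + h) w - xi h w.

Lemma L2_increment h t : increment h t \in Lfun PX 2%:E.
Proof.
rewrite (_ : increment h t = fun w => xi (t + h) w + -1 * xi h w).
  by apply: L2_add => //; exact: L2_scale.
by apply/funext => w; rewrite mulN1r.
Qed.

Lemma measurable_increment h t : measurable_fun setT (increment h t).
Proof. exact: measurable_funB. Qed.

Lemma mean_increment h t : mean PX (increment h t) = mu (t + h) - mu h.
Proof.
apply: EFin_inj; rewrite -meanE ?L2_increment// EFinB -!meanE//.
by rewrite -expectationB ?L2_L1.
Qed.

Lemma cov_incrementr h t F : F \in Lfun PX 2%:E ->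
  cov PX F (increment h t) = cov PX F (xi (t + h)) - cov PX F (xi h).
Proof.
move=> F2; apply: EFin_inj; rewrite -covE ?L2_increment// EFinB -!covE//.
by rewrite -covarianceBr.
Qed.

Lemma cov_increment h s t : cov PX (increment h s) (increment h t) =
  c (s + h) (t + h) - c (s + h) h - c h (t + h) + c h h.
Proof.
rewrite cov_incrementr ?L2_increment// ![cov PX (increment _ _) _]covC !cov_incrementr//.
by rewrite ![cov PX _ (xi (s + h))]covC [cov PX (xi (t + h)) _]covC; ring.
Qed.

(** The vector formed by [xi h] and the increments is Gaussian, being linear in values of [xi]; its
    exponent is expanded in mean and covariance. *)
Lemma mgf_increments l h n (t : 'I_n -> 'rV[R]_d) (a : 'I_n -> R) :
  (\int[PX]_w (expR (l * xi h w) * expR (\sum_j a j * increment h (t j) w))%:E =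
   (expR ((l * mu h + l ^+ 2 * c h h / 2) +
     \sum_j a j * (mean PX (increment h (t j)) + l * cov PX (xi h) (increment h (t j))) +
     (\sum_i \sum_j a i * a j * cov PX (increment h (t i)) (increment h (t j))) / 2))%:E)%E.
Proof.
pose Y (i : 'I_n.+1) : TX -> R := if unlift ord0 i is Some j then increment h (t j) else xi h.
pose b (i : 'I_n.+1) : R := if unlift ord0 i is Some j then a j else l.
pose r (i : 'I_n.+1) := if unlift ord0 i is Some j then t j + h else h.
(* Each increment contributes [- xi h], hence the coefficient [l - \sum_j a j] of [xi h] when the
   combination is written in the values of [xi]. *)
pose b' (i : 'I_n.+1) : R := if unlift ord0 i is Some j then a j else l - \sum_j a j.
have Y0 : Y ord0 = xi h by rewrite /Y unlift_none.
have YS j : Y (lift ord0 j) = increment h (t j) by rewrite /Y liftK.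
have b0 : b ord0 = l by rewrite /b unlift_none.
have bS j : b (lift ord0 j) = a j by rewrite /b liftK.
have r0 : r ord0 = h by rewrite /r unlift_none.
have rS j : r (lift ord0 j) = t j + h by rewrite /r liftK.
have b'0 : b' ord0 = l - \sum_j a j by rewrite /b' unlift_none.
have b'S j : b' (lift ord0 j) = a j by rewrite /b' liftK.
have Y2 i : Y i \in Lfun PX 2%:E.
  by rewrite /Y; case: unlift => // j; exact: L2_increment.
have LE : (fun w => \sum_i b i * Y i w) = (fun w => \sum_i b' i * xi (r i) w).
  apply/funext => w; rewrite !big_ord_recl Y0 b0 r0.
  under eq_bigr do rewrite YS bS /increment mulrBr.
  under [in RHS]eq_bigr do rewrite rS b'S.
  by rewrite b'0 sumrB -mulr_suml mulrBl; ring.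
have lawY := Gxi r b'.
have mY : measurable_fun setT (fun w => \sum_i b i * Y i w).
  apply: measurable_sum => i; apply: measurable_funM => //.
  by rewrite /Y; case: unlift => // j; exact: measurable_increment.
have {}lawY : exists m s : R, forall B : set R, measurable B ->
    PX [set w | B (\sum_i b i * Y i w)] = normal_law m s B.
  have [m [s lawY']] := lawY; exists m, s => B mB; rewrite -lawY'//; congr (PX _).
  by rewrite -[LHS](_ : (fun w => \sum_i b i * Y i w) @^-1` B = _)// LE.
transitivity (\int[PX]_w (expR (\sum_i b i * Y i w))%:E)%E.
  apply: eq_integral => w _; rewrite -expRD big_ord_recl b0 Y0.
  by under [in RHS]eq_bigr do rewrite YS bS.
rewrite (gaussian_variable_mgf mY lawY) (mean_sum _ b Y2) (cov_sum _ b Y2).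
congr (expR _)%:E.
rewrite !big_ord_recl b0 Y0.
under eq_bigr do rewrite YS bS.
under [X in _ + (_ + X + _) / 2]eq_bigr do rewrite YS bS.
under [X in _ + (_ + _ + X) / 2]eq_bigr => i _.
  rewrite big_ord_recl YS bS b0 Y0.
  under eq_bigr do rewrite YS bS.
  over.
rewrite big_split/=.
have -> : \sum_i a i * l * cov PX (increment h (t i)) (xi h) =
    \sum_j l * a j * cov PX (xi h) (increment h (t j)).
  by apply: eq_bigr => j _; rewrite covC; ring.
have -> : \sum_j l * a j * cov PX (xi h) (increment h (t j)) =
    \sum_j a j * (l * cov PX (xi h) (increment h (t j))).
  by apply: eq_bigr => j _; ring.
under [in RHS]eq_bigr do rewrite mulrDr.
rewrite big_split/=.
set A := \sum_j a j * mean _ _; set B := \sum_j a j * (l * _).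
by set D := \sum_i \sum_j _; field.
Qed.

Definition increment_mgf l h n (t : 'I_n -> 'rV[R]_d) (a : 'I_n -> R) :=
  (\int[PX]_w (expR (l * xi h w) * expR (\sum_j a j * increment h (t j) w))%:E)%E.

(* The density [expR (l * xi h)] turns the increments of [xi] after [h] into a
   copy of [xi]. *)
Definition tilt_invariant l := forall h n (t : 'I_n -> 'rV[R]_d) a,
  increment_mgf l h t a = (\int[PX]_w (expR (\sum_j a j * xi (t j) w))%:E)%E.

(** The constant, linear and quadratic coefficients in [a] of the exponents. The first condition
    says that [expR (l * xi h)] has mean 1; in the second, tilting a Gaussian law by it adds [l]
    times the covariance to the means and, by the third, leaves covariances alone. *)
Lemma tilt_invariantP l : tilt_invariant l <->
  [/\ forall h, l * mu h + l ^+ 2 * c h h / 2 = 0,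
      forall h t, mean PX (increment h t) + l * cov PX (xi h) (increment h t) = mu t &
      forall h s t, cov PX (increment h s) (increment h t) = c s t].
Proof.
split=> [ti|[e1 e2 e3] h n t a]; last first.
  rewrite /increment_mgf mgf_increments gaussian_mgf// e1 add0r; congr (expR (_ + _ / 2))%:E.
    by apply: eq_bigr => j _; rewrite e2.
  by apply: eq_bigr => i _; apply: eq_bigr => j _; rewrite e3.
have tiE h n (t : 'I_n -> 'rV[R]_d) a : (l * mu h + l ^+ 2 * c h h / 2) +
     \sum_j a j * (mean PX (increment h (t j)) + l * cov PX (xi h) (increment h (t j))) +
     (\sum_i \sum_j a i * a j * cov PX (increment h (t i)) (increment h (t j))) / 2 =
   \sum_j a j * mu (t j) + (\sum_i \sum_j a i * a j * c (t i) (t j)) / 2.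
  by have := ti h n t a; rewrite /increment_mgf mgf_increments gaussian_mgf// => -[/expR_inj].
have e1 h : l * mu h + l ^+ 2 * c h h / 2 = 0.
  by have := tiE h 0%N (fun=> 0) (fun=> 0); rewrite !big_ord0 !mul0r !addr0.
have e23 h t : mean PX (increment h t) + l * cov PX (xi h) (increment h t) = mu t /\
    cov PX (increment h t) (increment h t) = c t t.
  (* The values 1 and -1 separate the linear from the quadratic part; two indices then give the
     covariances by polarization. *)
  have := tiE h 1%N (fun=> t) (fun=> -1); have := tiE h 1%N (fun=> t) (fun=> 1).
  by rewrite e1 add0r !big_ord1; split; lra.
split=> // [h t|h s t]; first by have [] := e23 h t.
have [e2s e3s] := e23 h s; have [e2t e3t] := e23 h t.
have := tiE h 2%N (fun i => if i == ord0 then s else t) (fun=> 1).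
rewrite e1 add0r !big_ord_recl !big_ord0 /= !addr0 !mul1r.
rewrite e2s e2t e3s e3t.
rewrite [cov PX (increment h t) (increment h s)]covC [cov PX (xi t) (xi s)]covC.
by lra.
Qed.

End GaussianIncrements.

Section TiltedIntensity.
Context {R : realType} dX (TX : measurableType dX) (PX : probability TX R) (d : nat).
Variable xi : 'rV[R]_d -> {RV PX >-> R}.
Hypothesis Gxi : gaussian_process xi.
Hypothesis xi0 : {ae PX, forall w, xi 0 w = 0}.
Variables (m : {measure set R -> \bar R}) (alpha lambda : R).
Hypothesis alpha0 : 0 < alpha.
Hypothesis mE : forall B : set R, measurable B ->
  m B = (alpha%:E * exp_measure lambda B)%E.
Hypothesis m_sigma : sigma_finite setT m.

Let mxi t : measurable_fun setT (xi t : TX -> R). Proof. exact: measurable_funPT. Qed.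

Let Z n (t : n.-tuple 'rV[R]_d) := tuple_of_process (fun s => xi s : TX -> R) t.

Let D h n (t : n.-tuple 'rV[R]_d) := tuple_of_process (increment xi h) t.

Let mZ n (t : n.-tuple 'rV[R]_d) : measurable_fun setT (Z t).
Proof. exact: measurable_tuple_of_process. Qed.

Let mD h n (t : n.-tuple 'rV[R]_d) : measurable_fun setT (D h t).
Proof. by apply: measurable_tuple_of_process => s; exact: measurable_increment. Qed.

Let mY h : measurable_fun setT (fun w => expR (lambda * xi h w)).
Proof. by apply: measurableT_comp => //; exact: measurable_funM. Qed.

(** The particle at time [t j + h] is its position [u + xi h] at time [h] plus an increment. After
    substituting for that position, the increments under the density [expR (lambda * xi h)] are
    compared with [xi] by uniqueness of the moment generating function. *)
Lemma tilt_invariant_shift : tilt_invariant xi lambda -> shift_invariant m xi.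
Proof.
move=> ti n t h A mA.
have mS : measurable_fun setT (fun p : R * n.-tuple R => (\1_A (shift_tuple p.1 p.2) : R)%:E).
  apply/measurable_EFinP; apply: (measurableT_comp (measurable_indic mA)).
  exact: measurable_shift_tuple.
have S0 (p : R * n.-tuple R) : (0 <= (\1_A (shift_tuple p.1 p.2) : R)%:E)%E by [].
transitivity (\int[m]_u \int[PX]_w (\1_A (shift_tuple (u + xi h w)%R (D h t w)) : R)%:E)%E.
  apply: eq_integral => u _; apply: eq_integral => w _; congr (\1_A _)%:E.
  apply/eq_from_tnth => j; rewrite !tnth_mktuple /increment; ring.
rewrite (exp_intensity_tilt (ltW alpha0) mE PX (mxi h) (mD h t) mS S0).
rewrite /intensity (integral_exp_intensity (ltW alpha0) mE); last 2 first.
- apply: (measurable_fun_fubini_tonelli_F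
    (fun p : R * TX => (\1_A (shift_tuple p.1 (Z t p.2)) : R)%:E)) => //.
  exact: measurable_comp2 mS measurable_fst (measurableT_comp (mZ t) measurable_snd).
- by move=> u; apply: integral_ge0.
congr (_ * _)%E; apply: eq_integral => v _; congr (_ * _)%E => /=.
have [nu [nuA nuE]] := exists_density_measure PX (mY h) (fun w => expR_ge0 _).
have agree (a : 'I_n -> R) : integrals_agree nu PX
    (fun w => expR (\sum_j a j * increment xi h (tnth t j) w))
    (fun w => expR (\sum_j a j * xi (tnth t j) w)).
  have iR := gaussian_mgf_integrable Gxi (tnth t) a.
  have mE' : measurable_fun setT (fun w => (expR (\sum_j a j * increment xi h (tnth t j) w))%:E).
    by apply/measurable_EFinP/measurable_expR_comb => j; exact: measurable_increment.
  have eqI : (\int[nu]_w (expR (\sum_j a j * increment xi h (tnth t j) w))%:E =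
     \int[PX]_w (expR (\sum_j a j * xi (tnth t j) w))%:E)%E.
    rewrite nuE//.
    by rewrite -(ti h n (tnth t) a); apply: eq_integral => w _; rewrite EFinM.
  split => //; apply: integrable_expR_comb; first by move=> j; exact: measurable_increment.
  by rewrite eqI gaussian_mgf// ltry.
have mA' : measurable ((fun x : n.-tuple R => shift_tuple v x) @^-1` A).
  rewrite -[X in measurable X]setTI; apply: (measurableT_comp (@measurable_shift_tuple R n)
    (g := fun x => (v, x))) => //.
  exact: measurable_pair1.
have := mgf_unique (fun j => measurable_increment xi h (tnth t j)) (fun j => mxi (tnth t j))
  agree mA'.
have mDA : measurable (D h t @^-1` ((fun x : n.-tuple R => shift_tuple v x) @^-1` A)).
  by apply: measurable_preimage => //; exact: mD.
have mZA : measurable (Z t @^-1` ((fun x : n.-tuple R => shift_tuple v x) @^-1` A)).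
  by apply: measurable_preimage => //; exact: mZ.
move=> e; transitivity (nu (D h t @^-1` ((fun x : n.-tuple R => shift_tuple v x) @^-1` A))).
  by rewrite nuA.
transitivity (PX (Z t @^-1` ((fun x : n.-tuple R => shift_tuple v x) @^-1` A))).
  exact: e.
by rewrite -[X in PX X]setIT -integral_indic.
Qed.

(** A test function that sees the position at the reference time and the increments from there
    isolates the tilted moment generating function. Shifts by [h] and by 0 are then compared, and
    [xi 0] vanishes almost surely. *)
Lemma shift_invariant_tilt : shift_invariant m xi -> tilt_invariant xi lambda.
Proof.
move=> inv h n t a.
pose tt := [tuple t j | j < n].
(* The factor [expR (lambda * p.1)] cancels the density of [m], and the unit interval leaves total
   mass 1. *)
pose H (p : R * n.-tuple R) : \bar R :=
  ((\1_`[0%R, 1%R]%classic p.1 * expR (lambda * p.1)) * expR (\sum_j a j * tnth p.2 j))%:E.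
have mH : measurable_fun setT H.
  apply/measurable_EFinP; apply: measurable_funM.
    apply: measurable_funM.
      by apply: (measurableT_comp (measurable_indic _) measurable_fst); exact: measurable_itv.
    apply: measurableT_comp => //; exact: measurable_funM.
  apply: measurableT_comp => //; apply: measurable_sum => j; apply: measurable_funM => //.
  exact: (measurableT_comp (measurable_tnth j) measurable_snd).
have H0 p : (0 <= H p)%E by rewrite lee_fin !mulr_ge0 ?expR_ge0.
have IE k : (\int[m]_u \int[PX]_w H (u + xi k w, D k tt w)%R =
    alpha%:E * increment_mgf xi lambda k t a)%E.
  rewrite (exp_intensity_tilt (ltW alpha0) mE PX (mxi k) (mD k tt) mH H0); congr (_ * _)%E.
  transitivity (\int[leb]_v ((\1_`[0%R, 1%R]%classic v)%:E * increment_mgf xi lambda k t a))%E.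
    apply: eq_integral => v _.
    have mE2 : measurable_fun setT (fun w => (expR (lambda * xi k w))%:E * H (v, D k tt w))%E.
      apply: emeasurable_funM; first exact/measurable_EFinP.
      exact: measurable_comp2 mH (measurable_cst v) (mD k tt).
    have mE1 : measurable_fun setT (fun w => (expR (lambda * xi k w) *
        expR (\sum_j a j * increment xi k (t j) w))%:E).
      apply/measurable_EFinP/measurable_funM => //.
      by apply: measurable_expR_comb => j; exact: measurable_increment.
    rewrite /increment_mgf -!ge0_integralZl ?lee_fin ?expR_ge0//; last first.
      by move=> w _; rewrite mule_ge0 ?lee_fin ?expR_ge0.
    apply: eq_integral => w _; rewrite /H /= -!EFinM; congr (_%:E).
    have -> : \sum_j a j * tnth (D k tt w) j = \sum_j a j * increment xi k (t j) w.
      by apply: eq_bigr => j _; rewrite !tnth_mktuple.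
    have e1 : expR (- lambda * v) * expR (lambda * v) = 1.
      by rewrite -expRD mulNr addNr expR0.
    rewrite -[RHS]mul1r -e1; ring.
  rewrite ge0_integralZr//; last 2 first.
  - by apply/measurable_EFinP; apply: measurable_indic; exact: measurable_itv.
  - by apply: integral_ge0 => w _; rewrite lee_fin mulr_ge0 ?expR_ge0.
  rewrite integral_indic//.
  have l1 : leb `[0 : R, 1%R]%classic = 1%E.
    by rewrite [LHS]lebesgue_measure_itv/= lte_fin ltr01 sube0.
  by rewrite setIT [X in (X * _)%E]l1 mul1e.
pose G (x : n.+1.-tuple R) := H (tnth x ord0, [tuple tnth x (lift ord0 j) - tnth x ord0 | j < n]).
have mG : measurable_fun setT G.
  apply: (measurable_comp2 mH (measurable_tnth ord0)).
  by apply: measurable_mktuple => i; apply: measurable_funB; exact: measurable_tnth.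
(* The time 0 is put in front, so that the invariance also records the position from which the
   increments are taken. *)
pose r := [tuple if unlift ord0 i is Some j then t j else 0 | i < n.+1].
have GE k : (\int[m]_u \int[PX]_w G (shift_tuple u (Z [tuple (tnth r j + k)%R | j < n.+1] w)) =
    alpha%:E * increment_mgf xi lambda k t a)%E.
  rewrite -IE; apply: eq_integral => u _; apply: eq_integral => w _; rewrite /G; congr (H (_, _)).
    by rewrite !tnth_mktuple unlift_none add0r.
  apply/eq_from_tnth => j; rewrite !tnth_mktuple unlift_none liftK add0r /increment; ring.
have G0 x : (0 <= G x)%E by exact: H0.
have E k : (alpha%:E * increment_mgf xi lambda k t a =
    \int[m]_u \int[PX]_w G (shift_tuple u (Z r w)))%E.
  rewrite -(GE k); clearbody G r.
  exact: (eq_intensity_integral m_sigma (mZ _) (mZ _) (inv _ r k) mG G0).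
have eq0 := etrans (E h) (esym (E 0)).
transitivity (increment_mgf xi lambda 0 t a).
  exact: mulIe (lt0r_neq0 alpha0) eq0.
apply: ge0_ae_eq_integral => //.
- apply/measurable_EFinP/measurable_funM => //.
  by apply: measurable_expR_comb => j; exact: measurable_increment.
- by apply/measurable_EFinP; exact: measurable_expR_comb.
apply: filterS xi0 => w xi0w _; rewrite xi0w mulr0 expR0 mul1r; congr (expR _)%:E.
by apply: eq_bigr => j _; rewrite /increment addr0 xi0w subr0.
Qed.

End TiltedIntensity.

(** * Identification of the intensity measure *)

Lemma integral_normal_prob {R : realType} (mu s : R) (f : R -> \bar R) :
  measurable_fun setT f -> (forall x, 0 <= f x)%E ->
  (\int[normal_prob mu s]_x f x = \int[leb]_x ((normal_pdf mu s x)%:E * f x))%E.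
Proof.
move=> mf f0; rewrite ge0_integral_normal_prob//.
apply: (integral_leb (f := fun x => ((normal_pdf mu s x)%:E * f x)%E)).
  by apply: emeasurable_funM => //; apply/measurable_EFinP; exact: measurable_normal_pdf.
by move=> x; rewrite mule_ge0// lee_fin normal_pdf_ge0.
Qed.

Section NormalLaw.
Context {R : realType} d (T : measurableType d) (P : probability T R).
Variables (X : T -> R) (mu s : R).
Hypothesis mX : measurable_fun setT X.
Hypothesis lawX : forall B : set R, measurable B -> P [set w | B (X w)] = normal_law mu s B.

Lemma normal_law_dirac (f : R -> \bar R) : s = 0 -> measurable_fun setT f ->
  (forall x, 0 <= f x)%E -> (\int[P]_w f (X w) = f mu)%E.
Proof.
move=> s0 mf f0; transitivity (\int[dirac mu]_x f (id x))%E.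
  apply: (eq_integral_comp_law mX (@measurable_id _ _ setT)) => // A mA.
  by rewrite [LHS]lawX// /normal_law s0 eqxx.
by rewrite integral_dirac// diracT mul1e.
Qed.

Lemma normal_law_density (f : R -> \bar R) : s != 0 -> measurable_fun setT f ->
  (forall x, 0 <= f x)%E ->
  (\int[P]_w f (X w) = \int[leb]_x ((normal_pdf mu s x)%:E * f x))%E.
Proof.
move=> s0 mf f0.
transitivity (\int[normal_prob mu s]_x f x)%E.
  apply: (eq_integral_comp_law mX (X2 := fun x : measurableTypeR R => x : R)) => // A mA.
  by rewrite [LHS]lawX// /normal_law (negbTE s0).
exact: integral_normal_prob.
Qed.

End NormalLaw.

Section TwoPoints.
Context {R : realType} dX (TX : measurableType dX) (PX : probability TX R) (d : nat).
Variable xi : 'rV[R]_d -> {RV PX >-> R}.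
Variable m : {measure set R -> \bar R}.
Hypothesis m_sigma : sigma_finite setT m.
Hypothesis inv : shift_invariant m xi.

Let mxi t : measurable_fun setT (xi t : TX -> R). Proof. exact: measurable_funPT. Qed.

Lemma shift_invariant2 h s t (F : R * R -> \bar R) :
  measurable_fun setT F -> (forall p, 0 <= F p)%E ->
  (\int[m]_u \int[PX]_w F (u + xi (s + h) w, u + xi (t + h) w)%R =
   \int[m]_u \int[PX]_w F (u + xi s w, u + xi t w)%R)%E.
Proof.
move=> mF F0.
pose r : 2.-tuple 'rV[R]_d := [tuple s; t].
pose G (x : 2.-tuple R) := F (tnth x ord0, tnth x ord_max).
have mG : measurable_fun setT G.
  exact: measurable_comp2 mF (measurable_tnth ord0) (measurable_tnth ord_max).
have G0 x : (0 <= G x)%E by exact: F0.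
have mZ (q : 2.-tuple 'rV[R]_d) :
    measurable_fun setT (tuple_of_process (fun s => xi s : TX -> R) q).
  exact: measurable_tuple_of_process.
have := eq_intensity_integral m_sigma (mZ _) (mZ _) (inv r h) mG G0.
have GE (q : 2.-tuple 'rV[R]_d) u w :
    G (shift_tuple u (tuple_of_process (fun s => xi s : TX -> R) q w)) =
    F (u + xi (tnth q ord0) w, u + xi (tnth q ord_max) w).
  by rewrite /G !tnth_mktuple.
under eq_integral do under eq_integral do rewrite GE !tnth_mktuple.
under [X in _ = X -> _]eq_integral do under eq_integral do rewrite GE.
by [].
Qed.

Hypothesis xi0 : {ae PX, forall w, xi 0 w = 0}.

Lemma shift_invariant_reversal t (F : R * R -> \bar R) :
  measurable_fun setT F -> (forall p, 0 <= F p)%E ->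
  (\int[m]_u \int[PX]_w F (u, u + xi t w)%R =
   \int[m]_y \int[PX]_w F (y + xi (- t) w, y)%R)%E.
Proof.
move=> mF F0.
have := shift_invariant2 t (- t) 0 mF F0.
rewrite addNr add0r.
have mF2 (X Y : TX -> R) u : measurable_fun setT X -> measurable_fun setT Y ->
    measurable_fun setT (fun w => F (u + X w, u + Y w)%R).
  by move=> mX mY; apply: (measurable_comp2 mF); exact: measurable_funD.
have mF1 (X : TX -> R) u : measurable_fun setT X -> measurable_fun setT (fun w => F (u, u + X w)%R).
  by move=> mX; apply: (measurable_comp2 mF) => //; exact: measurable_funD.
have mF1' (X : TX -> R) u : measurable_fun setT X ->
    measurable_fun setT (fun w => F (u + X w, u)%R).
  by move=> mX; apply: (measurable_comp2 mF) => //; exact: measurable_funD.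
have e1 u : (\int[PX]_w F (u + xi 0 w, u + xi t w)%R = \int[PX]_w F (u, u + xi t w)%R)%E.
  apply: ge0_ae_eq_integral => //; [exact: mF2|exact: mF1|].
  by apply: filterS xi0 => w xi0w _; rewrite xi0w addr0.
have e2 u : (\int[PX]_w F (u + xi (- t) w, u + xi 0 w)%R = \int[PX]_w F (u + xi (- t) w, u)%R)%E.
  apply: ge0_ae_eq_integral => //; [exact: mF2|exact: mF1'|].
  by apply: filterS xi0 => w xi0w _; rewrite xi0w addr0.
under eq_integral do rewrite e1.
by under [X in _ = X -> _]eq_integral do rewrite e2.
Qed.

End TwoPoints.

Section QuadraticExponent.
Context {R : realType}.

(** In the reversal a displacement [z] over the time [- t] is the displacement [- z] over the time
    [t]; this ratio of the two densities is the function [rho]. *)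
Lemma normal_pdf_quadratic (m1 s1 m2 s2 : R) : s1 != 0 -> s2 != 0 ->
  exists q0 q1 q2 : R, forall z,
    normal_pdf m1 s1 z / normal_pdf m2 s2 (- z) = expR (q2 * z ^+ 2 + q1 * z + q0).
Proof.
move=> s10 s20; have p1 := normal_peak_gt0 s10; have p2 := normal_peak_gt0 s20.
exists (ln (normal_peak s1 / normal_peak s2) - m1 ^+ 2 / (s1 ^+ 2 *+ 2) + m2 ^+ 2 / (s2 ^+ 2 *+ 2)).
exists (m1 / s1 ^+ 2 + m2 / s2 ^+ 2), ((s2 ^+ 2 *+ 2)^-1 - (s1 ^+ 2 *+ 2)^-1) => z.
rewrite !normal_pdfE// /normal_fun invfM mulrACA -expRN.
rewrite -[normal_peak s1 / normal_peak s2]lnK ?posrE ?divr_gt0// -!expRD.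
by congr expR; rewrite lnK ?posrE ?divr_gt0//; field; rewrite s10 s20.
Qed.

End QuadraticExponent.

Lemma measurable_indic_diff {R : realType} (B : set R) : measurable B ->
  measurable_fun setT (fun p : R * R => \1_B (p.2 - p.1) : R).
Proof.
move=> mB; apply: (measurableT_comp (measurable_indic mB) (g := fun p : R * R => p.2 - p.1)).
exact: measurable_funB.
Qed.

Lemma exists_positive_itv {R : realType} (m : {measure set R -> \bar R}) :
  m setT != 0%E -> exists n : nat, (0 < m `[(- n%:R)%R, n%:R]%classic)%E.
Proof.
move=> m_neq0; apply: contrapT => nA; move/negP: m_neq0; apply; apply/eqP.
have m0 (n : nat) : m `[(- n%:R)%R, n%:R]%classic = 0%E.
  apply/eqP; rewrite eq_le measure_ge0 andbT leNgt; apply/negP => mn.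
  by apply: nA; exists n.
have : m.-negligible (\bigcup_(n : nat) `[(- n%:R : R), n%:R]%classic).
  by apply: negligible_bigcup => n; apply/negligibleP => //; exact: m0.
by rewrite bigcup_centered_itv => /negligibleP ->.
Qed.

Section ReversibleIntensity.
Context {R : realType}.
Variable m : {measure set R -> \bar R}.
Hypothesis m_gauss : gauss_integrable m.
Hypothesis m_neq0 : m setT != 0%E.
Variables q0 q1 q2 : R.
Let rho (z : R) := expR (q2 * z ^+ 2 + q1 * z + q0).
Hypothesis rev : forall F : R * R -> \bar R, measurable_fun setT F -> (forall p, 0 <= F p)%E ->
  (\int[m]_u \int[leb]_y F (u, y) =
   \int[m]_y \int[leb]_v ((rho (v - y))%:E * F (v, y)))%E.

Let mrho : measurable_fun setT rho.
Proof.
apply: measurableT_comp => //; apply: measurable_funD => //.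
by apply: measurable_funD; exact: measurable_funM.
Qed.

Let unit_itv (b : R) : set R := `[b, b + 1]%classic.

Let leb_unit b : leb (unit_itv b) = 1%E.
Proof.
by rewrite [LHS]lebesgue_measure_itv/= lte_fin ltrDl ltr01 -EFinB addrAC subrr add0r.
Qed.

Let munit b : measurable (unit_itv b). Proof. exact: measurable_itv. Qed.

(* Reversing the pair of points twice multiplies the density by
   [rho z * rho (- z)], so that this product is 1 almost everywhere. *)
Lemma reversal_density (B : set R) : measurable B ->
  (\int[leb]_z ((rho z * rho (- z))%:E * (\1_B z)%:E) = leb B)%E.
Proof.
(* An interval with mass strictly between 0 and [+oo]: the first point is confined to it and its
   mass is cancelled at the end. *)
move=> mB; have [n A0] := exists_positive_itv m_neq0.
have Aoo := gauss_integrable_itv n%:R m_gauss.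
set A := `[(- n%:R)%R, n%:R]%classic in A0 Aoo.
have mA : measurable A by exact: measurable_itv.
pose F1 (p : R * R) : \bar R := (\1_A p.1 * \1_B (p.2 - p.1))%:E.
pose F2 (p : R * R) : \bar R := (rho (p.2 - p.1) * (\1_A p.2 * \1_B (p.1 - p.2)))%:E.
have mF1 : measurable_fun setT F1.
  apply/measurable_EFinP; apply: measurable_funM; last exact: measurable_indic_diff.
  exact: (measurableT_comp (measurable_indic mA) measurable_fst).
have mF2 : measurable_fun setT F2.
  apply/measurable_EFinP; apply: measurable_funM.
    apply: (measurableT_comp mrho (g := fun p : R * R => p.2 - p.1)).
    exact: measurable_funB.
  apply: measurable_funM.
    exact: (measurableT_comp (measurable_indic mA) measurable_snd).
  apply: (measurableT_comp (measurable_indic mB) (g := fun p : R * R => p.1 - p.2)).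
  exact: measurable_funB.
have F10 p : (0 <= F1 p)%E by rewrite lee_fin.
have F20 p : (0 <= F2 p)%E by rewrite lee_fin mulr_ge0 ?expR_ge0.
have mrr : measurable_fun setT (fun z => ((rho z * rho (- z))%:E * (\1_B z)%:E)%E).
  apply: emeasurable_funM; last exact/measurable_EFinP/measurable_indic.
  apply/measurable_EFinP; apply: measurable_funM => //.
  exact: measurableT_comp.
have rr0 z : (0 <= (rho z * rho (- z))%:E * (\1_B z)%:E)%E.
  by rewrite mule_ge0// lee_fin mulr_ge0 ?expR_ge0.
have mB1 : measurable_fun setT (fun z : R => (\1_B z : R)%:E).
  exact/measurable_EFinP/measurable_indic.
have L : (\int[m]_u \int[leb]_y F1 (u, y) = m A * leb B)%E.
  transitivity (\int[m]_u ((\1_A u)%:E * leb B))%E.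
    apply: eq_integral => u _; rewrite /F1 /=.
    under eq_integral do rewrite EFinM.
    rewrite ge0_integralZl//; last first.
      by apply: (measurableT_comp mB1 (g := fun y : R => y - u)); exact: measurable_funB.
    congr (_ * _)%E.
    rewrite (integral_lebesgue_shift (- u) mB1)//.
    by rewrite integral_indic// setIT.
  rewrite ge0_integralZr//; last exact/measurable_EFinP/measurable_indic.
  by rewrite integral_indic// setIT.
have : (m A * leb B = m A * \int[leb]_z ((rho z * rho (- z))%:E * (\1_B z)%:E))%E.
  rewrite -L rev//.
  transitivity (\int[m]_u \int[leb]_y F2 (u, y))%E.
    apply: eq_integral => u _; apply: eq_integral => y _.
    by rewrite /F1 /F2 /= -EFinM.
  rewrite rev//.
  transitivity (\int[m]_y ((\1_A y)%:E *
      \int[leb]_z ((rho z * rho (- z))%:E * (\1_B z)%:E)))%E.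
    apply: eq_integral => y _.
    rewrite -(integral_lebesgue_shift (- y) mrr)// -ge0_integralZl//; last first.
      by apply: (measurableT_comp mrr (g := fun v : R => v - y)); exact: measurable_funB.
    apply: eq_integral => v _; rewrite /F2 /= -!EFinM opprB; congr (_%:E); ring.
  rewrite ge0_integralZr//; [|exact/measurable_EFinP/measurable_indic|exact: integral_ge0].
  by rewrite integral_indic// setIT.
have [a Ea] : exists a, m A = a%:E.
  by exists (fine (m A)); rewrite fineK// ge0_fin_numE.
rewrite Ea => /mulIe -> //.
by rewrite gt_eqF// -lte_fin -Ea.
Qed.

(** The product [rho z * rho (- z)] equals [expR (2 * (q2 * z ^+ 2 + q0))] and has integral 1 over
    every unit interval. Far from 0 it would exceed [expR 2] or stay below [expR (- 2)], according
    to the sign of [q2]. *)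
Lemma reversible_quadratic_coef : q2 = 0.
Proof.
apply/eqP/negPn/negP => q2n0.
(* Chosen so that [|q2| * z ^+ 2 >= |q0| + 1] for all [z >= b]. *)
pose b := 1 + (`|q0| + 1) / `|q2|.
have q2p : 0 < `|q2| by rewrite normr_gt0.
have b1 : 1 <= b by rewrite lerDl divr_ge0// addr_ge0.
have b2 : `|q2| * b = `|q2| + `|q0| + 1 by rewrite /b; field; rewrite normr_eq0.
have bz z : unit_itv b z -> `|q0| + 1 <= `|q2| * z ^+ 2.
  rewrite /unit_itv /= in_itv/= => /andP[bz _].
  have : `|q2| * b <= `|q2| * z ^+ 2.
    by rewrite ler_pM2l// (le_trans bz)// expr2 ler_peMr ?(le_trans b1 bz)//
      (le_trans _ (le_trans b1 bz)).
  by rewrite b2 => h; lra.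
have rrE z : rho z * rho (- z) = expR (2 * (q2 * z ^+ 2 + q0)).
  by rewrite /rho -expRD; congr expR; ring.
have E := reversal_density (munit b); rewrite leb_unit in E.
have mrr : measurable_fun setT (fun z => ((rho z * rho (- z))%:E * (\1_(unit_itv b) z : R)%:E)%E).
  apply: emeasurable_funM; last exact/measurable_EFinP/measurable_indic.
  apply/measurable_EFinP; apply: measurable_funM => //.
  exact: measurableT_comp.
have rr0 z : (0 <= (rho z * rho (- z))%:E * (\1_(unit_itv b) z : R)%:E)%E.
  by rewrite mule_ge0// lee_fin mulr_ge0 ?expR_ge0.
have mc (c : R) : measurable_fun setT (fun z => c%:E * (\1_(unit_itv b) z : R)%:E)%E.
  by apply: measurable_funeM; exact/measurable_EFinP/measurable_indic.
have Ec (c : R) : 0 <= c -> (\int[leb]_z (c%:E * (\1_(unit_itv b) z)%:E) = c%:E)%E.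
  move=> c0; rewrite ge0_integralZl//; last exact/measurable_EFinP/measurable_indic.
  by rewrite integral_indic// setIT [X in (_ * X)%E](leb_unit b) mule1.
have [q2_gt0|q2_le0] := ltP 0 q2.
  have : ((expR 2)%:E <= 1 :> \bar R)%E.
    rewrite -E -(Ec (expR 2))// ?expR_ge0//; apply: ge0_le_integral => //.
    move=> z _; rewrite indicE; have [zb|] := boolP (z \in _); last by rewrite !mule0.
    rewrite !mule1 lee_fin rrE ler_expR.
    have := bz z (set_mem zb); rewrite (gtr0_norm q2_gt0) => h.
    have := ler_norm (- q0); rewrite normrN; lra.
  by rewrite lee_fin leNgt expR_gt1 ltr0n.
have : (1 <= (expR (- 2))%:E :> \bar R)%E.
  rewrite -[leLHS]E -(Ec (expR (- 2)))// ?expR_ge0//; apply: ge0_le_integral => //.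
  move=> z _; rewrite indicE; have [zb|] := boolP (z \in _); last by rewrite !mule0.
  rewrite !mule1 lee_fin rrE ler_expR.
  have := bz z (set_mem zb); rewrite (ler0_norm q2_le0) => h.
  have := ler_norm q0; lra.
by rewrite lee_fin leNgt expR_lt1 oppr_lt0 ltr0n.
Qed.

(** With [q2 = 0], [rho (v - y)] splits as [expR (q0 - q1 * y) * expR (q1 * v)]. Testing with [u] in
    [A] and [y] in the unit interval gives [lambda = - q1], and [alpha] is the integral of
    [expR (q0 - q1 * y)] over that interval against [m]. *)
Lemma reversible_exponential : exists alpha lambda : R, 0 < alpha /\
  forall B : set R, measurable B -> m B = (alpha%:E * exp_measure lambda B)%E.
Proof.
pose I01 : set R := `[0, 1]%classic.
have mI : measurable I01 by exact: measurable_itv.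
have lI : leb I01 = 1%E by rewrite [LHS]lebesgue_measure_itv/= lte_fin ltr01 sube0.
pose al := (\int[m]_y (\1_I01 y * expR (q0 - q1 * y))%:E)%E.
have mal : measurable_fun setT (fun y : R => (\1_I01 y * expR (q0 - q1 * y))%:E).
  apply/measurable_EFinP; apply: measurable_funM; first exact: measurable_indic.
  by apply: measurableT_comp => //; apply: measurable_funB => //; exact: measurable_funM.
have al0 : (0 <= al)%E by apply: integral_ge0 => y _; rewrite lee_fin mulr_ge0 ?expR_ge0.
have mE A : measurable A -> m A = (al * exp_measure (- q1) A)%E.
  move=> mA; pose F (p : R * R) : \bar R := (\1_A p.1 * \1_I01 p.2)%:E.
  have mF : measurable_fun setT F.
    apply/measurable_EFinP; apply: measurable_funM.
      exact: (measurableT_comp (measurable_indic mA) measurable_fst).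
    exact: (measurableT_comp (measurable_indic mI) measurable_snd).
  have F0 p : (0 <= F p)%E by rewrite lee_fin.
  have := rev mF F0.
  have -> : (\int[m]_u \int[leb]_y F (u, y) = m A)%E.
    transitivity (\int[m]_u (\1_A u)%:E)%E; last by rewrite integral_indic// setIT.
    apply: eq_integral => u _; rewrite /F /=.
    under eq_integral do rewrite EFinM.
    rewrite ge0_integralZl//; last exact/measurable_EFinP/measurable_indic.
    by rewrite integral_indic// setIT [X in (_ * X)%E]lI mule1.
  move=> ->; rewrite exp_measureE//.
  transitivity (\int[m]_y ((\1_I01 y * expR (q0 - q1 * y))%:E *
      \int[leb]_v ((expR (- - q1 * v))%:E * (\1_A v)%:E)))%E.
    apply: eq_integral => y _; rewrite -ge0_integralZl//.
    - apply: eq_integral => v _; rewrite /F /= -!EFinM; congr (_%:E).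
      rewrite /rho reversible_quadratic_coef mul0r add0r opprK.
      have -> : q1 * (v - y) + q0 = (q0 - q1 * y) + q1 * v by ring.
      by rewrite expRD; ring.
    - apply: emeasurable_funM; last exact/measurable_EFinP/measurable_indic.
      by apply/measurable_EFinP; apply: measurableT_comp => //; exact: measurable_funM.
  rewrite ge0_integralZr//.
  by apply: integral_ge0 => v _; rewrite mule_ge0// lee_fin expR_ge0.
have aloo : (al < +oo)%E.
  apply: (@le_lt_trans _ _ (\int[m]_y ((expR (`|q0| + `|q1|))%:E * (\1_I01 y)%:E))%E).
    apply: ge0_le_integral => //.
    - by apply: measurable_funeM; exact/measurable_EFinP/measurable_indic.
    - move=> y _; rewrite -EFinM lee_fin indicE; have [yI|] := boolP (y \in _);
        last by rewrite mul0r mulr0.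
      rewrite mul1r mulr1 ler_expR; have := set_mem yI; rewrite /I01 /= in_itv/= => /andP[y0 y1].
      rewrite lerD ?ler_norm// (le_trans (ler_norm _))// normrN normrM ler_piMr//.
      by rewrite ger0_norm.
  rewrite ge0_integralZl//; last exact/measurable_EFinP/measurable_indic.
  rewrite integral_indic// setIT lte_mul_pinfty// ?lee_fin ?expR_ge0//.
  apply: le_lt_trans (gauss_integrable_itv 1 m_gauss).
  apply: le_measure; rewrite ?inE//.
  by apply: subset_itvr; rewrite bnd_simp.
have alp : 0 < fine al.
  apply: fine_gt0; rewrite aloo andbT lt_neqAle al0 andbT; apply/negP => /eqP al0'.
  by move/negP: m_neq0; apply; rewrite mE// -al0' mul0e.
exists (fine al), (- q1); split => // B mB.
by rewrite fineK ?ge0_fin_numE// mE.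
Qed.

End ReversibleIntensity.

Lemma normal_pdf_gt0 {R : realType} (mu s x : R) : s != 0 -> 0 < normal_pdf mu s x.
Proof. by move=> s0; rewrite normal_pdfE// mulr_gt0 ?expR_gt0 ?normal_peak_gt0. Qed.

Section NondegenerateSystem.
Context {R : realType} dX (TX : measurableType dX) (PX : probability TX R) (d : nat).
Variable xi : 'rV[R]_d -> {RV PX >-> R}.
Hypothesis Gxi : gaussian_process xi.
Hypothesis xi0 : {ae PX, forall w, xi 0 w = 0}.
Variable m : {measure set R -> \bar R}.
Hypothesis m_gauss : gauss_integrable m.
Hypothesis m_neq0 : m setT != 0%E.
Hypothesis inv : shift_invariant m xi.

Let m_sigma := gauss_integrable_sigma_finite m_gauss.
Let mxi t : measurable_fun setT (xi t : TX -> R). Proof. exact: measurable_funPT. Qed.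

Variables (t : 'rV[R]_d) (mu s : R).
Hypothesis s_neq0 : s != 0.
Hypothesis lawt : forall B : set R, measurable B ->
  PX [set w | B (xi t w)] = normal_law mu s B.

(** If [xi (- t)] were the constant [mu'], the reversed displacement would always be [- mu']. The
    normal law of [xi t] has no atom there, so testing the complement of that point gives [m setT]
    on one side and 0 on the other. *)
Lemma opposite_nondegenerate (mu' s' : R) :
  (forall B : set R, measurable B -> PX [set w | B (xi (- t) w)] = normal_law mu' s' B) ->
  s' != 0.
Proof.
move=> lawt'; apply/eqP => s'0.
pose B : set R := ~` [set (- mu')].
have mB : measurable B by apply: measurableC.
pose F (p : R * R) : \bar R := (\1_B (p.2 - p.1))%:E.
have mF : measurable_fun setT F.
  by apply/measurable_EFinP; exact: measurable_indic_diff.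
have F0 p : (0 <= F p)%E by rewrite lee_fin.
have := shift_invariant_reversal m_sigma inv xi0 t mF F0 => reversal.
move/negP: m_neq0; apply; apply/eqP.
transitivity (\int[m]_u \int[PX]_w F (u, u + xi t w)%R)%E.
  transitivity (\int[m]_u (cst 1 u))%E; first by rewrite integral_cst ?mul1e.
  apply: eq_integral => u _; rewrite /F /=.
  under eq_integral do rewrite addrAC subrr add0r.
  have mA : measurable ((xi t : TX -> R) @^-1` B).
    by apply: measurable_preimage => //; exact: mxi.
  transitivity (PX ((xi t : TX -> R) @^-1` B)); last first.
    by rewrite -[X in PX X]setIT -integral_indic.
  rewrite [RHS](lawt mB) /normal_law (negbTE s_neq0).
  have e1 : normal_prob mu s [set - mu'] = 0%E by exact: integral_set1.
  have e2 := @probability_setC _ _ _ (normal_prob mu s) _ (@measurable_set1 R (- mu')).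
  by rewrite [RHS]e2 [X in (_ - X)%E]e1 sube0.
transitivity (\int[m]_y (cst 0 y))%E; last by rewrite integral0.
rewrite reversal; apply: eq_integral => y _; rewrite /F /=.
have mf : measurable_fun setT (fun x : R => (\1_B (- x) : R)%:E).
  apply/measurable_EFinP; exact: (measurableT_comp (measurable_indic mB)).
have f0 (x : R) : (0 <= (\1_B (- x) : R)%:E)%E by [].
transitivity (\int[PX]_w (\1_B (- xi (- t) w) : R)%:E)%E.
  by apply: eq_integral => w _; rewrite opprD addrA subrr add0r.
refine (etrans (normal_law_dirac (mxi (- t)) lawt' s'0 mf f0) _).
by rewrite indicE memNset; [by []|move=> h; exact: h].
Qed.

Lemma nondegenerate_exponential : exists alpha lambda : R, 0 < alpha /\
  forall B : set R, measurable B -> m B = (alpha%:E * exp_measure lambda B)%E.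
Proof.
have [mu' [s' lawt']] := gaussian_process_law Gxi (- t).
have s'0 := opposite_nondegenerate lawt'.
have [q0 [q1 [q2 rhoE]]] := normal_pdf_quadratic mu' mu s'0 s_neq0.
apply: (@reversible_exponential _ _ m_gauss m_neq0 q0 q1 q2) => F mF F0.
have mq : measurable_fun setT (fun x : R => expR (q2 * x ^+ 2 + q1 * x + q0)).
  apply: measurableT_comp => //; apply: measurable_funD => //.
  by apply: measurable_funD; exact: measurable_funM.
pose p := normal_pdf mu s.
have p0 z : 0 < p z by exact: normal_pdf_gt0.
have pV z : normal_pdf mu s z * (p z)^-1 = 1 by exact: mulfV (lt0r_neq0 (p0 z)).
have mp : measurable_fun setT (fun x : R => p x) by exact: measurable_normal_pdf.
have mpV : measurable_fun setT (fun x : R => (p x)^-1).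
  rewrite (_ : (fun x => _) = (fun x => expR (- ln (p x)))).
    by do 2 apply: measurableT_comp => //; apply: measurableT_comp => //; exact: measurable_ln.
  by apply/funext => x; rewrite expRN lnK// posrE.
(* Dividing by the density of the displacement turns the left side into an integral against Lebesgue
   measure and produces the ratio [rho] on the right. *)
pose F' (x : R * R) : \bar R := ((p (x.2 - x.1))^-1%:E * F x)%E.
have mF' : measurable_fun setT F'.
  apply: emeasurable_funM => //; apply/measurable_EFinP.
  apply: (measurableT_comp mpV (g := fun x : R * R => x.2 - x.1)).
  exact: measurable_funB.
have F'0 x : (0 <= F' x)%E by rewrite mule_ge0// lee_fin invr_ge0 ltW.
have reversal := shift_invariant_reversal m_sigma inv xi0 t mF' F'0.
have pair_l (G : R * R -> \bar R) u : measurable_fun setT G ->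
    measurable_fun setT (fun z => G (u, z)).
  by move=> mG; apply: (measurableT_comp mG); exact: measurable_pair1.
have pair_r (G : R * R -> \bar R) u : measurable_fun setT G ->
    measurable_fun setT (fun z => G (z, u)).
  by move=> mG; apply: (measurableT_comp mG); exact: measurable_pair2.
have comp_shift (G : R -> \bar R) u : measurable_fun setT G ->
    measurable_fun setT (fun z : R => G (u + z)%R).
  by move=> mG; apply: (measurableT_comp mG); exact: measurable_funD.
have L : (\int[m]_u \int[PX]_w F' (u, u + xi t w)%R = \int[m]_u \int[leb]_y F (u, y))%E.
  apply: eq_integral => u _.
  rewrite [LHS](normal_law_density (mxi t) lawt s_neq0 (comp_shift _ u (pair_l _ u mF'))
    (fun z => F'0 _)).
  refine (etrans _ (integral_lebesgue_shift u (pair_l _ u mF) (fun z => F0 _))).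
  apply: eq_integral => z _; rewrite /F' /= muleA -EFinM addrAC subrr add0r.
  by rewrite pV mul1e [u + z]addrC.
refine (etrans (esym L) (etrans reversal _)).
change (\int[m]_y \int[PX]_w F' (y + xi (- t) w, y)%R =
    \int[m]_y \int[leb]_v
      ((expR (q2 * (v - y) ^+ 2 + q1 * (v - y) + q0))%:E * F (v, y)))%E.
apply: eq_integral => y _.
rewrite [LHS](normal_law_density (mxi (- t)) lawt' s'0 (comp_shift _ y (pair_r _ y mF'))
  (fun z => F'0 _)).
pose g v : \bar R := ((expR (q2 * (v - y) ^+ 2 + q1 * (v - y) + q0))%:E * F (v, y))%E.
have mg : measurable_fun setT g.
  apply: emeasurable_funM; last exact: pair_r.
  apply/measurable_EFinP.
  exact: (measurableT_comp mq (measurable_funB (@measurable_id _ _ setT) (measurable_cst y))).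
have g0 v : (0 <= g v)%E by rewrite mule_ge0// lee_fin expR_ge0.
refine (etrans _ (integral_lebesgue_shift y mg g0)).
apply: eq_integral => z _; rewrite /F' /g /= muleA -EFinM opprD addrA subrr add0r addrK.
by rewrite rhoE [y + z]addrC.
Qed.

End NondegenerateSystem.

(** * Measures invariant under arbitrarily small translations *)

Section IntervalFunction.
Context {R : realType}.
Variables (mu : R -> R -> R) (c : R).
Hypothesis c0 : 0 < c.
Hypothesis mu_ge0 : forall a b, a <= b -> 0 <= mu a b.
Hypothesis muD : forall a b e, a <= b -> b <= e -> mu a e = mu a b + mu b e.
Hypothesis mu_shift : forall (k : nat) a b, (0 < k)%N -> a <= b ->
  mu (a + c / k%:R) (b + c / k%:R) = mu a b.

Let mu_shiftn (k n : nat) a b : (0 < k)%N -> a <= b ->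
  mu (a + n%:R * (c / k%:R)) (b + n%:R * (c / k%:R)) = mu a b.
Proof.
move=> k0 ab; elim: n => [|n ih]; first by rewrite !mul0r !addr0.
by rewrite -natr1 mulrDl mul1r !addrA mu_shift// lerD2r.
Qed.

Let mu_multiple (k n : nat) : (0 < k)%N ->
  mu 0 (n%:R * (c / k%:R)) = n%:R * mu 0 (c / k%:R).
Proof.
move=> k0; have d0 : 0 < c / k%:R by rewrite divr_gt0// ltr0n.
elim: n => [|n ih].
  by have := muD (lexx 0) (lexx 0); rewrite !mul0r; lra.
have nd0 : 0 <= n%:R * (c / k%:R) by rewrite mulr_ge0// ltW.
rewrite -natr1 mulrDl mul1r (muD nd0); last by rewrite lerDl ltW.
rewrite ih mulrDl mul1r; congr (_ + _).
by rewrite -(@mu_shiftn k n 0)// ?add0r 1?addrC// ltW.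
Qed.

(** Enclosing [x] between consecutive multiples of [c / k%:R] determines [mu 0 x] up to
    [mu 0 c / k%:R]; [k] is arbitrary. *)
Let mu_origin x : 0 <= x -> mu 0 x = x * (mu 0 c / c).
Proof.
move=> x0; have M0 : 0 <= mu 0 c by rewrite mu_ge0// ltW.
have bound (k : nat) : (0 < k)%N -> `|mu 0 x - x * (mu 0 c / c)| <= mu 0 c / k%:R.
  move=> k0; have k0' : 0 < k%:R :> R by rewrite ltr0n.
  pose de := c / k%:R; have d0 : 0 < de by rewrite divr_gt0.
  have Mk : mu 0 de = mu 0 c / k%:R.
    have := mu_multiple k k0; rewrite -/de.
    have -> : k%:R * de = c by rewrite /de mulrC divfK// gt_eqF.
    by move=> ->; rewrite mulrAC divff ?mul1r// gt_eqF.
  pose n := Num.trunc (x / de).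
  have xd0 : 0 <= x / de by rewrite divr_ge0// ltW.
  have n1 : n%:R * de <= x by rewrite -ler_pdivlMr// truncn_le.
  have n2 : x <= n.+1%:R * de by rewrite -ler_pdivrMr// ltW// truncnS_gt.
  have nd0 : 0 <= n%:R * de by rewrite mulr_ge0// ltW.
  have G1 : n%:R * mu 0 de <= mu 0 x.
    by rewrite -mu_multiple// (muD nd0 n1) lerDl mu_ge0.
  have G2 : mu 0 x <= n.+1%:R * mu 0 de.
    by rewrite -mu_multiple// (muD x0 n2) lerDl mu_ge0.
  have xE : x * (mu 0 c / c) = x / de * mu 0 de.
    by rewrite Mk /de; field; rewrite !gt_eqF.
  have m0 : 0 <= mu 0 de by rewrite mu_ge0// ltW.
  have y1 : n%:R <= x / de by rewrite truncn_le.
  have y2 : x / de <= n%:R + 1 by rewrite natr1 ltW// truncnS_gt.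
  rewrite -natr1 in G2; rewrite -Mk xE ler_norml; move: (x / de) y1 y2 => y y1 y2.
  by apply/andP; split; nra.
apply/eqP; rewrite -subr_eq0 -normr_le0 leNgt; apply/negP => e0.
set e := `|_| in e0 bound.
pose k := (Num.trunc (mu 0 c / e)).+1.
have := bound k isT; rewrite ler_pdivlMr ?ltr0n// leNgt => /negP; apply.
by rewrite mulrC -ltr_pdivrMr// truncnS_gt.
Qed.

(** A shift by a large multiple of [c] brings the interval to the right of 0, where additivity
    reduces it to intervals starting at the origin. *)
Lemma shift_invariant_length a b : a <= b -> mu a b = (b - a) * (mu 0 c / c).
Proof.
move=> ab; pose N := (Num.trunc (`|a| / c)).+1.
have aN : 0 <= a + N%:R * c.
  have : `|a| / c < N%:R by exact: truncnS_gt.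
  rewrite ltr_pdivrMr// => h; have := ler_norm (- a); rewrite normrN; lra.
have := @mu_shiftn 1 N a b isT ab; rewrite divr1 => <-.
have bN : a + N%:R * c <= b + N%:R * c by rewrite lerD2r.
have := muD aN bN; rewrite (mu_origin aN) (mu_origin (le_trans aN bN)).
move=> h; apply: (addrI ((a + N%:R * c) * (mu 0 c / c))); rewrite -h; ring.
Qed.

End IntervalFunction.

Section TranslationInvariantMeasure.
Context {R : realType}.
Variable m : {measure set R -> \bar R}.
Hypothesis m_gauss : gauss_integrable m.
Hypothesis m_neq0 : m setT != 0%E.
Variable c : R.
Hypothesis c_neq0 : c != 0.
Hypothesis m_shift : forall (k : nat) A, (0 < k)%N -> measurable A ->
  m ((fun x => x + c / k%:R) @^-1` A) = m A.

(** Normalizes the sign of [c]: the preimage is [A] moved to the right by [|c| / k%:R]. *)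
Let m_shift_abs (k : nat) A : (0 < k)%N -> measurable A ->
  m ((fun x => x - `|c| / k%:R) @^-1` A) = m A.
Proof.
move=> k0 mA; have [c0|c0] := leP 0 c.
  have mA' : measurable ((fun x => x - c / k%:R) @^-1` A).
    by rewrite -[X in measurable X]setTI; apply: measurable_funB.
  rewrite (ger0_norm c0) -(m_shift k0 mA'); congr (m _).
  by apply/seteqP; split => x /=; rewrite addrK.
by rewrite (ltr0_norm c0) mulNr opprK m_shift.
Qed.

Let itv (a b : R) : set R := `]a, b]%classic.

Let m_itv_fin a b : m (itv a b) \is a fin_num.
Proof.
rewrite ge0_fin_numE//; apply: le_lt_trans (gauss_integrable_itv (`|a| + `|b|) m_gauss).
apply: le_measure; rewrite ?inE; [exact: measurable_itv|exact: measurable_itv|].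
move=> x; rewrite /itv /= !in_itv/= => /andP[ax xb].
have := ler_norm (- a); have := ler_norm b; rewrite normrN.
have := normr_ge0 a; have := normr_ge0 b; move=> *; apply/andP; split; lra.
Qed.

Lemma translation_invariant_lebesgue : exists alpha : R, 0 < alpha /\
  forall B : set R, measurable B -> m B = (alpha%:E * leb B)%E.
Proof.
have mI a b : measurable (itv a b) by exact: measurable_itv.
pose mu a b := fine (m (itv a b)).
have muE a b : m (itv a b) = (mu a b)%:E by rewrite fineK.
have c0 : 0 < `|c| by rewrite normr_gt0.
have mu0 a b : a <= b -> 0 <= mu a b by move=> _; rewrite fine_ge0.
have muD a b e : a <= b -> b <= e -> mu a e = mu a b + mu b e.
  move=> ab be; apply: EFin_inj; rewrite EFinD -!muE.
  have -> : itv a e = itv a b `|` itv b e.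
    apply/seteqP; split => x; rewrite /itv /= !in_itv/=.
      by move=> /andP[ax xe]; have [xb|bx] := leP x b; [left|right]; rewrite ?ax.
    by move=> [/andP[-> xb]|/andP[bx ->]]; rewrite ?(le_trans xb)// (le_lt_trans ab).
  rewrite measureU//.
  apply/seteqP; split => // x []; rewrite /itv /= !in_itv/= => /andP[_ xb] /andP[bx _].
  by have := lt_le_trans bx xb; rewrite ltxx.
have mu_shift (k : nat) a b : (0 < k)%N -> a <= b ->
    mu (a + `|c| / k%:R) (b + `|c| / k%:R) = mu a b.
  move=> k0 ab; rewrite /mu -(m_shift_abs k0 (mI a b)); congr (fine (m _)).
  by apply/seteqP; split => x; rewrite /itv /= !in_itv/= ltrBrDr lerBlDr.
have L := shift_invariant_length c0 mu0 muD mu_shift.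
set al := mu 0 `|c| / `|c| in L.
have al0 : 0 < al.
  rewrite divr_gt0// lt_neqAle mu0 ?ltW// andbT; apply/eqP => M0.
  have [n] := exists_positive_itv m_neq0; rewrite ltNge => /negP; apply.
  (* The left end is moved by 1 because [itv] excludes it while the given interval is closed. *)
  apply: (@le_trans _ _ (m (itv (- n%:R - 1) n%:R))).
    apply: le_measure; rewrite ?inE; [exact: measurable_itv|exact: measurable_itv|].
    by move=> x; rewrite /itv /= !in_itv/= => /andP[? ->]; rewrite andbT; lra.
  rewrite muE L; last by have := ler0n R n; lra.
  by rewrite /al -M0 mul0r mulr0.
exists al; split => // B mB.
(* The measure [m] divided by [al] has the values of Lebesgue measure on half-open intervals, which
   characterize it. *)
have [nu [nuA _]] := exists_density_measure m (measurable_cst al^-1)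
  (fun=> (ltW (etrans (invr_gt0 al) al0))).
have nuE A : measurable A -> nu A = (al^-1%:E * m A)%E.
  move=> mA; rewrite nuA//= ge0_integralZl//.
  - by rewrite integral_indic// setIT.
  - exact/measurable_EFinP/measurable_indic.
  - by rewrite lee_fin invr_ge0 ltW.
have mid : measurable_fun setT (fun x : R => x : measurableTypeR R) by exact: measurable_id.
pose nu' : {measure set (measurableTypeR R) -> \bar R} :=
  pushforward nu (fun x : R => x : measurableTypeR R).
have : lebesgue_measure B = nu B.
  apply: (lebesgue_measure_unique (mu := nu' mid)) => // X [[a b] _ <-].
  rewrite /nu' /= /pushforward preimage_id nuE; last exact: measurable_itv.
  rewrite lebesgue_measure_itv/= lte_fin.
  have [ab|ba] := ltP a b.
    rewrite muE L ?(ltW ab)// -EFinB -EFinM; congr (_%:E).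
    by rewrite mulrCA mulVf ?mulr1// gt_eqF.
  by rewrite set_itv_ge ?measure0 ?mule0// bnd_simp -leNgt.
by rewrite /leb => ->; rewrite nuE// muleA -EFinM divff ?mul1e// lt0r_neq0.
Qed.

End TranslationInvariantMeasure.

Section DegenerateSystem.
Context {R : realType} dX (TX : measurableType dX) (PX : probability TX R) (d : nat).
Variable xi : 'rV[R]_d -> {RV PX >-> R}.
Hypothesis Gxi : gaussian_process xi.
Hypothesis xi0 : {ae PX, forall w, xi 0 w = 0}.
Hypothesis xi_neq0 : exists t0, ~ {ae PX, forall w, xi t0 w = 0}.
Variable m : {measure set R -> \bar R}.
Hypothesis m_gauss : gauss_integrable m.
Hypothesis m_neq0 : m setT != 0%E.
Hypothesis inv : shift_invariant m xi.
Hypothesis degenerate : forall t mu s, (forall B : set R, measurable B ->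
  PX [set w | B (xi t w)] = normal_law mu s B) -> s = 0.

Let m_sigma := gauss_integrable_sigma_finite m_gauss.
Let mxi t : measurable_fun setT (xi t : TX -> R). Proof. exact: measurable_funPT. Qed.

Let degenerate_ae t : exists mu, {ae PX, forall w, xi t w = mu}.
Proof.
have [mu [s law]] := gaussian_process_law Gxi t.
exists mu, ((xi t : TX -> R) @^-1` (~` [set mu])); split => //.
  by rewrite -[X in measurable X]setTI; apply: mxi => //; exact: measurableC.
have mB : measurable (~` [set mu] : set R) by exact: measurableC.
rewrite [LHS](law _ mB) /normal_law (degenerate law) eqxx diracE memNset//.
by move=> h; exact: h.
Qed.

Let f t := projT1 (cid (degenerate_ae t)).

Let xi_f t : {ae PX, forall w, xi t w = f t}.
Proof. exact: projT2 (cid (degenerate_ae t)). Qed.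

Let ae_point (Q : TX -> Prop) : {ae PX, forall w, Q w} -> exists w, Q w.
Proof.
move=> [A [mA PA0 QA]]; apply: contrapT => nQ.
have AT : A = setT.
  by apply/seteqP; split => // w _; apply: QA => /= Qw; apply: nQ; exists w.
by move: PA0; rewrite AT probability_setT => -[] /eqP; rewrite oner_eq0.
Qed.

Let f0 : f 0 = 0.
Proof.
have [w [<- //]] : exists w, xi 0 w = f 0 /\ xi 0 w = 0.
by apply: ae_point; apply: filterI xi0; exact: xi_f.
Qed.

Let two_points h s t (F : R * R -> \bar R) : measurable_fun setT F -> (forall p, 0 <= F p)%E ->
  (\int[m]_u F (u + f (s + h), u + f (t + h))%R = \int[m]_u F (u + f s, u + f t)%R)%E.
Proof.
move=> mF F0.
have E a b u : (\int[PX]_w F (u + xi a w, u + xi b w)%R = F (u + f a, u + f b)%R)%E.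
  transitivity (\int[PX]_w (cst (F (u + f a, u + f b)%R) w))%E; last first.
    by rewrite integral_cst//= probability_setT mule1.
  apply: ge0_ae_eq_integral => //.
  - by apply: (measurable_comp2 mF); exact: measurable_funD.
  - by move=> w _; exact: F0.
  - by apply: filterS2 (xi_f a) (xi_f b) => w -> ->.
transitivity (\int[m]_u \int[PX]_w F (u + xi (s + h) w, u + xi (t + h) w)%R)%E.
  by apply: eq_integral => u _; rewrite E.
rewrite (shift_invariant2 m_sigma inv h s t mF F0).
by apply: eq_integral => u _; rewrite E.
Qed.

(** Between the times 0 and [s] every particle moves by [f s], between [t] and [s + t] by
    [f (s + t) - f t]. If these differed, testing for displacements other than [f s] would give 0
    and [m setT]. *)
Let fD s t : f (s + t) = f s + f t.
Proof.
apply: contrapT => /eqP fst.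
pose B : set R := ~` [set f s].
have mB : measurable B by exact: measurableC.
pose F (p : R * R) : \bar R := (\1_B (p.2 - p.1))%:E.
have mF : measurable_fun setT F.
  by apply/measurable_EFinP; exact: measurable_indic_diff.
have F0 p : (0 <= F p)%E by rewrite lee_fin.
have E := two_points t 0 s mF F0.
have L : (\int[m]_u F (u + f (0 + t), u + f (s + t))%R = m setT)%E.
  transitivity (\int[m]_u (cst 1 u))%E; last by rewrite integral_cst ?mul1e.
  apply: eq_integral => u _; rewrite /F /= add0r opprD addrACA subrr add0r.
  rewrite indicE mem_set//; move/eqP: fst => fst h; apply: fst.
  by rewrite -h subrK.
have R0 : (\int[m]_u F (u + f 0, u + f s)%R = 0)%E.
  transitivity (\int[m]_u (cst 0 u))%E; last by rewrite integral0.
  apply: eq_integral => u _; rewrite /F /= f0 addr0 addrAC subrr add0r.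
  by rewrite indicE memNset// => h; exact: h.
by move/negP: m_neq0; apply; apply/eqP; rewrite -L E R0.
Qed.

Lemma degenerate_lebesgue : exists alpha : R, 0 < alpha /\
  forall B : set R, measurable B -> m B = (alpha%:E * leb B)%E.
Proof.
have [t0 xit0] := xi_neq0.
have ft0 : f t0 != 0.
  by apply/eqP => ft0; apply: xit0; have := xi_f t0; rewrite ft0.
have fn (n : nat) s : f (s *+ n) = f s *+ n.
  by elim: n => [|n ih]; rewrite ?mulr0n// !mulrS fD ih.
have fk (k : nat) : (0 < k)%N -> f (k%:R^-1 *: t0) = f t0 / k%:R.
  move=> k0; have k0' : k%:R != 0 :> R by rewrite pnatr_eq0 -lt0n.
  apply: (mulfI k0'); rewrite mulrCA divff// mulr1 mulr_natl -fn.
  by rewrite -scaler_nat scalerA divff// scale1r.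
apply: (translation_invariant_lebesgue m_gauss m_neq0 ft0) => k A k0 mA.
have mAk : measurable ((fun x => x + f t0 / k%:R) @^-1` A).
  by rewrite -[X in measurable X]setTI; apply: measurable_funD.
pose F (p : R * R) : \bar R := (\1_A p.1)%:E.
have mF : measurable_fun setT F.
  by apply/measurable_EFinP; exact: (measurableT_comp (measurable_indic mA) measurable_fst).
have F0 p : (0 <= F p)%E by rewrite lee_fin.
have := two_points (k%:R^-1 *: t0) 0 0 mF F0.
rewrite /F /= add0r fk// f0.
under [X in _ = X -> _]eq_integral do rewrite addr0.
move=> E; transitivity (\int[m]_u (\1_A (u + f t0 / k%:R)%R)%:E)%E.
  by rewrite -[X in m X]setIT -integral_indic.
by rewrite E integral_indic// setIT.
Qed.

End DegenerateSystem.

(** * Processes with stationary increments *)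

Section Exponents.
Context {R : realType} (I : Type).

(** One index with coefficients 1 and -1 gives means and variances; two indices with coefficients 1
    give the covariances, by symmetry. *)
Lemma gaussian_exponent_inj (m1 m2 : I -> R) (c1 c2 : I -> I -> R) :
  (forall s t, c1 s t = c1 t s) -> (forall s t, c2 s t = c2 t s) ->
  (forall n (t : 'I_n -> I) (a : 'I_n -> R),
    \sum_j a j * m1 (t j) + (\sum_i \sum_j a i * a j * c1 (t i) (t j)) / 2 =
    \sum_j a j * m2 (t j) + (\sum_i \sum_j a i * a j * c2 (t i) (t j)) / 2) ->
  (forall t, m1 t = m2 t) /\ forall s t, c1 s t = c2 s t.
Proof.
move=> s1 s2 E.
have E1 t : m1 t = m2 t /\ c1 t t = c2 t t.
  have := E 1%N (fun=> t) (fun=> -1); have := E 1%N (fun=> t) (fun=> 1).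
  by rewrite !big_ord1; split; lra.
split=> [t|s t]; first by have [] := E1 t.
have [es1 es2] := E1 s; have [et1 et2] := E1 t.
have := E 2%N (fun i => if i == ord0 then s else t) (fun=> 1).
rewrite !big_ord_recl !big_ord0 /= !addr0 !mul1r es1 et1 es2 et2.
by rewrite (s1 t s) (s2 t s); lra.
Qed.

End Exponents.

Section FiniteDimensionalLaws.
Context {R : realType} d1 d2 (T1 : measurableType d1) (T2 : measurableType d2).
Variables (P1 : probability T1 R) (P2 : probability T2 R) (I : Type).

Lemma same_fdd_mgf (X : I -> T1 -> R) (Y : I -> T2 -> R) :
  (forall t, measurable_fun setT (X t)) -> (forall t, measurable_fun setT (Y t)) ->
  same_fdd P1 P2 X Y -> forall n (t : 'I_n -> I) (a : 'I_n -> R),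
  (\int[P1]_w (expR (\sum_j a j * X (t j) w))%:E =
   \int[P2]_w (expR (\sum_j a j * Y (t j) w))%:E)%E.
Proof.
move=> mX mY XY n t a.
pose tt := [tuple t j | j < n].
pose h (x : n.-tuple R) : \bar R := (expR (\sum_j a j * tnth x j))%:E.
have mh : measurable_fun setT h.
  by apply/measurable_EFinP/measurable_expR_comb => j; exact: measurable_tnth.
have h0 x : (0 <= h x)%E by rewrite lee_fin expR_ge0.
have := eq_integral_comp_law (measurable_tuple_of_process tt mX)
  (measurable_tuple_of_process tt mY) (fun A mA => XY n tt A mA) mh h0.
rewrite /h => E; transitivity (\int[P1]_w h (tuple_of_process X tt w))%E.
  by apply: eq_integral => w _; congr (expR _)%:E; apply: eq_bigr => j _; rewrite !tnth_mktuple.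
rewrite E; apply: eq_integral => w _; congr (expR _)%:E.
by apply: eq_bigr => j _; rewrite !tnth_mktuple.
Qed.

(** The common value is asked to be a real number: this is the integrability behind uniqueness of
    the moment generating function. *)
Lemma mgf_same_fdd (X : I -> T1 -> R) (Y : I -> T2 -> R) :
  (forall t, measurable_fun setT (X t)) -> (forall t, measurable_fun setT (Y t)) ->
  (forall n (t : 'I_n -> I) (a : 'I_n -> R), exists c : R,
    (\int[P1]_w (expR (\sum_j a j * X (t j) w))%:E = c%:E /\
     \int[P2]_w (expR (\sum_j a j * Y (t j) w))%:E = c%:E)%E) ->
  same_fdd P1 P2 X Y.
Proof.
move=> mX mY XY n t A mA.
apply: (mgf_unique (fun j => mX (tnth t j)) (fun j => mY (tnth t j)) _ mA) => a.
have [c [e1 e2]] := XY n (tnth t) a.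
split; last by rewrite e1 e2.
- by apply: integrable_expR_comb => //; rewrite e1 ltry.
- by apply: integrable_expR_comb => //; rewrite e2 ltry.
Qed.

End FiniteDimensionalLaws.

Section GaussianZero.
Context {R : realType} d (T : measurableType d) (P : probability T R) (I : Type).
Variable X : I -> {RV P >-> R}.
Hypothesis GX : gaussian_process X.

(** Setting the coefficient of [X o] to 0 leaves every moment generating function unchanged, so all
    terms of the exponent that contain this coefficient cancel. *)
Lemma gaussian_cov_ae0 o : {ae P, forall w, X o w = 0} ->
  mean P (X o) = 0 /\ forall t, cov P (X t) (X o) = 0.
Proof.
move=> Xo.
have E t (a b : R) : b * mean P (X o) + a * b * cov P (X t) (X o) +
    b ^+ 2 * cov P (X o) (X o) / 2 = 0.
  pose tt (i : 'I_2) := if i == ord0 then t else o.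
  have : (\int[P]_w (expR (\sum_(j < 2) (if j == ord0 then a else b) * X (tt j) w))%:E =
      \int[P]_w (expR (\sum_(j < 2) (if j == ord0 then a else 0) * X (tt j) w))%:E)%E.
    have mE (c : 'I_2 -> R) : measurable_fun setT
        (fun w => (expR (\sum_(j < 2) c j * X (tt j) w))%:E).
      by apply/measurable_EFinP/measurable_expR_comb => j; exact: measurable_funPT.
    apply: ge0_ae_eq_integral => //.
    apply: filterS Xo => w Xow _; congr (expR _)%:E.
    by rewrite !big_ord_recl !big_ord0 /tt /= Xow !mulr0.
  rewrite !gaussian_mgf// => -[/expR_inj].
  rewrite !big_ord_recl !big_ord0 /tt /= [cov P (X o) (X t)]covC => h; lra.
have m0 : mean P (X o) = 0 by have := E o 0 1; have := E o 0 (-1); lra.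
have c0 : cov P (X o) (X o) = 0 by have := E o 0 1; lra.
split=> // t; have := E t 1 1; lra.
Qed.

End GaussianZero.

Section NormalShift.
Context {R : realType}.

Lemma normal_probE (mu s : R) (A : set R) : measurable A ->
  normal_prob mu s A = (\int[leb]_x ((normal_pdf mu s x)%:E * (\1_A x)%:E))%E.
Proof.
move=> mA.
have mA1 : measurable_fun setT (fun x : R => (\1_A x : R)%:E).
  exact/measurable_EFinP/measurable_indic.
transitivity (\int[normal_prob mu s]_x (\1_A x)%:E)%E.
  by rewrite integral_indic// setIT.
exact: integral_normal_prob.
Qed.

Lemma normal_law_shift (mu s c : R) (B : set R) : measurable B ->
  normal_law mu s ((fun x => x - c) @^-1` B) = normal_law (mu - c) s B.
Proof.
move=> mB; rewrite /normal_law; have [_|s0] := eqVneq s 0.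
  by rewrite !diracE.
have mB' : measurable ((fun x => x - c) @^-1` B).
  by rewrite -[X in measurable X]setTI; apply: measurable_funB.
rewrite !normal_probE//.
have mg : measurable_fun setT (fun x =>
    (normal_pdf mu s x)%:E * (\1_((fun x => x - c) @^-1` B) x : R)%:E)%E.
  apply: emeasurable_funM; apply/measurable_EFinP; first exact: measurable_normal_pdf.
  exact: measurable_indic.
have g0 (x : R) : (0 <= (normal_pdf mu s x)%:E * (\1_((fun x => x - c) @^-1` B) x : R)%:E)%E.
  by rewrite mule_ge0// lee_fin normal_pdf_ge0.
rewrite -(integral_lebesgue_shift c mg g0); apply: eq_integral => x _.
congr (_%:E * _)%E; first by rewrite !normal_pdfE// /normal_fun opprB addrA.
congr (_%:E); rewrite !indicE; congr (nat_of_bool _)%:R.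
by apply/idP/idP => /set_mem h; apply/mem_set; move: h; rewrite /= addrK.
Qed.

End NormalShift.

Section CenteredProcess.
Context {R : realType} dX (TX : measurableType dX) (PX : probability TX R) (d : nat).
Variable xi : 'rV[R]_d -> {RV PX >-> R}.
Hypothesis Gxi : gaussian_process xi.
Local Notation mu t := (mean PX (xi t)).
Local Notation c s t := (cov PX (xi s) (xi t)).

Let mxi t : measurable_fun setT (xi t : TX -> R). Proof. exact: measurable_funPT. Qed.
Let xi2 t : (xi t : TX -> R) \in Lfun PX 2%:E. Proof. exact: gaussian_process_L2. Qed.

Let center_fun t w := xi t w - mu t.
Let mcenter_fun t : measurable_fun setT (center_fun t). Proof. exact: measurable_funB. Qed.

Definition center t : {RV PX >-> R} := HB.pack (center_fun t)
  (isMeasurableFun.Build _ _ _ _ (center_fun t) (mcenter_fun t)).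

Lemma center_gaussian : gaussian_process center.
Proof.
move=> n t a; have [m [s law]] := Gxi t a.
pose k := \sum_j a j * mu (t j).
exists (m - k), s => B mB; rewrite -normal_law_shift// -law; last first.
  by rewrite -[X in measurable X]setTI; apply: measurable_funB.
congr (PX _); apply/funext => w /=; congr B.
under eq_bigr do rewrite /center_fun mulrBr.
by rewrite sumrB.
Qed.

Lemma center_moments t : [/\ (center t : TX -> R) \in Lfun PX 2%:E,
  ('E_PX[center t] = 0)%E & variance PX (center t) = (c t t)%:E].
Proof.
have k2 : (cst (mu t) : TX -> R) \in Lfun PX 2%:E by exact: Lfun_cst.
have cE : (center t : TX -> R) = (xi t : TX -> R) \- cst (mu t) by [].
have W2 : (center t : TX -> R) \in Lfun PX 2%:E by exact: gaussian_process_L2 center_gaussian t.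
split=> //.
  by rewrite cE expectationB ?L2_L1// expectation_cst meanE// subee.
rewrite /variance [X in covariance PX X]cE covarianceBl// covariance_cst_l sube0.
by rewrite cE covarianceBr// covariance_cst_r sube0 covE.
Qed.

(** The case [l = 0] of [mgf_increments]: centering removes the linear part, and the quadratic part
    is independent of [h] by hypothesis. *)
Lemma center_stationary_increments :
  (forall h s t, cov PX (increment xi h s) (increment xi h t) = c s t) ->
  stationary_increments center.
Proof.
move=> e3; split=> [t|h1 h2].
  have [W2 E0 _] := center_moments t; split => //.
  by apply/Lfun1_integrable; exact: L2_L1.
have mW h t : measurable_fun setT (fun w => center (t + h) w - center h w).
  by apply: measurable_funB; exact: measurable_funPT.
apply: mgf_same_fdd => // n t a.
have mgfW h : (\int[PX]_w (expR (\sum_j a j * (center (t j + h) w - center h w)))%:E =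
    (expR ((\sum_i \sum_j a i * a j * c (t i) (t j)) / 2))%:E)%E.
  pose k := \sum_j a j * mean PX (increment xi h (t j)).
  transitivity ((expR (- k))%:E * \int[PX]_w
      (expR (0 * xi h w) * expR (\sum_j a j * increment xi h (t j) w))%:E)%E.
    rewrite -ge0_integralZl ?lee_fin ?expR_ge0//.
    - apply: eq_integral => w _; rewrite -EFinM mul0r expR0 mul1r -expRD; congr (expR _)%:E.
      rewrite /k -sumrN -big_split/=; apply: eq_bigr => j _.
      by rewrite mean_increment// /center_fun /increment; ring.
    - apply/measurable_EFinP/measurable_funM.
        by apply: measurableT_comp => //; exact: measurable_funM.
      by apply: measurable_expR_comb => j; exact: measurable_increment.
  rewrite mgf_increments// -EFinM -expRD; congr (expR _)%:E.
  have -> : \sum_j a j * (mean PX (increment xi h (t j)) +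
      0 * cov PX (xi h) (increment xi h (t j))) = k.
    by apply: eq_bigr => j _; rewrite mul0r addr0.
  under eq_bigr do under eq_bigr do rewrite e3.
  by ring.
by exists (expR ((\sum_i \sum_j a i * a j * c (t i) (t j)) / 2)).
Qed.

End CenteredProcess.

Section StationaryIncrements.
Context {R : realType} (d : nat) dW (TW : measurableType dW) (PW : probability TW R).
Variable W : 'rV[R]_d -> {RV PW >-> R}.
Hypothesis GW : gaussian_process W.
Hypothesis SW : stationary_increments W.
Hypothesis W0 : {ae PW, forall w, W 0 w = 0}.

Lemma stationary_increments_mean t : mean PW (W t) = 0.
Proof. by rewrite /mean (SW.1 t).2. Qed.

(** Increments after [h] and after 0 have the same law, hence the same covariances. After 0, the
    three terms involving [W 0] vanish. *)
Lemma stationary_increments_cov h s t :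
  cov PW (increment W h s) (increment W h t) = cov PW (W s) (W t).
Proof.
have mI k r := measurable_increment W k r.
have mgfE k n (r : 'I_n -> 'rV[R]_d) (a : 'I_n -> R) :
    (\int[PW]_w (expR (\sum_j a j * increment W k (r j) w))%:E =
     (expR (\sum_j a j * mean PW (increment W k (r j)) +
       (\sum_i \sum_j a i * a j * cov PW (increment W k (r i)) (increment W k (r j))) / 2))%:E)%E.
  have := mgf_increments GW 0 k r a; rewrite mul0r expr0n/= !mul0r addr0 add0r.
  under [X in expR (X + _)]eq_bigr do rewrite mul0r addr0.
  by move=> <-; apply: eq_integral => w _; rewrite mul0r expR0 mul1r.
have [_ E] := @gaussian_exponent_inj R _ (fun r => mean PW (increment W h r))
  (fun r => mean PW (increment W 0 r))
  (fun r q => cov PW (increment W h r) (increment W h q))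
  (fun r q => cov PW (increment W 0 r) (increment W 0 q))
  (fun r q => covC PW _ _) (fun r q => covC PW _ _)
  (fun n r a => expR_inj (EFin_inj (etrans (esym (mgfE h n r a)) (etrans
    (same_fdd_mgf (mI h) (mI 0) (SW.2 h 0) r a) (mgfE 0 n r a))))).
have [_ c0] := gaussian_cov_ae0 GW W0.
by rewrite E cov_increment// !addr0 !c0 [cov PW (W 0) _]covC c0; ring.
Qed.

End StationaryIncrements.

Section TiltFromRepresentation.
Context {R : realType} (d : nat) dX dW (TX : measurableType dX) (TW : measurableType dW).
Variables (PX : probability TX R) (PW : probability TW R).
Variables (xi : 'rV[R]_d -> {RV PX >-> R}) (W : 'rV[R]_d -> {RV PW >-> R}).
Hypotheses (Gxi : gaussian_process xi) (GW : gaussian_process W).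
Hypotheses (SW : stationary_increments W) (W0 : {ae PW, forall w, W 0 w = 0}).
Variables (g : 'rV[R]_d -> R) (lambda : R).
Hypothesis xiW : same_fdd PX PW (fun t => xi t : TX -> R) (fun t w => W t w + g t).

Lemma representation_moments : (forall t, mean PX (xi t) = g t) /\
  forall s t, cov PX (xi s) (xi t) = cov PW (W s) (W t).
Proof.
have mxi t : measurable_fun setT (xi t : TX -> R) by exact: measurable_funPT.
have mW t : measurable_fun setT (W t : TW -> R) by exact: measurable_funPT.
have mWg t : measurable_fun setT (fun w => W t w + g t) by exact: measurable_funD.
have mgfE n (t : 'I_n -> 'rV[R]_d) (a : 'I_n -> R) :
    (\int[PW]_w (expR (\sum_j a j * (W (t j) w + g (t j))))%:E =
     (expR (\sum_j a j * g (t j) +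
       (\sum_i \sum_j a i * a j * cov PW (W (t i)) (W (t j))) / 2))%:E)%E.
  transitivity ((expR (\sum_j a j * g (t j)))%:E * \int[PW]_w (expR (\sum_j a j * W (t j) w))%:E)%E.
    rewrite -ge0_integralZl ?lee_fin ?expR_ge0//.
      apply: eq_integral => w _; rewrite -EFinM -expRD; congr (expR _)%:E.
      by rewrite -big_split/=; apply: eq_bigr => j _; rewrite mulrDr addrC.
    by apply/measurable_EFinP; exact: measurable_expR_comb.
  rewrite gaussian_mgf// -EFinM -expRD; congr (expR (_ + _))%:E.
  rewrite big1 ?add0r// => j _; rewrite stationary_increments_mean//; exact: mulr0.
apply: (@gaussian_exponent_inj R _ (fun t => mean PX (xi t)) g
  (fun s t => cov PX (xi s) (xi t)) (fun s t => cov PW (W s) (W t))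
  (fun s t => covC PX _ _) (fun s t => covC PW _ _)) => n t a.
exact: expR_inj (EFin_inj (etrans (esym (gaussian_mgf Gxi t a))
  (etrans (same_fdd_mgf mxi mWg xiW t a) (mgfE n t a)))).
Qed.

Hypothesis drift : (lambda = 0 /\ {morph g : s t / s + t}) \/
  forall t, g t = - (lambda * cov PW (W t) (W t) / 2).

(** For the drift [- lambda * sigma^2 / 2] the mean condition follows from the variance of an
    increment: [sigma^2 (t + h) - 2 * cov + sigma^2 h = sigma^2 t], with [cov] the covariance at the
    times [t + h] and [h]. *)
Lemma representation_tilt : tilt_invariant xi lambda.
Proof.
have [mE cE] := representation_moments.
have e3 h s t : cov PX (increment xi h s) (increment xi h t) = cov PX (xi s) (xi t).
  by rewrite cov_increment// !cE -(stationary_increments_cov GW SW W0 h s t) cov_increment.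
apply/tilt_invariantP => //; split=> // [h|h t].
  rewrite mE cE; case: drift => [[-> _]|->]; first by rewrite expr0n/= !mul0r addr0.
  by field.
rewrite mean_increment// cov_incrementr ?(gaussian_process_L2 Gxi)// !mE.
case: drift => [[-> gD]|gE]; first by rewrite gD mul0r addr0 addrK.
have := e3 h t t; rewrite cov_increment// [cov PX (xi (t + h)) (xi h)]covC !cE => E.
by rewrite !gE -E; field.
Qed.

End TiltFromRepresentation.

(** * The characterization of stationary systems *)

Unset Implicit Arguments.

(** The measure is taken nonzero since [alpha] is positive: the zero measure gives a system without
    particles, which is stationary. The process [W] may live on any probability space, as only its
    law matters. *)
Theorem corollary1p1 (R : realType) (d : nat)
    (m : {measure set R -> \bar R})
    (m_neq0 : m [set: R] != 0%E)
    (m_gauss : forall eps : R, 0 < eps ->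
      (\int[m]_x (expR (- eps * x ^+ 2))%:E < +oo)%E)
    (dX : measure_display) (TX : measurableType dX) (PX : probability TX R)
    (xi : 'rV[R]_d -> {RV PX >-> R})
    (xi_gauss : gaussian_process xi)
    (xi0 : {ae PX, forall w, xi 0 w = 0})
    (xi_neq0 : exists t0, ~ {ae PX, forall w, xi t0 w = 0})
    (dO : measure_display) (T : measurableType dO) (P : probability T R)
    (U : nat -> T -> option R) (xs : nat -> 'rV[R]_d -> {RV P >-> R})
    (GS : gaussian_system_data m xi U xs) :
  stationary_system P (particles U (fun i t => xs i t : T -> R)) <->
  exists alpha lambda : R, 0 < alpha /\
    (forall B : set R, measurable B ->
      m B = (alpha%:E * exp_measure lambda B)%E) /\
    exists (dW : measure_display) (TW : measurableType dW)
      (PW : probability TW R) (W : 'rV[R]_d -> {RV PW >-> R}),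
      gaussian_process W /\ stationary_increments W /\
      {ae PW, forall w, W 0 w = 0} /\
      ((lambda = 0 /\ exists f : 'rV[R]_d -> R,
          {morph f : s t / s + t} /\
          same_fdd PX PW (fun t => xi t : TX -> R)
            (fun t w => W t w + f t))
       \/ (lambda <> 0 /\
          same_fdd PX PW (fun t => xi t : TX -> R)
            (fun t w => W t w - lambda * fine (variance PW (W t)) / 2))).
Proof.
have m_sigma := gauss_integrable_sigma_finite m_gauss.
rewrite (stationary_shift_invariantE GS m_sigma); split; last first.
  move=> [al [la [al0 [mE [dW [TW [PW [W [GW [SW [W0 rep]]]]]]]]]]].
  apply: (tilt_invariant_shift xi_gauss al0 mE).
  case: rep => [[la0 [f [fD xiW]]]|[_ xiW]].
    by apply: (representation_tilt xi_gauss GW SW W0 xiW); left.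
  apply: (representation_tilt (g := fun t => - (la * cov PW (W t) (W t) / 2))
    xi_gauss GW SW W0 xiW).
  by right.
move=> inv.
have [al [la [al0 mE]]] : exists alpha lambda : R, 0 < alpha /\
    forall B : set R, measurable B -> m B = (alpha%:E * exp_measure lambda B)%E.
  have [[t [mu [s [s0 law]]]]|degenerate] := pselect (exists t mu s, s != 0 /\
      forall B : set R, measurable B -> PX [set w | B (xi t w)] = normal_law mu s B).
    exact: (nondegenerate_exponential xi_gauss xi0 m_gauss m_neq0 inv s0 law).
  have s0 t mu s : (forall B : set R, measurable B ->
      PX [set w | B (xi t w)] = normal_law mu s B) -> s = 0.
    by move=> law; apply: contrapT => /eqP s0; apply: degenerate; exists t, mu, s.
  have [al [al0 mE]] := degenerate_lebesgue xi_gauss xi0 xi_neq0 m_gauss m_neq0 inv s0.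
  by exists al, 0; split => // B mB; rewrite mE// exp_measure0.
have ti := shift_invariant_tilt xi0 al0 mE m_sigma inv.
have [e1 e2 e3] := (tilt_invariantP xi_gauss la).1 ti.
exists al, la; split=> //; split=> //.
(* The process [W] is [xi] minus its mean, on the same probability space. *)
exists dX, TX, PX, (center xi).
split; first exact: center_gaussian.
split; first exact: center_stationary_increments.
have [mu0 _] := gaussian_cov_ae0 xi_gauss xi0.
split; first by apply: filterS xi0 => w xi0w; rewrite /= xi0w mu0 subr0.
have [la0|la0] := eqVneq la 0; [left|right]; split=> //.
(* For [la = 0] the second tilt condition says precisely that the mean of [xi] is additive. *)
- exists (fun t => mean PX (xi t)); split.
    move=> s t /=; have := e2 t s; rewrite la0 mul0r addr0 mean_increment// => <-.
    by rewrite subrK.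
  move=> n t A mA; congr (PX _); apply/seteqP; split => w /=; congr A;
  by apply/eq_from_tnth => j; rewrite !tnth_mktuple subrK.
- exact/eqP.
- move=> n t A mA; congr (PX _).
  (* Dividing the first tilt condition by [la] gives the mean of [xi s] as [- la / 2] times its
     variance, and centering does not change the variance. *)
  have E s w : center xi s w - la * fine (variance PX (center xi s)) / 2 = xi s w.
    have [_ _ ->] := center_moments xi_gauss s; rewrite /=.
    have := e1 s; rewrite expr2 -mulrA -mulrA -mulrDr => /eqP.
    rewrite mulf_eq0 (negbTE la0)/= => /eqP; lra.
  by apply/seteqP; split => w /=; congr A; apply/eq_from_tnth => j;
    rewrite !tnth_mktuple E.
Qed.
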